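(* Let $G$ be an ample groupoid with compact unit space $G^{(0)}$. The following conditions are equivalent: (i) $G^{(0)}$ admits a $G$-invariant probability measure; (ii) $\pi$ weakly contains the trivial representation; (iii) $\mathrm{C}^*_\pi([[G]])$ admits a character; (iv) $G^{(0)}$ admits a $[[G]]$-invariant probability measure.
   Context: A topological groupoid $G$ is ample if it is locally compact, Hausdorff, étale (the range and source maps $r,s\colon G\to G$ are local homeomorphisms onto $G^{(0)}$) and its unit space $G^{(0)}$ is totally disconnected. A bisection is a subset $U\subset G$ such that $r|_U$ and $s|_U$ are injective. For an open bisection $U$, $\theta_U:=r\circ(s|_U)^{-1}\colon s(U)\to r(U)$. For $G$ ample with compact unit space, the topological full group $[[G]]$ is the group of compact open bisections $U$ with $r(U)=s(U)=G^{(0)}$, with product $UV=\{uv\mid u\in U, v\in V, s(u)=r(v)\}$, inverse $U^{-1}=\{u^{-1}\mid u\in U\}$ and identity $G^{(0)}$; it acts on $G^{(0)}$ by homeomorphisms via $U\mapsto\theta_U$. A regular Borel measure $\mu$ on $G^{(0)}$ is $G$-invariant if $\mu(r(S))=\mu(s(S))$ for each open bisection $S\subset G$; it is $[[G]]$-invariant if it is invariant under the action $\theta$ of $[[G]]$ on $G^{(0)}$. Probability measures on $G^{(0)}$ are understood to be regular Borel. $C_c(G)$ is the $*$-algebra of continuous compactly supported complex functions on $G$ with $(f\star g)(\gamma)=\sum_{\alpha\beta=\gamma}f(\alpha)g(\beta)$ and $f^*(\gamma)=\overline{f(\gamma^{-1})}$. $\mathrm{C}^*(G)$ is the full groupoid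 $\mathrm{C}^*$-algebra (the completion of $C_c(G)$ in the universal $\mathrm{C}^*$-norm). The unitary representation $\pi\colon[[G]]\to \mathrm{C}^*(G)$ is $\pi(U):=1_U$ (indicator function), and $\mathrm{C}^*_\pi([[G]])$ is the $\mathrm{C}^*$-subalgebra of $\mathrm{C}^*(G)$ generated by $\pi([[G]])$. A character of a unital $\mathrm{C}^*$-algebra is a unital $*$-homomorphism to $\mathbb{C}$. If $\sigma,\eta$ are unitary representations of a group $\Gamma$ in unital $\mathrm{C}^*$-algebras, $\sigma$ weakly contains $\eta$ if $\|\sum_i\alpha_i\eta(g_i)\|\leq\|\sum_i\alpha_i\sigma(g_i)\|$ for every $\sum_i\alpha_ig_i\in\mathbb{C}\Gamma$. The trivial representation is $\Gamma\to\mathbb{C}$, $g\mapsto 1$. *)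

(* Defs.v *)
From HB Require Import structures.
From mathcomp Require Import all_boot all_order all_algebra.
From mathcomp Require Import all_classical all_reals all_analysis.
From mathcomp Require Import complex.

Set Implicit Arguments.
Unset Strict Implicit.
Unset Printing Implicit Defensive.

Import Order.TTheory GRing.Theory Num.Theory numFieldNormedType.Exports.

Local Open Scope classical_set_scope.
Local Open Scope ring_scope.

(* The type is kept behind a numClosedFieldType constant so that R[i] inherits
   the topology and the normed-module structure that MathComp-Analysis puts on
   an arbitrary numClosedFieldType. *)
Definition Cplx (R : realType) : numClosedFieldType := R[i]%C.

(* A (possibly zero) unital C*-algebra over Cplx R.  The product is a field of its own
   because HB provides no join of the ring and the normed-module hierarchies
   below numDomainType.  Norms take values in the real elements of Cplx R. *)
HB.mixin Record isCStarAlgebra (R : realType) A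
    of CompleteNormedModule (Cplx R) A := {
  cmul : A -> A -> A;
  cone : A;
  star : A -> A;
  cmulA : associative cmul;
  cmul1l : left_id cone cmul;
  cmul1r : right_id cone cmul;
  cmulDl : left_distributive cmul +%R;
  cmulDr : right_distributive cmul +%R;
  cmulZl : forall (a : Cplx R) x y, cmul (a *: x) y = a *: cmul x y;
  cmulZr : forall (a : Cplx R) x y, cmul x (a *: y) = a *: cmul x y;
  starK : involutive star;
  starD : {morph star : x y / x + y};
  starZ : forall (a : Cplx R) x, star (a *: x) = a^* *: star x;
  starM : forall x y, star (cmul x y) = cmul (star y) (star x);
  cnormM : forall x y : A, `|cmul x y| <= `|x| * `|y|;
  cnorm_star : forall x : A, `|cmul (star x) x| = `|x| ^+ 2
}.
#[short(type="cstarAlgType")]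
HB.structure Definition CStarAlgebra (R : realType) :=
  {A of isCStarAlgebra R A & CompleteNormedModule (Cplx R) A}.
Section complex_numbers.
Variable R : realType.

Lemma Cplx_complete (F : set_system (Cplx R)) : ProperFilter F -> cauchy F -> cvg F.
Proof.
move=> FF /cauchy_ballP Fc.
have reim (f : Cplx R -> R) : (forall z w, `|f z - f w|%:C%C <= `|z - w|) -> 
   exists l : R, f @ F --> l.
  move=> fle; suff : cvg (f @ F) by exists (lim (f @ F)).
  apply: R_complete; apply/cauchy_ballP => e e0.
  have eC : 0 < (e%:C)%C :> Cplx R by rewrite ltcR.
  have [[A B] /= [FA FB] AB] := Fc _ eC.
  exists (f @` A, f @` B) => /=.
    split; rewrite /nbhs /=.
    - by apply: filterS FA => z Az; exists z.
    - by apply: filterS FB => z Bz; exists z.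
  move=> [_ _] /= [[z Az <-] [w Bw <-]].
  have := AB (z, w) (conj Az Bw); rewrite -!ball_normE /=.
  by move=> /(le_lt_trans (fle _ _)); rewrite ltcR.
have [a Fa] : exists l : R, (fun z : Cplx R => complex.Re z) @ F --> l.
  apply: reim => -[x y] [x' y'] /=.
  rewrite lecR -sqrtr_sqr ler_wsqrtr// lerDl sqr_ge0//.
have [b Fb] : exists l : R, (fun z : Cplx R => complex.Im z) @ F --> l.
  apply: reim => -[x y] [x' y'] /=.
  rewrite lecR -sqrtr_sqr ler_wsqrtr// lerDr sqr_ge0//.
apply/cvg_ex; exists (Complex a b : Cplx R).
apply/cvgrPdist_lt => -[e e'] /= e0.
have [e'0 {}e0] : e' = 0 /\ 0 < e by move: e0; rewrite ltcE /= => /andP[/eqP].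
rewrite e'0.
have e20 : 0 < e / 2 by rewrite divr_gt0.
near=> z.
have za : `|a - complex.Re z| < e / 2.
  by near: z; exact: (cvgrPdist_lt _ _).1 Fa _ e20.
have zb : `|b - complex.Im z| < e / 2.
  by near: z; exact: (cvgrPdist_lt _ _).1 Fb _ e20.
have zE : z = Complex (complex.Re z) (complex.Im z) :> Cplx R by case: (z).
rewrite zE; set x := complex.Re z; set y := complex.Im z; rewrite -/x -/y in za zb.
have -> : Complex a b - Complex x y = 
   (a - x)%:C%C + (Complex 0 (b - y)) :> Cplx R.
  by apply/eqP; rewrite eq_complex /= addr0 add0r !eqxx.
apply: le_lt_trans (ler_normD _ _) _.
rewrite (_ : e +i* 0 = (e/2)%:C + (e/2)%:C :> Cplx R)%C; last first.
  by apply/eqP; rewrite eq_complex /= addr0 eqxx andbT -splitr.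
apply: ltrD; rewrite normc_def /= ltcR expr0n /= ?addr0 ?add0r sqrtr_sqr//.
Unshelve. all: by end_near. Qed.

HB.instance Definition _ := Uniform_isComplete.Build (Cplx R) Cplx_complete.

Let l1 : involutive (fun x : Cplx R => x^*). Proof. exact: conjCK. Qed.
Let l2 : {morph (fun x : Cplx R => x^*) : x y / x + y}. Proof. exact: rmorphD. Qed.
Let l3 (a x : Cplx R) : (a *: x)^* = a^* *: x^*. Proof. exact: rmorphM. Qed.
Let l4 (x y : Cplx R) : (x*y)^* = y^* * x^*. Proof. by rewrite rmorphM mulrC. Qed.
Let l5 (x y : Cplx R) : `|x * y| <= `|x| * `|y|. Proof. by rewrite normrM. Qed.
Let l6 (x : Cplx R) : `|x^* * x| = `|x| ^+ 2. Proof. by rewrite normrM norm_conjC expr2. Qed.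
Let l7 (a x y : Cplx R) : (a *: x) * y = a *: (x * y). Proof. by rewrite -scalerAl. Qed.
Let l8 (a x y : Cplx R) : x * (a *: y) = a *: (x * y). Proof. by rewrite -scalerAr. Qed.

HB.instance Definition _ := isCStarAlgebra.Build R (Cplx R)
  (@mulrA _) (@mul1r _) (@mulr1 _) (@mulrDl _) (@mulrDr _) l7 l8
  l1 l2 l3 l4 l5 l6.

End complex_numbers.

Definition rnorm (R : realType) (V : normedModType (Cplx R)) (x : V) : R :=
  complex.Re `|x|.

Section representations.
Variable R : realType.

(* The elements of the group algebra are given as finite formal sums. *)
Definition weakly_contains (Gamma : groupType) (A B : cstarAlgType R)
    (sigma : Gamma -> A) (eta : Gamma -> B) :=
  forall s : seq (Cplx R * Gamma),
    `|\sum_(p <- s) p.1 *: eta p.2| <= `|\sum_(p <- s) p.1 *: sigma p.2|.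

Definition trivial_rep (Gamma : groupType) (_ : Gamma) : Cplx R := 1.

Definition cstar_subalgebra (A : cstarAlgType R) (B : set A) :=
  [/\ closed B, B 0,
      forall x y, B x -> B y -> B (x + y) /\ B (cmul x y),
      forall (a : Cplx R) x, B x -> B (a *: x)
    & forall x, B x -> B (star x)].

(* For a C*-subalgebra B of A that contains the unit of A; chi is only
   constrained, hence only meaningful, on B. *)
Definition admits_character (A : cstarAlgType R) (B : set A) :=
  exists chi : A -> Cplx R,
    [/\ chi cone = 1,
        {in B &, forall x y, chi (x + y) = chi x + chi y},
        {in B &, forall x y, chi (cmul x y) = chi x * chi y},
        forall a, {in B, forall x, chi (a *: x) = a * chi x}
      & {in B, forall x, chi (star x) = (chi x)^*}].

End representations.

(* The unit space is a separate type, embedded in the arrows by unt: as unt is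
   continuous and rng is a continuous left inverse of it, units carries the
   topology induced by G.  units is pointed because measurable types are.
   gmul g h is meaningful only when src g = rng h. *)
Record topGroupoid := TopGroupoid {
  arrows :> topologicalType;
  units : ptopologicalType;
  rng : arrows -> units;
  src : arrows -> units;
  unt : units -> arrows;
  gmul : arrows -> arrows -> arrows;
  ginv : arrows -> arrows;
  rng_unt : forall x, rng (unt x) = x;
  src_unt : forall x, src (unt x) = x;
  rng_inv : forall g, rng (ginv g) = src g;
  src_inv : forall g, src (ginv g) = rng g;
  rng_mul : forall g h, src g = rng h -> rng (gmul g h) = rng g;
  src_mul : forall g h, src g = rng h -> src (gmul g h) = src h;
  gmulA : forall g h k, src g = rng h -> src h = rng k ->
    gmul g (gmul h k) = gmul (gmul g h) k;
  gmul1l : forall g, gmul (unt (rng g)) g = g;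
  gmul1r : forall g, gmul g (unt (src g)) = g;
  gmulV : forall g, gmul g (ginv g) = unt (rng g);
  gmulVl : forall g, gmul (ginv g) g = unt (src g);
  rng_continuous : continuous rng;
  src_continuous : continuous src;
  unt_continuous : continuous unt;
  ginv_continuous : continuous ginv;
  gmul_continuous : {within [set gh : arrows * arrows | src gh.1 = rng gh.2],
    continuous (fun gh => gmul gh.1 gh.2)}
}.
Arguments rng {_}.
Arguments src {_}.
Arguments unt {_}.
Arguments gmul {_}.
Arguments ginv {_}.

Definition local_homeo (X Y : topologicalType) (f : X -> Y) :=
  forall x, exists U : set X, [/\ open U, U x, open (f @` U) &
    exists g : Y -> X, [/\ {in U, cancel f g}, {within U, continuous f}
      & {within f @` U, continuous g}]].

Definition ample (G : topGroupoid) :=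
  [/\ locally_compact [set: G], hausdorff_space G,
      local_homeo (@rng G), local_homeo (@src G)
    & totally_disconnected [set: units G]].

Definition bisection (G : topGroupoid) (U : set G) :=
  set_inj U rng /\ set_inj U src.

Definition full_bisection (G : topGroupoid) (U : set G) :=
  [/\ compact U, open U, bisection U, rng @` U = setT & src @` U = setT].

Definition bmul (G : topGroupoid) (U V : set G) : set G :=
  [set w | exists u v, [/\ U u, V v, src u = rng v & w = gmul u v]].

Section openness.
Variables (X Y : topologicalType) (f : X -> Y).
Hypothesis fh : local_homeo f.

Lemma local_homeo_open (O : set X) : open O -> open (f @` O).
Proof.
move=> oO; rewrite openE => _ [x Ox <-].
have [U [oU Ux ofU [g [gK _ cg]]]] := fh x.
have fxU : (f @` U) (f x) by exists x.
have gOU : nbhs (g (f x)) (O `&` U).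
  rewrite gK ?inE//; apply: filterI; exact: open_nbhs_nbhs.
move/subspace_continuousP : cg => /(_ _ fxU _ gOU).
rewrite /nbhs /= /within /= => gN.
apply: filterS2 gN (open_nbhs_nbhs (conj ofU fxU)) => y gy fUy.
have [Ogy Ugy] := gy fUy; exists (g y) => //.
by have [u Uu uy] := fUy; rewrite -uy gK ?inE.
Qed.

Lemma section_open (s : Y -> X) : continuous f -> cancel s f -> continuous s ->
  open (range s).
Proof.
move=> cf sK cs; rewrite openE => _ [y _ <-].
have [U [oU Ux _ [g [gK _ _]]]] := fh (s y).
have U1 : nbhs (f (s y)) (s @^-1` U).
  by rewrite sK; apply: cs; exact: open_nbhs_nbhs.
have := cf _ _ U1; rewrite /nbhs /= => fU.
apply: filterS2 fU (open_nbhs_nbhs (conj oU Ux)) => x /= Usfx Ux'.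
exists (f x) => //.
by rewrite -[RHS]gK ?inE// -[LHS]gK ?inE// sK.
Qed.

Lemma inj_section_continuous (s : Y -> X) (U : set X) : open U -> set_inj U f ->
  cancel s f -> (forall y, U (s y)) -> continuous s.
Proof.
move=> oU fI sK sU y O; rewrite nbhsE => -[W [oW Wsy] WO].
have : nbhs y (f @` (W `&` U)).
  apply: open_nbhs_nbhs; split; first by apply: local_homeo_open; exact: openI.
  by exists (s y) => //; split.
apply: filterS => z [x [Wx Ux] fxz]; apply: WO.
by rewrite -(_ : x = s z)//; apply: fI; rewrite ?inE// sK.
Qed.

End openness.

Section topological_full_group.
Variable G : topGroupoid.
Hypotheses (hG : ample G) (hX : compact [set: units G]).
Implicit Types U V W : set G.

Let src_homeo : local_homeo (@src G). Proof. by case: hG. Qed.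
Let rng_homeo : local_homeo (@rng G). Proof. by case: hG. Qed.

(* The inverse of the restriction of src to U, when src maps U bijectively
   onto the unit space; the default value unt x is then never used. *)
Definition src_section U (x : units G) : G :=
  xget (unt x) [set g | U g /\ src g = x].

Lemma src_sectionP U : src @` U = setT ->
  forall x, U (src_section U x) /\ src (src_section U x) = x.
Proof.
move=> sU x; have : (src @` U) x by rewrite sU.
by move=> [g Ug gx]; rewrite /src_section; case: xgetP => [y _ []|/(_ g)[]].
Qed.

Lemma src_section_continuous U : open U -> bisection U -> src @` U = setT ->
  continuous (src_section U).
Proof.
move=> oU [_ sI] sU; apply: inj_section_continuous sI _ _ => // x.
- by case: (src_sectionP sU x).
- by case: (src_sectionP sU x).
Qed.

Lemma full_bisection_intro U : open U -> bisection U -> rng @` U = setT ->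
  src @` U = setT -> full_bisection U.
Proof.
move=> oU bU rU sU; split => //.
have -> : U = src_section U @` setT.
  apply/seteqP; split=> [g Ug|_ [x _ <-]]; last by case: (src_sectionP sU x).
  exists (src g) => //; have [? ?] := src_sectionP sU (src g).
  by apply: bU.2; rewrite ?inE.
apply: continuous_compact hX; apply: continuous_subspaceT.
exact: src_section_continuous.
Qed.

Lemma gmul_continuous_comp (T : topologicalType) (h k : T -> G) :
  continuous h -> continuous k -> (forall t, src (h t) = rng (k t)) ->
  continuous (fun t => gmul (h t) (k t)).
Proof.
move=> ch ck hk t O.
have /subspace_continuousP/(_ (h t, k t) (hk t) O) := @gmul_continuous G.
move=> /[apply].
rewrite /nbhs /= /within /= => O'.
have hkt : (h x, k x) @[x --> t] --> (h t, k t).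
  by apply: cvg_pair; [exact: ch|exact: ck].
have : \forall u \near t, src (h u) = rng (k u) -> O (gmul (h u) (k u)).
  exact: hkt _ O'.
by rewrite /nbhs /=; apply: filterS => u /=; apply; exact: hk.
Qed.

Lemma ginvK : involutive (@ginv G).
Proof.
move=> g.
rewrite -[LHS]gmul1r src_inv rng_inv -gmulVl gmulA ?src_inv//.
by rewrite gmulVl src_inv gmul1l.
Qed.

Lemma full_bisection1 : full_bisection (range (@unt G)).
Proof.
apply: full_bisection_intro.
- exact: (section_open src_homeo (@src_continuous G) (@src_unt G)
    (@unt_continuous G)).
- split=> _ _ /set_mem[x _ <-] /set_mem[y _ <-].
  + by rewrite !rng_unt => ->.
  + by rewrite !src_unt => ->.
- by apply/seteqP; split=> // x _; exists (unt x) => //; rewrite rng_unt.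
- by apply/seteqP; split=> // x _; exists (unt x) => //; rewrite src_unt.
Qed.

Lemma full_bisectionV U : full_bisection U -> full_bisection (ginv @` U).
Proof.
move=> [_ oU [rI sI] rU sU].
have VE : ginv @` U = ginv @^-1` U.
  apply/seteqP; split=> [_ [g Ug <-]|g Ug] /=; first by rewrite ginvK.
  by exists (ginv g) => //; rewrite ginvK.
apply: full_bisection_intro.
- by rewrite VE; move/continuousP: (@ginv_continuous G); exact.
- split=> _ _ /set_mem[g Ug <-] /set_mem[h Uh <-].
  + by rewrite !rng_inv => /sI; rewrite !inE => ->.
  + by rewrite !src_inv => /rI; rewrite !inE => ->.
- rewrite -sU; apply/seteqP; split=> [_ [_ [g Ug <-] <-]|_ [g Ug <-]].
    by rewrite rng_inv; exists g.
  by exists (ginv g); rewrite ?rng_inv//; exists g.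
- rewrite -rU; apply/seteqP; split=> [_ [_ [g Ug <-] <-]|_ [g Ug <-]].
    by rewrite src_inv; exists g.
  by exists (ginv g); rewrite ?src_inv//; exists g.
Qed.

Lemma full_bisectionM U V :
  full_bisection U -> full_bisection V -> full_bisection (bmul U V).
Proof.
move=> fU fV; have [_ oU [rIU sIU] rU sU] := fU.
have [_ oV [rIV sIV] rV sV] := fV.
have [_ oU' bU' _ sU'] := full_bisectionV fU.
pose t := src_section (ginv @` U).
have tU x : U (ginv (t x)).
  by rewrite /t; have [[g Ug <-] _] := src_sectionP sU' x; rewrite ginvK.
have st x : src (t x) = x by case: (src_sectionP sU' x).
have ct : continuous t by exact: src_section_continuous.
apply: full_bisection_intro.
- have -> : bmul U V = (fun g => gmul (t (rng g)) g) @^-1` V.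
    apply/seteqP; split=> [_ [u [v [Uu Vv uv ->]]]|w Vw] /=.
      have -> : t (rng (gmul u v)) = ginv u.
        rewrite -[LHS]ginvK; congr ginv; apply: rIU; rewrite ?inE//.
        by rewrite rng_inv st rng_mul.
      by rewrite gmulA// ?src_inv// gmulVl uv gmul1l.
    exists (ginv (t (rng w))), (gmul (t (rng w)) w); split => //.
      by rewrite src_inv rng_mul// st.
    by rewrite gmulA// ?src_inv ?st// gmulVl st gmul1l.
  move/continuousP : (@gmul_continuous_comp G (fun g => t (rng g)) id
    (fun g => cvg_comp _ _ (@rng_continuous G g) (ct (rng g))) (fun=> cvg_id) (fun g => st _)).
  exact.
- split=> _ _ /set_mem[u [v [Uu Vv uv ->]]] /set_mem[u' [v' [Uu' Vv' uv' ->]]].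
  + rewrite !rng_mul// => /rIU; rewrite !inE => /(_ Uu Uu') uu.
    have : rng v = rng v' by rewrite -uv -uv' uu.
    by move=> /rIV; rewrite !inE => /(_ Vv Vv') ->; rewrite uu.
  + rewrite !src_mul// => /sIV; rewrite !inE => /(_ Vv Vv') vv.
    have : src u = src u' by rewrite uv uv' vv.
    by move=> /sIU; rewrite !inE => /(_ Uu Uu') ->; rewrite vv.
- apply/seteqP; split=> // x _.
  have [u Uu <-] : (rng @` U) x by rewrite rU.
  have [v Vv vu] : (rng @` V) (src u) by rewrite rV.
  by exists (gmul u v); [exists u, v|rewrite rng_mul].
- apply/seteqP; split=> // x _.
  have [v Vv <-] : (src @` V) x by rewrite sV.
  have [u Uu uv] : (src @` U) (rng v) by rewrite sU.
  by exists (gmul u v); [exists u, v|rewrite src_mul].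
Qed.

End topological_full_group.

Definition full_group (G : topGroupoid) (hG : ample G)
    (hX : compact [set: units G]) : Type :=
  set_type [set U : set G | full_bisection U].

Section full_group_group.
Variables (G : topGroupoid) (hG : ample G) (hX : compact [set: units G]).
Local Notation T := (full_group hG hX).
HB.instance Definition _ := Choice.on T.

Definition full_group_one : T := SigSub (mem_set (full_bisection1 hG hX)).
Definition full_group_inv (U : T) : T :=
  SigSub (mem_set (full_bisectionV hG hX (set_mem (valP U)))).
Definition full_group_mul (U V : T) : T :=
  SigSub (mem_set (full_bisectionM hG hX (set_mem (valP U)) (set_mem (valP V)))).

Let mulA : associative full_group_mul.
Proof.
move=> U V W; apply: val_inj; apply/seteqP; split => /=.
- move=> _ [u [_ [Uu [v [w [Vv Ww vw ->]]] uvw ->]]].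
  rewrite rng_mul// in uvw.
  exists (gmul u v), w; split => //; first by exists u, v.
    by rewrite src_mul.
  by rewrite gmulA.
- move=> _ [_ [w [[u [v [Uu Vv uv ->]]] Ww uvw ->]]].
  rewrite src_mul// in uvw.
  exists u, (gmul v w); split => //; first by exists v, w.
    by rewrite rng_mul.
  by rewrite gmulA.
Qed.

Let mul1 : left_id full_group_one full_group_mul.
Proof.
move=> U; apply: val_inj; apply/seteqP; split=> /= [_ [_ [u [[x _ <-] Uu xu ->]]]|u Uu].
  by rewrite src_unt in xu; rewrite xu gmul1l.
by exists (unt (rng u)), u; split; rewrite ?src_unt ?gmul1l//; exists (rng u).
Qed.

Let mulg1' : right_id full_group_one full_group_mul.
Proof.
move=> U; apply: val_inj; apply/seteqP; split=> /= [_ [u [_ [Uu [x _ <-] xu ->]]]|u Uu].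
  by rewrite rng_unt in xu; rewrite -xu gmul1r.
by exists u, (unt (src u)); split; rewrite ?rng_unt ?gmul1r//; exists (src u).
Qed.

Let mulV : left_inverse full_group_one full_group_inv full_group_mul.
Proof.
move=> U; have [_ _ [rI sI] rU sU] := set_mem (valP U).
apply: val_inj; apply/seteqP; split=> /= [_ [_ [v [[u Uu <-] Uv uv ->]]]|_ [x _ <-]].
  have -> : v = u by apply: rI; rewrite ?inE//; rewrite -uv src_inv.
  by rewrite gmulVl; exists (src u).
have [u Uu <-] : (src @` val U) x by rewrite sU.
exists (ginv u), u; split; rewrite ?src_inv ?gmulVl//; by exists u.
Qed.

Let mulV' : right_inverse full_group_one full_group_inv full_group_mul.
Proof.
move=> U; have [_ _ [rI sI] rU sU] := set_mem (valP U).
apply: val_inj; apply/seteqP; split=> /= [_ [u [_ [Uu [v Uv <-] uv ->]]]|_ [x _ <-]].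
  have -> : v = u by apply: sI; rewrite ?inE//; rewrite uv rng_inv.
  by rewrite gmulV; exists (rng u).
have [u Uu <-] : (rng @` val U) x by rewrite rU.
exists u, (ginv u); split; rewrite ?rng_inv ?gmulV//; by exists u.
Qed.

HB.instance Definition _ := @isGroup.Build T full_group_one full_group_inv
  full_group_mul mulA mul1 mulg1' mulV mulV'.

End full_group_group.
Definition theta (G : topGroupoid) (U : set G) : units G -> units G :=
  rng \o src_section U.

Section invariant_measures.
Variables (R : realType) (G : topGroupoid).

Definition Borel (X : ptopologicalType) := g_sigma_algebraType (@open X).

Definition regular_borel (X : ptopologicalType) (mu : probability (Borel X) R) :=
  forall E : set (Borel X), measurable E ->
    mu E = ereal_inf [set mu U | U in [set U : set X | open U /\ E `<=` U]] /\
    mu E = ereal_sup [set mu K | K in [set K : set X | compact K /\ K `<=` E]].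

Definition groupoid_invariant (mu : probability (Borel (units G)) R) :=
  forall S : set G, open S -> bisection S -> mu (rng @` S) = mu (src @` S).

Definition full_group_invariant (hG : ample G) (hX : compact [set: units G])
    (mu : probability (Borel (units G)) R) :=
  forall (U : full_group hG hX) (E : set (Borel (units G))),
    measurable E -> mu (theta (val U) @` E) = mu E.

End invariant_measures.

Section convolution_algebra.
Variables (R : realType) (G : topGroupoid).
Implicit Types f h : G -> Cplx R.

Definition Cc : set (G -> Cplx R) :=
  [set f | continuous f /\ compact (closure [set g | f g != 0])].

(* For f, h in Cc and G Hausdorff and etale, only finitely many terms of the sum
   are nonzero. *)
Definition conv f h : G -> Cplx R := fun g =>
  \sum_(ab \in [set ab : G * G | src ab.1 = rng ab.2 /\ gmul ab.1 ab.2 = g])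
    (f ab.1 * h ab.2).

Definition adj f : G -> Cplx R := fun g => (f (ginv g))^*.

Definition cstar_seminorm (p : (G -> Cplx R) -> R) :=
  [/\ forall f, Cc f -> 0 <= p f,
      forall f h, Cc f -> Cc h -> p (f \+ h) <= p f + p h,
      forall (a : Cplx R) f, Cc f -> p (fun g => a * f g) = rnorm a * p f,
      forall f h, Cc f -> Cc h -> p (conv f h) <= p f * p h
    & forall f, Cc f -> p (conv (adj f) f) = p f ^+ 2].

Definition universal_norm f : \bar R :=
  ereal_sup [set (p f)%:E | p in cstar_seminorm].

(* A completion of the *-algebra Cc in the universal C*-norm; it is unique up to
   a *-isomorphism that commutes with the maps embed.  The values of embed
   outside Cc are irrelevant. *)
Record full_cstar := FullCstar {
  cstar_carrier :> cstarAlgType R;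
  embed : (G -> Cplx R) -> cstar_carrier;
  embedD : forall f h, Cc f -> Cc h -> embed (f \+ h) = embed f + embed h;
  embedZ : forall (a : Cplx R) f, Cc f ->
    embed (fun g => a * f g) = a *: embed f;
  embedM : forall f h, Cc f -> Cc h ->
    embed (conv f h) = cmul (embed f) (embed h);
  embed_star : forall f, Cc f -> embed (adj f) = star (embed f);
  embed_norm : forall f, Cc f -> (rnorm (embed f))%:E = universal_norm f;
  embed_dense : closure (embed @` Cc) = setT
}.

Definition pi_rep (A : full_cstar) (hG : ample G)
    (hX : compact [set: units G]) (U : full_group hG hX) : A :=
  embed A (\1_(val U)).

Definition cstar_pi (A : full_cstar) (hG : ample G)
    (hX : compact [set: units G]) : set A :=
  smallest (@cstar_subalgebra R A) (range (@pi_rep A hG hX)).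

End convolution_algebra.

(* Main.v *)
From HB Require Import structures.
Require Import Defs.
From mathcomp Require Import all_boot all_order all_algebra.
From mathcomp Require Import all_classical all_reals all_analysis.
From mathcomp Require Import measurable_realfun complex ring lra.

Set Implicit Arguments.
Unset Strict Implicit.
Unset Printing Implicit Defensive.

Import Order.TTheory GRing.Theory Num.Theory numFieldNormedType.Exports.

Local Open Scope classical_set_scope.
Local Open Scope ring_scope.

(** The four conditions are linked in a circle.

    From an invariant measure mu to weak containment.  The convolution algebra
    acts on L^2(mu) by (f xi)(x) = sum of f(g) xi(s(g)) over the arrows g with
    r(g) = x.  Invariance of mu says that integrating over range fibres and over
    source fibres gives the same measure on G (mean_fibre_sum), and this is what
    makes the adjoint function act as the adjoint operator (koopman_adj).  Hence
    the operator norm is a C*-seminorm (op_norm_cstar), bounded by the universal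
    norm.  A combination of indicators of elements of the full group multiplies
    the constant function 1 by the sum of its coefficients, so this sum is
    bounded by the universal norm of the combination.

    From weak containment to a character.  The sum of the coefficients is then a
    contractive *-homomorphism on the span of the representation; it extends to
    the closure of the span, which contains the generated C*-subalgebra
    (weak_containment_character).

    From a character chi to an invariant measure.  By the Neumann series, chi is
    contractive (character_le), so its real part extends, by Hahn-Banach, to a
    real-linear functional f on the whole algebra with f <= norm.  The unitaries
    v of the generated subalgebra with chi(v) = 1 satisfy f(v b) = f(b) for all b
    (extension_mull), so f is invariant under conjugation by the unitaries of
    the representation (extension_conj).  Such a conjugation moves the indicator
    of a clopen set K of units to that of theta_U(K) (clopen_proj_theta);
    thus f defines an invariant finitely additive probability on clopen sets.
    The unit space is compact and zero-dimensional, so this content extends to a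
    regular Borel measure (stone_probability), canonically enough to stay
    invariant (stone_probability_homeo).

    From invariance under the full group to invariance under the groupoid.  On
    the part of an open bisection S where r and s agree nothing has to be
    proved.  Every arrow g of S with r(g) <> s(g) lies in a compact open
    bisection T inside S whose range and source are disjoint, and such a T is part
    of an element of the full group, the involution that exchanges s(T) and
    r(T).  Inner regularity reduces the comparison of the measures to finitely
    many such T (invariant_le). *)

(** * Compactness and clopen sets *)

Section compactness.
Implicit Types T : topologicalType.

(** Induction over a compact set: a class of sets that is closed under finite
    unions and contains a neighbourhood of every point of K has a member that
    contains K.  It replaces the extraction of finite subcovers everywhere
    below. *)
Lemma compact_ind T (K : set T) (P : set T -> Prop) :
  compact K -> P set0 -> (forall A B, P A -> P B -> P (A `|` B)) ->
  (forall x, K x -> exists2 U, nbhs x U & P U) ->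
  exists2 U, K `<=` U & P U.
Proof.
move=> cK P0 PU KP; apply: contrapT => nU.
pose F := [set A | exists2 U, P U & K `\` U `<=` A].
have FF : ProperFilter F.
  split.
    move=> [U PU' KU]; apply: nU; exists U => // x Kx; apply: contrapT => Ux.
    exact: (KU x).
  split.
  - by exists set0.
  - move=> A B [U PU1 UA] [V PV VB]; exists (U `|` V); first exact: PU.
    move=> x [Kx /not_orP[Ux Vx]]; split; first by apply: UA.
    by apply: VB.
  - by move=> A B AB [U PU' UA]; exists U => // x /UA /AB.
have [x [Kx xF]] : exists x, K x /\ cluster F x.
  have [|x [? ?]] := cK F; last by exists x.
  by exists set0 => // x [].
have [U Ux PU'] := KP x Kx.
have [|y [[_ ?] //]] := xF (K `\` U) U _ Ux.
by exists U.
Qed.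

Lemma continuous_bounded T (R : realType) (u : T -> R) :
  compact [set: T] -> continuous u ->
  exists2 M, 0 <= M & forall x, u x <= M.
Proof.
move=> cT cu.
have [U UX [M M0 HM]] : exists2 U : set T, setT `<=` U &
    exists2 M, 0 <= M & forall x, U x -> u x <= M.
  apply: compact_ind => //; first by exists 0.
  - move=> A B [M M0 HA] [N N0 HB]; exists (M + N); first exact: addr_ge0.
    move=> x [/HA|/HB] /le_trans; apply; first by rewrite lerDl.
    by rewrite lerDr.
  - move=> x _; exists (u @^-1` ball (u x) 1).
      exact: (cu x _ (nbhsx_ballx _ _ ltr01)).
    exists (`|u x| + 1); first by rewrite addr_ge0.
    move=> y; rewrite /= -ball_normE /= => xy.
    have := ler_norm (u x); move: xy; rewrite ltr_norml; lra.
by exists M => // x; apply: HM; exact: UX.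
Qed.

Lemma continuous_separated_hausdorff T (T' : topologicalType) (f : T -> T') :
  continuous f -> injective f -> hausdorff_space T' -> hausdorff_space T.
Proof.
move=> cf fI hT' x y xy; apply: fI; apply: hT' => A B fA fB.
have [z [Az Bz]] := xy _ _ (cf _ _ fA) (cf _ _ fB).
by exists (f z).
Qed.

(** The classical fact that components and quasi-components agree in a compact
    Hausdorff space: the intersection Q of the clopen sets that contain x is
    connected, because a splitting of Q extends, by normality, to disjoint open
    sets, and by compactness some clopen D around x lies in their union. *)
Lemma compact_totally_disconnected_zero_dimensional T :
  hausdorff_space T -> compact [set: T] -> totally_disconnected [set: T] ->
  zero_dimensional T.
Proof.
move=> hT cT tdT x y /eqP xy; apply: contrapT => nxy; apply: xy.
pose Q := [set z | forall D : set T, clopen D -> D x -> D z].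
have Qy : Q y.
  by move=> D cD Dx; apply: contrapT => nDy; apply: nxy; exists D.
have cQ : closed Q.
  have -> : Q = \bigcap_(D in [set D | clopen D /\ D x]) D.
    by apply/seteqP; split=> z Qz D /=; [case; exact: Qz|move=> ? ?; exact: Qz].
  by apply: closed_bigI => D [[]].
suff Qc : connected Q.
  have : connected_component setT x y.
    by exists Q => //; split => //; move=> D.
  by rewrite tdT.
apply/connectedP => E [E0 EQ sE].
wlog E0x : E E0 EQ sE / E false x.
  move=> G; have : Q x by move=> D.
  rewrite EQ => -[E0x|E1x]; first exact: G.
  by apply: (G (E \o negb)) => //;
    [case => /=|rewrite EQ setUC|rewrite separatedC].
have cE b : closed (E b).
  have EbQ : E b `<=` Q by rewrite EQ; case: (b); [right|left].
  have cEQ : closure (E b) `<=` Q.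
    by rewrite [Q](closure_id _).1//; exact: closureS.
  move=> z cEz; have := cEQ _ cEz; rewrite EQ.
  have [sE1 sE2] := sE.
  case: (b) cEz => cEz [] // Ez; exfalso.
  - by have : (E false `&` closure (E true)) z by []; rewrite sE2.
  - by have : (closure (E false) `&` E true) z by []; rewrite sE1.
have dE : E false `&` E true = set0 by exact: separated_disjoint.
(* C and the complement of its closure separate the two pieces of Q *)
have [C CE CE1] : filter_from (set_nbhs (E false)) closure (~` E true).
  apply: (compact_normal hT cT (cE false)) => z E0z.
  apply: open_nbhs_nbhs; split; first exact: closed_openC.
  by move=> E1z; have : (E false `&` E true) z by []; rewrite dE.
pose U := C^°; pose V := ~` closure C.
have oU : open U by exact: open_interior.
have oV : open V by apply: closed_openC; exact: closed_closure.
have EU : E false `<=` U by [].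
have EV : E true `<=` V by move=> z E1z /CE1.
have UV : U `&` V = set0.
  by rewrite -subset0 => z [/interior_subset/subset_closure].
have [W UVW [D [cD Dx DW]]] : exists2 W, ~` (U `|` V) `<=` W &
    exists D, [/\ clopen D, D x & D `&` W = set0].
  apply: compact_ind.
  - apply: (subclosed_compact _ cT) => //; apply: open_closedC.
    exact: openU.
  - by exists setT; split; [exact: clopenT| |rewrite setI0].
  - move=> A B [D [cD Dx DA]] [D' [cD' Dx' DA']].
    exists (D `&` D'); split; [exact: clopenI|by []|].
    rewrite -subset0 => z [[Dz Dz'] [Az|Bz]].
    + by have : (D `&` A) z by []; rewrite DA.
    + by have : (D' `&` B) z by []; rewrite DA'.
  - move=> z /not_orP[Uz Vz].
    have nQz : ~ Q z by rewrite EQ => -[/EU|/EV].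
    have [D nD] : exists D, ~ (clopen D -> D x -> D z).
      by apply: contrapT => nD; apply: nQz => D; apply: contrapT => ?; apply: nD; exists D.
    have cD : clopen D by apply: contrapT => ?; apply: nD.
    have Dx : D x by apply: contrapT => ?; apply: nD.
    exists (~` D).
      apply: open_nbhs_nbhs; split; first by case: cD => _ /closed_openC.
      by move=> Dz; exact: nD.
    by exists D; split => //; rewrite setICr.
have DUV : D `&` U = D `\` V.
  apply/seteqP; split=> z [Dz].
    by move=> Uz; split => // Vz; have : (U `&` V) z by []; rewrite UV.
  move=> nVz; split => //; apply: contrapT => nUz.
  have : (D `&` W) z by split => //; apply: UVW => -[].
  by rewrite DW.
have cDU : clopen (D `&` U).
  case: cD => oD clD; split; first exact: openI.
  by rewrite DUV setDE; apply: closedI => //; exact: open_closedC.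
have [z E1z] := E0 true.
have Qz : Q z by rewrite EQ; right.
have [_ Uz] : (D `&` U) z by apply: Qz => //; split => //; exact: EU.
have : (U `&` V) z by split => //; exact: EV.
by rewrite UV.
Qed.

Lemma clopen_nbhs_basis T (x : T) (U : set T) :
  hausdorff_space T -> compact [set: T] -> totally_disconnected [set: T] ->
  nbhs x U -> exists D, [/\ clopen D, D x & D `<=` U].
Proof.
move=> hT cT tT xU.
have zT := compact_totally_disconnected_zero_dimensional hT cT tT.
by have [D [Dx cD] DU] := zero_dimensional_cvg hT zT cT xU; exists D.
Qed.
Lemma open_preimage T (T' : topologicalType) (f : T -> T') (A : set T') :
  continuous f -> open A -> open (f @^-1` A).
Proof. by move/continuousP; exact. Qed.

End compactness.

(** * Compactly supported functions and fibre sums *)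

Definition compact_open_bisection (G : topGroupoid) (S : set G) :=
  [/\ compact S, open S & bisection S].

(** This form, with an arbitrary compact set outside of which the function
    vanishes, makes sums and products immediate; it agrees with the condition
    on the closure of the support in a Hausdorff space. *)
Definition compactly_supported (T : topologicalType) (K : numFieldType)
    (f : T -> K) :=
  continuous f /\ exists2 C : set T, compact C & forall t, ~ C t -> f t = 0.

Section patches.
Variables (T : topologicalType) (K : numFieldType).
Implicit Types (f : T -> K) (S : set T).

Lemma continuous_patch f S : clopen S -> continuous f ->
  continuous (patch (fun=> 0) S f).
Proof.
move=> [oS cS] cf x; have [Sx|Sx] := pselect (S x).
  have : patch (fun=> 0) S f @ x --> f x.
    apply: cvg_trans (cf x); apply: near_eq_cvg.
    near=> y; rewrite /patch ifT// inE; near: y.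
    exact: open_nbhs_nbhs.
  by rewrite /continuous_at patchT ?inE.
have : patch (fun=> 0) S f @ x --> (0 : K).
  apply: (@cvg_trans _ ((fun=> 0 : K) @ x)); last exact: cvg_cst.
  apply: near_eq_cvg; near=> y; rewrite /patch ifF//.
  apply/negbTE; rewrite notin_setE; near: y.
  by apply: open_nbhs_nbhs; split => //; exact: closed_openC.
by rewrite /continuous_at patchC ?inE.
Unshelve. all: by end_near. Qed.

Lemma patch_setC_split f S : f = patch (fun=> 0) S f \+ patch (fun=> 0) (~` S) f.
Proof.
apply/funext => x /=; rewrite /patch in_setC.
by case: (x \in S); rewrite /= ?addr0 ?add0r.
Qed.

Lemma compactly_supported_patch f S : clopen S -> compactly_supported f ->
  compactly_supported (patch (fun=> 0) S f).
Proof.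
move=> cS [cf [C cC fC]]; split; first exact: continuous_patch.
by exists C => // t /fC; rewrite /patch; case: ifP.
Qed.

Lemma compactly_supportedD f h : compactly_supported f ->
  compactly_supported h -> compactly_supported (f \+ h).
Proof.
move=> [cf [C cC fC]] [ch [D cD hD]]; split.
  by move=> x; apply: cvgD; [exact: cf|exact: ch].
exists (C `|` D); first exact: compactU.
by move=> t /not_orP[/fC + /hD] /= => -> ->; rewrite addr0.
Qed.

Lemma compactly_supportedZ (a : K) f :
  compactly_supported f -> compactly_supported (fun g => a * f g).
Proof.
move=> [cf [C cC fC]]; split; last by exists C => // t /fC ->; rewrite mulr0.
by move=> x; apply: cvgM; [exact: cvg_cst|exact: cf].
Qed.

Lemma compactly_supportedM f (u : T -> K) :
  compactly_supported f -> continuous u ->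
  compactly_supported (fun t => f t * u t).
Proof.
move=> [cf [D cD fD]] cu; split.
  by move=> t; apply: cvgM; [exact: cf|exact: cu].
by exists D => // t /fD ->; rewrite mul0r.
Qed.

Lemma compactly_supported_comp (K' : numFieldType) (phi : K -> K') f :
  continuous phi -> phi 0 = 0 -> compactly_supported f ->
  compactly_supported (fun t => phi (f t)).
Proof.
move=> cphi phi0 [cf [D cD fD]]; split.
  by move=> t; apply: continuous_comp; [exact: cf|exact: cphi].
by exists D => // t /fD ->.
Qed.

End patches.

(** Locally p is injective, so each point of C has a neighbourhood that meets
    the fibre at most once. *)
Lemma finite_preimage_compact (T X : topologicalType) (p : T -> X) (C : set T) x :
  local_homeo p -> compact C -> finite_set (p @^-1` [set x] `&` C).
Proof.
move=> lp cC; have [U CU] : exists2 U, C `<=` U & finite_set (p @^-1` [set x] `&` U).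
  apply: compact_ind => //.
  - by rewrite setI0.
  - by move=> A B; rewrite setIUr finite_setU.
  - move=> g _; have [U [oU Ug _ [h [hK _ _]]]] := lp g.
    exists U; first exact: open_nbhs_nbhs.
    apply: (@sub_finite_set _ _ [set h x]); last exact: finite_set1.
    by move=> z [/= <- Uz]; rewrite hK// inE.
by apply: sub_finite_set; exact: setIS.
Qed.

(** Integration against the counting measures of the fibres of p.  The sum is
    finite when p is a local homeomorphism and f has compact support. *)
Definition fibre_sum (T : choiceType) (X : Type) (K : numFieldType) (p : T -> X)
    (f : T -> K) (x : X) : K :=
  \sum_(g \in p @^-1` [set x]) f g.

Section fibre_sum.
Variables (T X : topologicalType) (K : numFieldType) (p : T -> X).
Implicit Types (f h : T -> K) (S : set T).

Lemma fibre_sum_inj f S g : set_inj S p -> (forall t, ~ S t -> f t = 0) ->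
  S g -> fibre_sum p f (p g) = f g.
Proof.
move=> pI fS Sg; rewrite /fibre_sum -(fsbig_widen [set g]) ?fsbig_set1//.
  by move=> _ ->.
move=> z /= [pz /eqP zg]; apply: fS => Sz; case/eqP: zg.
by apply: pI; rewrite ?inE.
Qed.

Lemma fibre_sum_out f S x : (forall t, ~ S t -> f t = 0) -> ~ (p @` S) x ->
  fibre_sum p f x = 0.
Proof.
move=> fS Sx; apply: fsbig1 => g /= gx; apply: fS => Sg; apply: Sx.
by exists g.
Qed.

Hypothesis lp : local_homeo p.

Lemma fibre_sum_finite f C x : compact C -> (forall t, ~ C t -> f t = 0) ->
  fibre_sum p f x = \sum_(g \in p @^-1` [set x] `&` C) f g.
Proof.
move=> cC fC; apply/esym/fsbig_widen; first by move=> g [].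
by move=> g [gx gC] /=; apply: fC => Cg; apply: gC.
Qed.

Lemma fibre_sumD f h x : compactly_supported f -> compactly_supported h ->
  fibre_sum p (f \+ h) x = fibre_sum p f x + fibre_sum p h x.
Proof.
move=> [_ [C cC fC]] [_ [D cD hD]].
have cCD : compact (C `|` D) by exact: compactU.
rewrite !(fibre_sum_finite (C := C `|` D))//.
- by rewrite fsbig_split//; exact: finite_preimage_compact.
- by move=> t /not_orP[_ /hD].
- by move=> t /not_orP[/fC].
- by move=> t /not_orP[/fC /= -> /hD ->]; rewrite addr0.
Qed.

Lemma fibre_sumZ (a : K) f x : fibre_sum p (fun g => a * f g) x =
  a * fibre_sum p f x.
Proof. by rewrite /fibre_sum mulr_fsumr. Qed.

(** Over the image of S, which is clopen, the fibre sum is f composed with the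
    inverse of p on S; elsewhere it vanishes. *)
Lemma fibre_sum_inj_continuous f S : hausdorff_space X -> continuous p ->
  compact S -> open S -> set_inj S p ->
  continuous f -> (forall t, ~ S t -> f t = 0) -> continuous (fibre_sum p f).
Proof.
move=> hX cp cS oS pI cf fS x.
have [[g Sg <-{x}]|Sx] := pselect ((p @` S) x).
  rewrite /continuous_at (fibre_sum_inj pI fS Sg) => O /cf; rewrite nbhsE.
  move=> [W [oW Wg] WO].
  have : nbhs (p g) (p @` (W `&` S)).
    apply: open_nbhs_nbhs; split; first by apply: local_homeo_open => //; exact: openI.
    by exists g.
  apply: filterS => _ [t [Wt St] <-].
  by rewrite /= (fibre_sum_inj pI fS St); exact: WO.
rewrite /continuous_at (fibre_sum_out fS Sx).
apply: (@cvg_trans _ ((fun=> 0 : K) @ x)); last exact: cvg_cst.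
apply: near_eq_cvg; near=> y; apply/esym/(fibre_sum_out fS); near: y.
apply: open_nbhs_nbhs; split => //; apply: closed_openC.
apply: compact_closed => //; apply: continuous_compact => //.
exact: continuous_subspaceT.
Unshelve. all: by end_near. Qed.

End fibre_sum.

Section ample_groupoid.
Variable G : topGroupoid.
Hypotheses (hG : ample G) (hX : compact [set: units G]).
Local Notation X := (units G).

Lemma units_hausdorff : hausdorff_space X.
Proof.
case: hG => _ hGG _ _ _.
apply: (continuous_separated_hausdorff (@unt_continuous G) _ hGG).
exact: can_inj (@rng_unt G).
Qed.

Lemma units_clopen_basis (x : X) U : nbhs x U ->
  exists D, [/\ clopen D, D x & D `<=` U].
Proof.
by apply: clopen_nbhs_basis => //; [exact: units_hausdorff|case: hG].
Qed.

Lemma clopen_compact (D : set X) : closed D -> compact D.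
Proof. by move=> cD; exact: subclosed_compact cD hX _. Qed.

Lemma compact_open_clopen (S : set G) : compact S -> open S -> clopen S.
Proof. by move=> cS oS; split => //; apply: compact_closed => //; case: hG. Qed.

(** This is where total disconnectedness enters: a clopen set inside the image
    of a small open bisection lifts to a compact open bisection. *)
Lemma compact_open_bisection_basis (g : G) (O : set G) : nbhs g O ->
  exists S, [/\ compact_open_bisection S, S g & S `<=` O].
Proof.
move=> Og; have [_ _ lr ls _] := hG.
have [U [oU Ug _ [h [hK _ ch]]]] := ls g.
have [V [oV Vg _ [k [kK _ _]]]] := lr g.
pose W := U `&` V `&` O^°.
have oW : open W by apply: openI; [exact: openI|exact: open_interior].
have [D [cD Dg DW]] : exists D, [/\ clopen D, D (src g) & D `<=` src @` W].
  apply: units_clopen_basis; apply: open_nbhs_nbhs; split.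
    exact: local_homeo_open.
  by exists g.
have SE : W `&` src @^-1` D = h @` D.
  apply/seteqP; split=> [z [[[Uz _] _] Dz]|_ [_ /[dup]/DW[w Ww <-] Dw <-]].
    by exists (src z) => //; rewrite hK// inE.
  have [[Uw _] _] := Ww.
  by rewrite hK ?inE.
exists (W `&` src @^-1` D); split => //; last first.
  by move=> z [[_ /interior_subset]].
split.
- rewrite SE; apply: continuous_compact; last by apply: clopen_compact; case: cD.
  apply: continuous_subspaceW ch => z /DW[w [[Uw _] _] <-].
  by exists w.
- apply: openI => //.
  by case: cD => oD _; move/continuousP: (@src_continuous G); exact.
- split=> x y /set_mem[[[Ux Vx] _] _] /set_mem[[[Uy Vy] _] _] xy.
  + by rewrite -(kK x) ?inE// -(kK y) ?inE// xy.
  + by rewrite -(hK x) ?inE// -(hK y) ?inE// xy.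
Qed.

(** A compactly supported function is a finite sum of functions that vanish off
    a compact open bisection.  Compact open sets being clopen, restricting a
    continuous function to one of them keeps it continuous; such restrictions
    play the part of a partition of unity. *)
Lemma compactly_supported_ind (K : numFieldType) (P : (G -> K) -> Prop) :
  P (fun=> 0) ->
  (forall f h, compactly_supported f -> compactly_supported h ->
    P f -> P h -> P (f \+ h)) ->
  (forall S f, compact_open_bisection S -> continuous f ->
    (forall t, ~ S t -> f t = 0) -> P f) ->
  forall f, compactly_supported f -> P f.
Proof.
move=> P0 PD PS f [cf [C cC fC]].
pose Q (A : set G) := [/\ compact A, open A & forall f : G -> K, continuous f ->
  (forall t, ~ A t -> f t = 0) -> P f].
have [U CU [_ _ PU]] : exists2 U, C `<=` U & Q U.
  apply: compact_ind => //.
  - split; [exact: compact0|exact: open0|].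
    move=> k ck k0; rewrite (_ : k = fun=> 0)//.
    by apply/funext => x; exact: k0.
  - move=> A B [cA oA PA] [cB oB PB]; split; [exact: compactU|exact: openU|].
    move=> k ck kAB; have clA := compact_open_clopen cA oA.
    rewrite (patch_setC_split k A).
    have k1 : continuous (patch (fun=> 0) A k) by exact: continuous_patch.
    have k2 : continuous (patch (fun=> 0) (~` A) k).
      by apply: continuous_patch => //; exact: clopenC.
    have k1A t : ~ A t -> patch (fun=> 0) A k t = 0.
      by move=> At; rewrite /patch memNset.
    have k2B t : ~ B t -> patch (fun=> 0) (~` A) k t = 0.
      move=> Bt; rewrite /patch in_setC; case: ifPn => //.
      by rewrite notin_setE => At; apply: kAB => -[].
    apply: PD; [by split=> //; exists A|by split=> //; exists B|exact: PA|exact: PB].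
  - move=> g _; have [S [[cS oS bS] Sg _]] := @compact_open_bisection_basis g setT filterT.
    exists S; first exact: open_nbhs_nbhs.
    by split=> // k ck kS; apply: PS kS => //; split.
by apply: PU => // t Ut; apply: fC => /CU.
Qed.

Lemma fibre_sum_rng_continuous (K : numFieldType) (f : G -> K) :
  compactly_supported f -> continuous (fibre_sum rng f).
Proof.
have lr : local_homeo (@rng G) by case: hG.
move: f; apply: compactly_supported_ind.
- rewrite (_ : fibre_sum _ _ = fun=> 0); first by move=> x; exact: cvg_cst.
  by apply/funext => x; apply: fsbig1.
- move=> f h sf sh cf ch.
  rewrite (_ : fibre_sum _ _ = fibre_sum rng f \+ fibre_sum rng h).
    by move=> x; apply: cvgD; [exact: cf|exact: ch].
  by apply/funext => x; rewrite fibre_sumD.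
- move=> S f [cS oS [rI _]] cf fS.
  apply: fibre_sum_inj_continuous cS oS rI cf fS => //.
    exact: units_hausdorff.
  exact: rng_continuous.
Qed.

Lemma compact_ginv (C : set G) : compact C -> compact (ginv @^-1` C).
Proof.
move=> cC; rewrite (_ : _ @^-1` _ = ginv @` C).
  apply: continuous_compact => //; apply: continuous_subspaceT.
  exact: ginv_continuous.
apply/seteqP; split=> [g Cg|_ [g Cg <-]]; last by rewrite /= ginvK.
by exists (ginv g) => //; rewrite ginvK.
Qed.

Lemma compactly_supported_ginv (K : numFieldType) (f : G -> K) :
  compactly_supported f -> compactly_supported (f \o ginv).
Proof.
move=> [cf [C cC fC]]; split.
  by move=> x; apply: continuous_comp; [exact: ginv_continuous|exact: cf].
by exists (ginv @^-1` C); [exact: compact_ginv|move=> t /fC].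
Qed.

Lemma fibre_sum_ginv (K : numFieldType) (f : G -> K) x :
  fibre_sum src f x = fibre_sum rng (f \o ginv) x.
Proof.
rewrite /fibre_sum; apply: reindex_fsbig; split.
- by move=> g /= <-; rewrite src_inv.
- by move=> g h _ _ /(congr1 ginv); rewrite !ginvK.
- by move=> g /= <-; exists (ginv g); rewrite /= ?ginvK ?rng_inv.
Qed.

Lemma fibre_sum_src_continuous (K : numFieldType) (f : G -> K) :
  compactly_supported f -> continuous (fibre_sum src f).
Proof.
move=> sf; rewrite (_ : fibre_sum _ _ = fibre_sum rng (f \o ginv)).
  by apply: fibre_sum_rng_continuous; exact: compactly_supported_ginv.
by apply/funext => x; exact: fibre_sum_ginv.
Qed.

End ample_groupoid.

(** * Moduli of complex numbers *)

Section modulus.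
Variable R : realType.
Implicit Types z w : Cplx R.

(** The norm of a complex number is itself a complex number; the modulus is its
    real version. *)
Definition modulus z : R := complex.Re `|z|.

Lemma normCplxE z : `|z| = (modulus z)%:C%C.
Proof. by rewrite /modulus normc_def. Qed.

Lemma modulus_ge0 z : 0 <= modulus z.
Proof. by rewrite /modulus normc_def /= sqrtr_ge0. Qed.

Lemma modulus_sqr z : modulus z ^+ 2 = complex.Re z ^+ 2 + complex.Im z ^+ 2.
Proof. by rewrite /modulus normc_def /= sqr_sqrtr// addr_ge0// sqr_ge0. Qed.

Lemma modulusM z w : modulus (z * w) = modulus z * modulus w.
Proof.
have : `|z * w| = `|z| * `|w| by exact: normrM.
by rewrite !normCplxE -rmorphM => /complexI.
Qed.

Lemma modulusD z w : modulus (z + w) <= modulus z + modulus w.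
Proof.
have : `|z + w| <= `|z| + `|w| by exact: ler_normD.
by rewrite !normCplxE -rmorphD lecR.
Qed.

Lemma modulus_conj z : modulus z^* = modulus z.
Proof. by rewrite /modulus norm_conjC. Qed.

Lemma modulus_real (a : R) : modulus a%:C%C = `|a|.
Proof. by rewrite /modulus normc_def /= expr0n addr0 sqrtr_sqr. Qed.

Lemma Re_mul_conj z w : complex.Re (z * w^*) =
  complex.Re z * complex.Re w + complex.Im z * complex.Im w.
Proof. by case: z => a b; case: w => c d /=; rewrite mulrN opprK. Qed.

Lemma Re_modulus z : `|complex.Re z| <= modulus z.
Proof.
rewrite -(ler_pXn2r (n := 2)) ?nnegrE ?modulus_ge0//.
by rewrite real_normK ?num_real// modulus_sqr lerDl sqr_ge0.
Qed.

Lemma ReD z w : complex.Re (z + w) = complex.Re z + complex.Re w.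
Proof. by case: z; case: w. Qed.

Lemma ImD z w : complex.Im (z + w) = complex.Im z + complex.Im w.
Proof. by case: z; case: w. Qed.

Lemma ReZ (t : R) z : complex.Re (t%:C%C * z) = t * complex.Re z.
Proof. by case: z => a b /=; rewrite mul0r subr0. Qed.

Lemma ImZ (t : R) z : complex.Im (t%:C%C * z) = t * complex.Im z.
Proof. by case: z => a b /=; rewrite mul0r addr0. Qed.

Lemma Re_mul3_conj (a b c : Cplx R) :
  complex.Re (a * b * c^*) = complex.Re (a^* * c * b^*).
Proof. by case: a => a a'; case: b => b b'; case: c => c c' /=; ring. Qed.

Lemma lipschitz1_continuous (f : Cplx R -> R) :
  (forall z w, `|f z - f w| <= modulus (z - w)) -> continuous f.
Proof.
move=> fl z; apply/(@cvgrPdist_lt _ _ _ _ (nbhs_filter z)) => e e0.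
have : nbhs z (ball z e%:C%C) by apply: nbhsx_ballx; rewrite ltcR.
apply: filterS => w; rewrite -ball_normE /= normCplxE ltcR.
exact: le_lt_trans.
Qed.

Lemma modulus_continuous : continuous modulus.
Proof.
apply: lipschitz1_continuous => z w; rewrite ler_norml; apply/andP; split.
- rewrite lerBrDl lerBlDr addrC -{1}(subrK z w) (le_trans (modulusD _ _))//.
  by rewrite lerD2r /modulus distrC.
- by rewrite lerBlDr -{1}(subrK w z) modulusD.
Qed.

Lemma Re_continuous : continuous (fun z : Cplx R => complex.Re z).
Proof.
apply: lipschitz1_continuous => z w.
by rewrite (_ : _ - _ = complex.Re (z - w)) ?Re_modulus//; case: (z); case: (w).
Qed.

Lemma conj_continuous : continuous (fun z : Cplx R => z^*).
Proof.
move=> z; apply/(@cvgrPdist_lt _ _ _ _ (nbhs_filter z)) => e e0.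
have : nbhs z (ball z e) by exact: nbhsx_ballx.
by apply: filterS => w; rewrite -ball_normE /= -rmorphB norm_conjC.
Qed.

End modulus.

(** The Cauchy-Schwarz inequality in a form that covers degenerate positive
    semidefinite forms. *)
Lemma discriminant_le (R : realFieldType) (A B C : R) : 0 <= A ->
  (forall t, 0 <= A * t ^+ 2 + 2 * B * t + C) -> B ^+ 2 <= A * C.
Proof.
rewrite le_eqVlt => /predU1P[<-|A0] H.
  have [->|B0] := eqVneq B 0; first by rewrite expr0n mul0r.
  have := H (- (C + 1) / (2 * B)).
  by rewrite mul0r add0r mulrC divfK ?mulf_neq0//; lra.
have A0' : A != 0 by rewrite gt_eqF.
have E : A * (A * (- B / A) ^+ 2 + 2 * B * (- B / A) + C) = A * C - B ^+ 2 by field.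
by have := H (- B / A); rewrite -(pmulr_rge0 _ A0) E subr_ge0.
Qed.

(** * Invariant means on the unit space *)

Section invariant_mean.
Variables (R : realType) (G : topGroupoid).
Hypotheses (hG : ample G) (hX : compact [set: units G]).
Local Notation X := (units G).

Definition indicator (S : set G) : G -> R := patch (fun=> 0) S (fun=> 1).

(** The part of integration against a G-invariant probability measure that the
    representation needs: a normalized positive functional on the continuous
    functions that gives the range and the source of a compact open bisection
    the same weight, the indicator of p(S) being the fibre sum along p of the
    indicator of S. *)
Record invariant_mean (I : (X -> R) -> R) : Prop := InvariantMean {
  meanD : forall h k : X -> R, continuous h -> continuous k -> I (h \+ k) = I h + I k;
  meanZ : forall (a : R) (h : X -> R), continuous h -> I (fun x => a * h x) = a * I h;
  mean_ge0 : forall h : X -> R, continuous h -> (forall x, 0 <= h x) -> 0 <= I h;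
  mean1 : I (fun=> 1) = 1;
  mean_bisection : forall S, compact_open_bisection S ->
    I (fibre_sum rng (indicator S)) = I (fibre_sum src (indicator S)) }.

Variables (I : (X -> R) -> R) (hI : invariant_mean I).

Lemma le_mean (h k : X -> R) : continuous h -> continuous k -> (forall x, h x <= k x) ->
  I h <= I k.
Proof.
move=> ch ck hk.
pose d : X -> R := fun x => k x + - 1 * h x.
have c1 : continuous (fun x => - 1 * h x : R).
  by move=> x; apply: cvgM; [exact: cvg_cst|exact: ch].
have cd : continuous d by move=> x; apply: cvgD; [exact: ck|exact: c1].
have : 0 <= I d by apply: (mean_ge0 hI) => // x; rewrite /d mulN1r subr_ge0.
by rewrite /d (meanD hI)// (meanZ hI)// mulN1r subr_ge0.
Qed.

Lemma compactly_supported_indicator S : compact S -> open S ->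
  compactly_supported (indicator S).
Proof.
move=> cS oS; split.
  apply: continuous_patch; first exact: compact_open_clopen.
  by move=> x; exact: cvg_cst.
by exists S => // t St; rewrite /indicator /patch memNset.
Qed.

Lemma le_fibre_sum (p : G -> X) (f h : G -> R) x : local_homeo p ->
  compactly_supported f -> compactly_supported h -> (forall g, f g <= h g) ->
  fibre_sum p f x <= fibre_sum p h x.
Proof.
move=> lp sf sh fh; rewrite -subr_ge0 -mulN1r -fibre_sumZ addrC -fibre_sumD//.
  by apply: fsumr_ge0 => g _ /=; rewrite mulN1r addrC subr_ge0.
exact: compactly_supportedZ.
Qed.

(** If k is within e of the constant c on T, then the mean of its fibre sum is
    within e times the weight of T of c times that weight. *)
Let approx (p : G -> X) (T : set G) (k : G -> R) (c e : R) :
  local_homeo p -> (forall f : G -> R, compactly_supported f ->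
    continuous (fibre_sum p f)) ->
  compact T -> open T -> compactly_supported k ->
  (forall g, T g -> `|k g - c| <= e) -> (forall g, ~ T g -> k g = 0) ->
  `|I (fibre_sum p k) - c * I (fibre_sum p (indicator T))| <=
    e * I (fibre_sum p (indicator T)).
Proof.
move=> lp cp cT oT sk kT k0.
have s1 := compactly_supported_indicator cT oT.
have E a : a * I (fibre_sum p (indicator T)) =
    I (fibre_sum p (fun g => a * indicator T g)).
  rewrite -(meanZ hI); last exact: cp.
  by congr I; apply/funext => x; rewrite fibre_sumZ.
have le a : (forall g, T g -> k g <= a) ->
    I (fibre_sum p k) <= a * I (fibre_sum p (indicator T)).
  move=> ka; rewrite E; have sa := compactly_supportedZ a s1.
  apply: le_mean; [exact: cp|exact: cp|move=> x].
  apply: le_fibre_sum => // g; rewrite /indicator /patch.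
  case: ifPn => [/set_mem/ka|]; first by rewrite mulr1.
  by rewrite notin_setE => /k0 ->; rewrite mulr0.
have ge a : (forall g, T g -> a <= k g) ->
    a * I (fibre_sum p (indicator T)) <= I (fibre_sum p k).
  move=> ka; rewrite E; have sa := compactly_supportedZ a s1.
  apply: le_mean; [exact: cp|exact: cp|move=> x].
  apply: le_fibre_sum => // g; rewrite /indicator /patch.
  case: ifPn => [/set_mem/ka|]; first by rewrite mulr1.
  by rewrite notin_setE => /k0 ->; rewrite mulr0.
have H1 : (c - e) * I (fibre_sum p (indicator T)) <= I (fibre_sum p k).
  by apply: ge => g /kT; rewrite ler_norml; lra.
have H2 : I (fibre_sum p k) <= (c + e) * I (fibre_sum p (indicator T)).
  by apply: le => g /kT; rewrite ler_norml; lra.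
by move: H1 H2; rewrite mulrBl mulrDl ler_norml; lra.
Qed.

(** Invariance passes from indicators to continuous functions on a bisection
    by approximation: cut S into compact open pieces on which k varies by at
    most d; the two means then differ by at most 2d times the weight of S. *)
Lemma mean_fibre_sum_bisection S (k : G -> R) : compact_open_bisection S ->
  continuous k -> (forall g, ~ S g -> k g = 0) ->
  I (fibre_sum rng k) = I (fibre_sum src k).
Proof.
move=> [cS oS bS] ck kS.
have [_ hGG lr ls _] := hG.
have cpr := @fibre_sum_rng_continuous G hG hX R.
have cps := @fibre_sum_src_continuous G hG hX R.
have clS := compact_open_clopen hG cS oS.
apply/eqP; rewrite -subr_eq0 -normr_le0; apply/ler_addgt0Pr => e e0.
rewrite add0r.
pose a := I (fibre_sum rng (indicator S)).
have a0 : 0 <= a.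
  apply: (mean_ge0 hI); first by apply: cpr; exact: compactly_supported_indicator.
  move=> x; apply: fsumr_ge0 => g _; rewrite /indicator /patch; by case: ifP.
pose d := e / (2 * (a + 1)).
have d0 : 0 < d by rewrite divr_gt0// mulr_gt0// ltr_wpDl.
(* the bound is asked of every clopen part, so that overlapping pieces can be
   made disjoint *)
pose Q (T : set G) := [/\ compact T, open T & forall T' : set G, clopen T' -> T' `<=` T `&` S ->
  `|I (fibre_sum rng (patch (fun=> 0) T' k)) - I (fibre_sum src (patch (fun=> 0) T' k))|
    <= 2 * d * I (fibre_sum rng (indicator T'))].
suff [U SU [_ _ QU]] : exists2 U, S `<=` U & Q U.
  have := QU S clS; rewrite (_ : patch (fun=> 0) S k = k).
    move=> H; apply: (le_trans (H _)); first by move=> g Sg; split => //; exact: SU.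
    have dE : 2 * d * (a + 1) = e.
      by rewrite /d; field; rewrite gt_eqF// ltr_wpDl.
    rewrite -[leRHS]dE; apply: ler_wpM2l; first by rewrite mulr_ge0 ?ltW.
    by rewrite lerDl.
  apply/funext => g; rewrite /patch; case: ifPn => //.
  by rewrite notin_setE => /kS.
have spk T' : clopen T' -> T' `<=` S -> compactly_supported (patch (fun=> 0) T' k).
  move=> cT' T'S; apply: compactly_supported_patch => //.
  by split => //; exists S.
apply: compact_ind => //.
- split; [exact: compact0|exact: open0|move=> T' _].
  rewrite set0I subset0 => ->.
  rewrite /patch (_ : (fun _ => _) = fun=> 0); last first.
    by apply/funext => g; rewrite in_set0.
  have z (p : G -> X) : fibre_sum p (fun=> 0 : R) = fun=> 0.
    by apply/funext => x; apply: fsbig1.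
  rewrite !z subrr normr0; apply: mulr_ge0.
    by apply: mulr_ge0 => //; exact: ltW.
  apply: (mean_ge0 hI).
    by apply: cpr; apply: compactly_supported_indicator; [exact: compact0|exact: open0].
  by move=> x; apply: fsumr_ge0 => g _; rewrite /indicator /patch in_set0.
- move=> A B [cA oA QA] [cB oB QB]; split; [exact: compactU|exact: openU|].
  move=> T' cT' T'AB; have clA := compact_open_clopen hG cA oA.
  pose T1 := T' `&` A; pose T2 := T' `&` ~` A.
  have c1 : clopen T1 by exact: clopenI.
  have c2 : clopen T2 by apply: clopenI => //; exact: clopenC.
  have T1S : T1 `<=` S by move=> g [/T'AB[]].
  have T2S : T2 `<=` S by move=> g [/T'AB[]].
  have patchE (f : G -> R) : patch (fun=> 0) T' f = patch (fun=> 0) T1 f \+ patch (fun=> 0) T2 f.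
    apply/funext => g; rewrite /patch /= /T1 /T2 !in_setI in_setC.
    by case: (g \in T'); case: (g \in A); rewrite /= ?addr0 ?add0r.
  have i1 : compactly_supported (indicator T1).
    apply: compactly_supported_indicator; last by case: c1.
    by apply: subclosed_compact cS T1S; case: c1.
  have i2 : compactly_supported (indicator T2).
    apply: compactly_supported_indicator; last by case: c2.
    by apply: subclosed_compact cS T2S; case: c2.
  have FE (p : G -> X) (f1 f2 : G -> R) : local_homeo p ->
      (forall f : G -> R, compactly_supported f -> continuous (fibre_sum p f)) ->
      compactly_supported f1 -> compactly_supported f2 ->
      I (fibre_sum p (f1 \+ f2)) = I (fibre_sum p f1) + I (fibre_sum p f2).
    move=> lp cp s1 s2; rewrite -(meanD hI); [|exact: cp|exact: cp].
    by congr I; apply/funext => x; rewrite fibre_sumD.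
  have s1 := spk _ c1 T1S; have s2 := spk _ c2 T2S.
  rewrite patchE /indicator patchE !FE// mulrDr.
  rewrite opprD addrACA (le_trans (ler_normD _ _))// lerD//.
    by apply: QA => // g [/T'AB[_ ?] ?].
  by apply: QB => // g [/T'AB[[]]].
- move=> g Sg.
  have [T [[cT oT bT] Tg Td]] := @compact_open_bisection_basis G hG hX g
     (k @^-1` ball (k g) d) (ck g _ (nbhsx_ballx _ _ d0)).
  exists T; first exact: open_nbhs_nbhs.
  split=> // T' cT' T'T.
  have cpT' : compact T'.
    by apply: subclosed_compact cT _; [case: cT'|move=> t /T'T[]].
  have oT' : open T' by case: cT'.
  have bT' : compact_open_bisection T'.
    split => //; case: bT => r1 s1; split=> x y /set_mem/T'T[Tx _] /set_mem/T'T[Ty _].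
      by apply: r1; rewrite inE.
    by apply: s1; rewrite inE.
  have T'S : T' `<=` S by move=> t /T'T[].
  have kT' t : T' t -> `|patch (fun=> 0) T' k t - k g| <= d.
    move=> T't; rewrite /patch ifT ?inE//.
    have [/Td + _] := T'T _ T't; rewrite -ball_normE /= distrC; exact: ltW.
  have k0 t : ~ T' t -> patch (fun=> 0) T' k t = 0.
    by move=> T't; rewrite /patch memNset.
  have Hr := approx lr cpr cpT' oT' (spk _ cT' T'S) kT' k0.
  have Hs := approx ls cps cpT' oT' (spk _ cT' T'S) kT' k0.
  move: Hr Hs; rewrite -(mean_bisection hI bT').
  rewrite !ler_norml; lra.
Qed.

(** The measure on G obtained by integrating the counting measures of the range
    fibres is the one obtained from the source fibres. *)
Lemma mean_fibre_sum (k : G -> R) : compactly_supported k ->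
  I (fibre_sum rng k) = I (fibre_sum src k).
Proof.
have [_ hGG lr ls _] := hG.
have cpr := @fibre_sum_rng_continuous G hG hX R.
have cps := @fibre_sum_src_continuous G hG hX R.
move: k; apply: compactly_supported_ind => //.
- by congr I; apply/funext => x; rewrite /fibre_sum !fsbig1.
- move=> f h sf sh.
  have FE (p : G -> X) : local_homeo p ->
      (forall f : G -> R, compactly_supported f -> continuous (fibre_sum p f)) ->
      I (fibre_sum p (f \+ h)) = I (fibre_sum p f) + I (fibre_sum p h).
    move=> lp cp; rewrite -(meanD hI); [|exact: cp|exact: cp].
    by congr I; apply/funext => x; rewrite fibre_sumD.
  by rewrite !FE// => -> ->.
- exact: mean_fibre_sum_bisection.
Qed.

End invariant_mean.

(** * The Koopman representation *)

(* These rewrite rules replace simplification, which would unfold the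
   operations of the complex numbers down to their real components. *)
Lemma addfunE (T : Type) (V : nmodType) (f h : T -> V) x : (f \+ h) x = f x + h x.
Proof. by []. Qed.

Lemma compE (A B C : Type) (f : B -> C) (g : A -> B) x : (f \o g) x = f (g x).
Proof. by []. Qed.

Section action.
Variables (K : numFieldType) (G : topGroupoid).
Hypotheses (hG : ample G) (hX : compact [set: units G]).
Local Notation X := (units G).
Implicit Types (f h : G -> K) (xi : X -> K).

Lemma fibre_sum_morph (K' : numFieldType) (phi : K -> K') (p : G -> X) f x :
  local_homeo p -> {morph phi : u v / u + v} -> phi 0 = 0 -> compactly_supported f ->
  phi (fibre_sum p f x) = fibre_sum p (fun g => phi (f g)) x.
Proof.
move=> lp phiD phi0 [_ [D cD fD]].
have fin := finite_preimage_compact x lp cD.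
rewrite !(fibre_sum_finite _ (C:=D))//; last by move=> t /fD ->.
by rewrite !fsbig_finite// (big_morph phi phiD phi0).
Qed.

(** The Koopman representation of the convolution algebra on functions on the
    unit space. *)
Definition koopman f xi : X -> K := fibre_sum rng (fun g => f g * xi (src g)).

Let lr : local_homeo (@rng G). Proof. by case: hG. Qed.
Let ls : local_homeo (@src G). Proof. by case: hG. Qed.

Lemma continuous_src xi : continuous xi -> continuous (fun g : G => xi (src g)).
Proof.
by move=> cxi g; apply: continuous_comp; [exact: src_continuous|exact: cxi].
Qed.

Lemma continuous_rng xi : continuous xi -> continuous (fun g : G => xi (rng g)).
Proof.
by move=> cxi g; apply: continuous_comp; [exact: rng_continuous|exact: cxi].
Qed.

Lemma koopman_continuous f xi : compactly_supported f -> continuous xi ->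
  continuous (koopman f xi).
Proof.
move=> sf cxi; apply: fibre_sum_rng_continuous => //.
by apply: compactly_supportedM => //; exact: continuous_src.
Qed.

Lemma koopmanD f h xi : compactly_supported f -> compactly_supported h -> continuous xi ->
  koopman (f \+ h) xi = koopman f xi \+ koopman h xi.
Proof.
move=> sf sh cxi; apply/funext => x.
have sxi := continuous_src cxi.
rewrite /koopman /= -fibre_sumD//; try exact: compactly_supportedM.
by apply: eq_fsbigr => g _ /=; rewrite mulrDl.
Qed.

Lemma koopmanZ (a : K) f xi : koopman (fun g => a * f g) xi = fun x => a * koopman f xi x.
Proof.
apply/funext => x; rewrite /koopman -fibre_sumZ; apply: eq_fsbigr => g _.
by rewrite mulrA.
Qed.

(** In a convolution the second factor is determined by the first; summing over
    the first one alone turns the sum over factorizations into a sum over one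
    range fibre. *)
Definition convolution f h (g : G) : K :=
  \sum_(a \in rng @^-1` [set rng g]) f a * h (gmul (ginv a) g).

(** Both sides are the sum of f(a) h(b) xi(s(b)) over composable pairs with
    r(a) = x.  A has finitely many a that matter, and B the finitely many
    products, which justifies the exchange of the two sums. *)
Lemma koopman_convolution f h xi : compactly_supported f -> compactly_supported h ->
  koopman (convolution f h) xi = koopman f (koopman h xi).
Proof.
move=> [_ [D cD fD]] [_ [E cE hE]]; apply/funext => x.
pose A := rng @^-1` [set x] `&` D.
have fA : finite_set A by exact: finite_preimage_compact.
pose B := \bigcup_(a in A) gmul a @` (rng @^-1` [set src a] `&` E).
have fB : finite_set B.
  apply: bigcup_finite => // a _; apply: finite_image.
  exact: finite_preimage_compact.
have BA : B `<=` rng @^-1` [set x].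
  by move=> _ [a [/= ax Da] [b [/= bs Eb] <-]]; rewrite /= rng_mul.
have inB a g : A a -> rng g = x -> ~ B g -> h (gmul (ginv a) g) = 0.
  move=> Aa gx Bg; apply: hE => Eg; apply: Bg; exists a => //.
  have [/= ax _] := Aa.
  exists (gmul (ginv a) g).
    by split => //=; rewrite rng_mul ?src_inv ?rng_inv// ax.
  by rewrite gmulA ?src_inv ?rng_inv ?ax// gmulV ax -gx gmul1l.
transitivity (\sum_(g \in B) \sum_(a \in A) f a * h (gmul (ginv a) g) * xi (src g)).
  rewrite /koopman /fibre_sum -(fsbig_widen B)//.
    apply: eq_fsbigr => g /set_mem /BA /= gx.
    rewrite /convolution gx mulr_fsuml; apply/esym/fsbig_widen; first by move=> a [].
    by move=> a [ax Aa] /=; rewrite fD ?mul0r// => Da; apply: Aa.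
  move=> g [/= gx Bg]; rewrite /convolution gx fsbig1 ?mul0r// => a /= ax.
  have [Da|Da] := pselect (D a); last by rewrite fD// mul0r.
  by rewrite (inB a g)// mulr0.
rewrite exchange_fsbig//.
rewrite /koopman /fibre_sum -[RHS](fsbig_widen A); first last.
- by move=> a [ax Aa] /=; rewrite fD ?mul0r// => Da; apply: Aa.
- by move=> a [].
apply: eq_fsbigr => a /set_mem Aa; have [/= ax _] := Aa.
under eq_fsbigr do rewrite -mulrA.
rewrite -mulr_fsumr; congr (_ * _).
rewrite (fsbig_widen _ (rng @^-1` [set x])) ?BA//; last first.
  by move=> g [/= gx Bg]; rewrite (inB a g)// mul0r.
rewrite (reindex_fsbig (gmul a) (rng @^-1` [set src a])); last first.
  split=> [b /= ba|b b' /set_mem /= ba /set_mem /= b'a bb'|g /= gx].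
  - by rewrite rng_mul.
  - rewrite -[b]gmul1l -[b']gmul1l ba b'a -gmulVl -!gmulA ?src_inv//.
    by rewrite bb'.
  - exists (gmul (ginv a) g); first by rewrite /= rng_mul ?src_inv ?rng_inv ?ax.
    by rewrite gmulA ?src_inv ?rng_inv ?ax// gmulV ax -gx gmul1l.
apply: eq_fsbigr => b /set_mem /= ba.
by rewrite gmulA ?src_inv// gmulVl -ba gmul1l src_mul.
Qed.

End action.

Section koopman_representation.
Variables (R : realType) (G : topGroupoid).
Hypotheses (hG : ample G) (hX : compact [set: units G]).
Local Notation X := (units G).
Local Notation Cx := (Cplx R).
Implicit Types (f h : G -> Cx) (xi eta zeta : X -> Cx).

Lemma modulus_fibre_sum (p : G -> X) f x : local_homeo p -> compactly_supported f ->
  modulus (fibre_sum p f x) <= fibre_sum p (fun g => modulus (f g)) x.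
Proof.
move=> lp [_ [D cD fD]].
have fin := finite_preimage_compact x lp cD.
have m0 : modulus (0 : Cx) = 0 by rewrite /modulus normr0.
rewrite !(fibre_sum_finite _ (C:=D))//; last by move=> t /fD ->.
rewrite !fsbig_finite//; elim/big_ind2 : _ => [|u a v b ua vb|//].
  by rewrite m0.
by rewrite (le_trans (modulusD _ _))// lerD.
Qed.

Lemma conv_convolution f h : Defs.conv f h = convolution f h.
Proof.
apply/funext => g.
rewrite /Defs.conv (reindex_fsbig (fun a => (a, gmul (ginv a) g)) (rng @^-1` [set rng g]))//.
split=> [a /= ag|a b _ _ [//]|[a b] /= [ab abg]].
- by rewrite rng_mul ?src_inv// rng_inv gmulA ?rng_inv ?src_inv// gmulV ag gmul1l.
- exists a; first by rewrite -abg rng_mul.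
  by rewrite -abg gmulA ?src_inv// gmulVl ab gmul1l.
Qed.

Let lr : local_homeo (@rng G). Proof. by case: hG. Qed.

Variables (I : (X -> R) -> R) (hI : invariant_mean I).

(** The real part of the inner product of L^2.  A real inner product is enough
    for the C*-identity, since the adjoint relation below holds for it. *)
Definition l2_dot xi eta : R := I (fun x => complex.Re (xi x * (eta x)^*)).

Lemma continuous_l2_dot xi eta : continuous xi -> continuous eta ->
  continuous (fun x => complex.Re (xi x * (eta x)^*)).
Proof.
move=> cxi ceta x; apply: (@continuous_comp _ _ _ (fun x => xi x * (eta x)^*)).
  apply: cvgM; first exact: cxi.
  by apply: (@continuous_comp _ _ _ eta); [exact: ceta|exact: conj_continuous].
exact: Re_continuous.
Qed.

Lemma l2_dotC xi eta : l2_dot xi eta = l2_dot eta xi.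
Proof.
by congr I; apply/funext => x; rewrite !Re_mul_conj; congr (_ + _); exact: mulrC.
Qed.

Lemma l2_dotDl xi eta zeta : continuous xi -> continuous eta -> continuous zeta ->
  l2_dot (xi \+ eta) zeta = l2_dot xi zeta + l2_dot eta zeta.
Proof.
move=> cxi ceta czeta; rewrite /l2_dot -(meanD hI); try exact: continuous_l2_dot.
by congr I; apply/funext => x; rewrite !addfunE !Re_mul_conj ReD ImD; ring.
Qed.

Lemma l2_dotZl (t : R) xi eta : continuous xi -> continuous eta ->
  l2_dot (fun x => (t%:C%C : Cx) * xi x) eta = t * l2_dot xi eta.
Proof.
move=> cxi ceta; rewrite /l2_dot -(meanZ hI); last exact: continuous_l2_dot.
congr I; apply/funext => x; rewrite !Re_mul_conj ReZ ImZ; ring.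
Qed.

Lemma sqnE xi : l2_dot xi xi = I (fun x => modulus (xi x) ^+ 2).
Proof.
by congr I; apply/funext => x; rewrite modulus_sqr Re_mul_conj !expr2.
Qed.

Lemma continuous_modulus_sqr (T : topologicalType) (xi : T -> Cx) :
  continuous xi -> continuous (fun x => modulus (xi x) ^+ 2).
Proof.
move=> cxi x; rewrite /continuous_at; under eq_fun do rewrite expr2.
have c : {for x, continuous (fun x => modulus (xi x))}.
  by apply: continuous_comp; [exact: cxi|exact: modulus_continuous].
by rewrite expr2; apply: cvgM; exact: c.
Qed.

Lemma l2_dot_ge0 xi : continuous xi -> 0 <= l2_dot xi xi.
Proof.
move=> cxi; rewrite sqnE; apply: (mean_ge0 hI).
  exact: continuous_modulus_sqr.
by move=> x; exact: sqr_ge0.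
Qed.

Definition l2_norm xi : R := Num.sqrt (l2_dot xi xi).

Lemma l2_norm_ge0 xi : 0 <= l2_norm xi. Proof. exact: sqrtr_ge0. Qed.

Lemma l2_norm_sqr xi : continuous xi -> l2_norm xi ^+ 2 = l2_dot xi xi.
Proof. by move=> cxi; rewrite sqr_sqrtr// l2_dot_ge0. Qed.

Lemma continuousD_Cplx xi eta : continuous xi -> continuous eta ->
  continuous (xi \+ eta).
Proof. by move=> cxi ceta x; apply: cvgD; [exact: cxi|exact: ceta]. Qed.

Lemma l2_dot_le_norm xi eta : continuous xi -> continuous eta ->
  l2_dot xi eta <= l2_norm xi * l2_norm eta.
Proof.
move=> cxi ceta.
have H : l2_dot xi eta ^+ 2 <= l2_dot xi xi * l2_dot eta eta.
  apply: discriminant_le; first exact: l2_dot_ge0.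
  move=> t; pose txi x : Cx := (t%:C%C : Cx) * xi x.
  have ct : continuous txi.
    by move=> x; apply: cvgM; [exact: cvg_cst|exact: cxi].
  have cD : continuous (txi \+ eta) by exact: continuousD_Cplx.
  have := l2_dot_ge0 cD; rewrite l2_dotDl// l2_dotZl// [l2_dot xi _]l2_dotC l2_dotDl// l2_dotZl//.
  by rewrite [l2_dot eta (_ \+ _)]l2_dotC l2_dotDl// l2_dotZl// [l2_dot eta xi]l2_dotC; lra.
rewrite (le_trans (ler_norm _))// -(ler_pXn2r (n := 2)) ?nnegrE ?mulr_ge0 ?l2_norm_ge0//.
by rewrite real_normK ?num_real// exprMn !l2_norm_sqr.
Qed.

Lemma l2_normD xi eta : continuous xi -> continuous eta ->
  l2_norm (xi \+ eta) <= l2_norm xi + l2_norm eta.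
Proof.
move=> cxi ceta; rewrite -(ler_pXn2r (n := 2)) ?nnegrE ?addr_ge0 ?l2_norm_ge0//.
have cD := continuousD_Cplx cxi ceta.
rewrite l2_norm_sqr// l2_dotDl// ![l2_dot _ (_ \+ _)]l2_dotC !l2_dotDl//.
have := l2_dot_le_norm cxi ceta; rewrite sqrrD !l2_norm_sqr// [l2_dot eta xi]l2_dotC; lra.
Qed.

Lemma l2_normZ (a : Cx) xi : continuous xi ->
  l2_norm (fun x => a * xi x) = modulus a * l2_norm xi.
Proof.
move=> cxi; rewrite /l2_norm !sqnE.
rewrite (_ : I _ = modulus a ^+ 2 * I (fun x => modulus (xi x) ^+ 2)).
  by rewrite sqrtrM ?sqr_ge0// sqrtr_sqr ger0_norm// modulus_ge0.
rewrite -(meanZ hI); last exact: continuous_modulus_sqr.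
by congr I; apply/funext => x; rewrite modulusM exprMn.
Qed.

Lemma compactly_supported_form f xi eta : compactly_supported f ->
  continuous xi -> continuous eta ->
  compactly_supported (fun g => f g * xi (src g) * (eta (rng g))^*).
Proof.
move=> sf cxi ceta.
have c1 : continuous (fun g : G => (eta (rng g))^*).
  move=> g; apply: (@continuous_comp _ _ _ (fun g => eta (rng g))).
    exact: continuous_rng.
  exact: conj_continuous.
exact: (compactly_supportedM (compactly_supportedM sf (continuous_src cxi)) c1).
Qed.

Lemma l2_dot_koopman f xi eta : compactly_supported f -> continuous xi -> continuous eta ->
  l2_dot (koopman f xi) eta =
  I (fibre_sum rng (fun g => complex.Re (f g * xi (src g) * (eta (rng g))^*))).
Proof.
move=> sf cxi ceta; congr I; apply/funext => x.
rewrite -(fibre_sum_morph (phi := fun z : Cx => complex.Re z))//.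
- congr complex.Re; rewrite /koopman /fibre_sum mulr_fsuml.
  by apply: eq_fsbigr => g /set_mem /= ->.
- exact: ReD.
- exact: compactly_supported_form.
Qed.

Lemma compactly_supported_adj f : compactly_supported f -> compactly_supported (adj f).
Proof.
move=> sf; rewrite /adj.
apply: (compactly_supported_comp (phi := fun z : Cx => z^*)
  (f := f \o ginv)) => //; first exact: conj_continuous.
  by rewrite rmorph0.
exact: compactly_supported_ginv.
Qed.

(** Inversion exchanges range and source fibres, and by invariance the mean does
    not distinguish them. *)
Lemma koopman_adj f xi eta : compactly_supported f -> continuous xi -> continuous eta ->
  l2_dot (koopman f xi) eta = l2_dot xi (koopman (adj f) eta).
Proof.
move=> sf cxi ceta; rewrite [RHS]l2_dotC !l2_dot_koopman//; last exact: compactly_supported_adj.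
rewrite mean_fibre_sum//; last first.
  apply: (compactly_supported_comp (phi := fun z : Cx => complex.Re z)) => //.
    exact: Re_continuous.
  exact: compactly_supported_form.
congr I; apply/funext => x; rewrite fibre_sum_ginv; apply: eq_fsbigr => g _.
rewrite compE src_inv rng_inv /adj.
exact: Re_mul3_conj.
Qed.

(** The Schur test: the square of the norm of the operator f is at most the
    product of the suprema of the fibre sums of |f| along range and source,
    which are finite because these fibre sums are continuous. *)
Lemma koopman_bounded f : compactly_supported f ->
  exists2 M, 0 <= M & forall xi, continuous xi -> l2_norm (koopman f xi) <= M * l2_norm xi.
Proof.
move=> sf; pose m g := modulus (f g).
have m0 : modulus (0 : Cx) = 0 by rewrite /modulus normr0.
have sm : compactly_supported m.
  exact: (compactly_supported_comp (phi := @modulus R) (@modulus_continuous R) m0).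
have mge0 g : 0 <= m g by exact: modulus_ge0.
have cr := fibre_sum_rng_continuous hG hX sm.
have cs := fibre_sum_src_continuous hG hX sm.
have [M M0 HM] := continuous_bounded hX cr.
have [N N0 HN] := continuous_bounded hX cs.
exists (Num.sqrt (M * N)); first exact: sqrtr_ge0.
move=> xi cxi; rewrite /l2_norm -sqrtrM ?mulr_ge0// ler_wsqrtr//.
have cx2 := continuous_modulus_sqr cxi.
have smul (u : X -> R) : continuous u -> compactly_supported (fun g => m g * u (src g)).
  move=> cu; case: sm => cm [D cD mD]; split.
    move=> g; apply: cvgM; first exact: cm.
    by apply: continuous_comp; [exact: src_continuous|exact: cu].
  by exists D => // t /mD ->; rewrite mul0r.
have cmx : continuous (fun x => modulus (xi x)).
  by move=> x; apply: continuous_comp; [exact: cxi|exact: modulus_continuous].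
pose k1 g := m g * modulus (xi (src g)).
pose k2 g := m g * modulus (xi (src g)) ^+ 2.
have s1 : compactly_supported k1 by exact: (smul (fun x => modulus (xi x))).
have s2 : compactly_supported k2 by exact: (smul (fun x => modulus (xi x) ^+ 2)).
have c2 := fibre_sum_rng_continuous hG hX s2.
have schur x : modulus (koopman f xi x) ^+ 2 <= M * fibre_sum rng k2 x.
  apply: (@le_trans _ _ (fibre_sum rng m x * fibre_sum rng k2 x)); last first.
    apply: ler_wpM2r; last exact: HM.
    by apply: fsumr_ge0 => g _; rewrite mulr_ge0// sqr_ge0.
  apply: (@le_trans _ _ (fibre_sum rng k1 x ^+ 2)).
    rewrite ler_pXn2r// ?nnegrE ?modulus_ge0//; last first.
      by apply: fsumr_ge0 => g _; rewrite mulr_ge0// modulus_ge0.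
    rewrite /koopman; apply: (le_trans (modulus_fibre_sum _ _ _)) => //.
      exact: (compactly_supportedM sf (continuous_src cxi)).
    rewrite le_eqVlt; apply/orP; left; apply/eqP.
    by apply: eq_fsbigr => g _; rewrite modulusM.
  apply: discriminant_le; first by apply: fsumr_ge0.
  move=> t; have -> : fibre_sum rng m x * t ^+ 2 + 2 * fibre_sum rng k1 x * t +
      fibre_sum rng k2 x = fibre_sum rng ((fun g => t ^+ 2 * m g) \+
      ((fun g => (2 * t) * k1 g) \+ k2)) x.
    rewrite !fibre_sumD//; first by rewrite !fibre_sumZ; ring.
    - exact: compactly_supportedZ.
    - exact: compactly_supportedZ.
    - by apply: compactly_supportedD => //; exact: compactly_supportedZ.
  apply: fsumr_ge0 => g _ /=.
  rewrite (_ : _ + _ = m g * (t + modulus (xi (src g))) ^+ 2).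
    by rewrite mulr_ge0// sqr_ge0.
  by rewrite /k1 /k2; ring.
rewrite !sqnE; apply: (@le_trans _ _ (M * I (fibre_sum rng k2))).
  rewrite -(meanZ hI)//; apply: (le_mean hI) => //.
    by apply: continuous_modulus_sqr; exact: koopman_continuous.
  by move=> x; apply: cvgM; [exact: cvg_cst|exact: c2].
rewrite -mulrA ler_wpM2l// mean_fibre_sum// -(meanZ hI)//.
apply: (le_mean hI).
- exact: fibre_sum_src_continuous.
- by move=> x; apply: cvgM; [exact: cvg_cst|exact: cx2].
- move=> x; apply: (@le_trans _ _ (modulus (xi x) ^+ 2 * fibre_sum src m x)).
    rewrite -fibre_sumZ le_eqVlt; apply/orP; left; apply/eqP.
    by apply: eq_fsbigr => g /set_mem /= gx; rewrite /k2 gx mulrC.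
  by rewrite mulrC ler_wpM2r// sqr_ge0.
Qed.

Definition op_bound f : set R :=
  [set c | 0 <= c /\ forall xi, continuous xi -> l2_norm (koopman f xi) <= c * l2_norm xi].

Definition op_norm f : R := inf (op_bound f).

Lemma op_bound_ge0 f : has_lbound (op_bound f).
Proof. by exists 0 => c []. Qed.

Lemma op_norm_le f c : op_bound f c -> op_norm f <= c.
Proof. by move=> fc; apply: ge_inf => //; exact: op_bound_ge0. Qed.

(** The infimum of the bounds is itself a bound as soon as there is one. *)
Lemma op_normP f c : op_bound f c -> op_bound f (op_norm f).
Proof.
move=> fc; have ne : op_bound f !=set0 by exists c.
split; first by apply: lb_le_inf => // d [].
move=> xi cxi; have [z|z] := eqVneq (l2_norm xi) 0.
  by case: fc => _ /(_ _ cxi); rewrite z !mulr0.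
have p : 0 < l2_norm xi by rewrite lt_neqAle eq_sym z l2_norm_ge0.
rewrite -ler_pdivrMr//; apply: lb_le_inf => // d [_ /(_ _ cxi)].
by rewrite ler_pdivrMr.
Qed.

Lemma op_norm_bound f : compactly_supported f -> op_bound f (op_norm f).
Proof.
by move=> /koopman_bounded[M M0 HM]; apply: (@op_normP _ M).
Qed.

Lemma op_bound_conv f h c d : compactly_supported f -> compactly_supported h ->
  op_bound f c -> op_bound h d -> op_bound (Defs.conv f h) (c * d).
Proof.
move=> sf sh [c0 fc] [d0 hd]; split; first exact: mulr_ge0.
move=> xi cxi; rewrite conv_convolution koopman_convolution//.
have cx := koopman_continuous hG hX sh cxi.
apply: (le_trans (fc _ cx)); rewrite -mulrA; apply: ler_wpM2l => //.
exact: hd.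
Qed.

Lemma op_norm_adj f : compactly_supported f -> op_norm (adj f) <= op_norm f.
Proof.
move=> sf; have [f0 fb] := op_norm_bound sf.
have sa := compactly_supported_adj sf.
apply: op_norm_le; split=> // xi cxi; have ca := koopman_continuous hG hX sa cxi.
have [z|z] := eqVneq (l2_norm (koopman (adj f) xi)) 0; first by rewrite z mulr_ge0 ?l2_norm_ge0.
have p : 0 < l2_norm (koopman (adj f) xi) by rewrite lt_neqAle eq_sym z l2_norm_ge0.
rewrite -(ler_pM2l p) -expr2 l2_norm_sqr// -koopman_adj//.
have cf := koopman_continuous hG hX sf ca.
apply: (le_trans (l2_dot_le_norm cf cxi)).
rewrite mulrA [l2_norm _ * op_norm f]mulrC; apply: ler_wpM2r; first exact: l2_norm_ge0.
exact: (fb _ ca).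
Qed.

Lemma Cc_compactly_supported f : Cc f -> compactly_supported f.
Proof.
move=> [cf cC]; split=> //; exists (closure [set g | f g != 0]) => // t nC.
by apply/eqP; apply: contrapT => /negP ft; apply: nC; exact: subset_closure.
Qed.

(** The C*-identity comes from ||f xi||^2 = <f^* f xi, xi> and from the fact that
    bounds multiply under convolution. *)
Lemma op_norm_cstar : cstar_seminorm op_norm.
Proof.
split.
- by move=> f /Cc_compactly_supported/op_norm_bound[].
- move=> f h /Cc_compactly_supported sf /Cc_compactly_supported sh.
  have [f0 fb] := op_norm_bound sf; have [h0 hb] := op_norm_bound sh.
  apply: op_norm_le; split; first exact: addr_ge0.
  move=> xi cxi; rewrite koopmanD//.
  apply: (le_trans (l2_normD (koopman_continuous hG hX sf cxi) (koopman_continuous hG hX sh cxi))).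
  by rewrite mulrDl; apply: lerD; [exact: fb|exact: hb].
- move=> a f /Cc_compactly_supported sf; rewrite /rnorm -/(modulus a).
  have [f0 fb] := op_norm_bound sf.
  have bZ b h c : compactly_supported h -> op_bound h c ->
      op_bound (fun g => b * h g) (modulus b * c).
    move=> sh [c0 hc]; split; first by rewrite mulr_ge0// modulus_ge0.
    move=> xi cxi; rewrite koopmanZ (l2_normZ b (koopman_continuous hG hX sh cxi)).
    by rewrite -mulrA; apply: ler_wpM2l; [exact: modulus_ge0|exact: hc].
  have sa : compactly_supported (fun g => a * f g) by exact: compactly_supportedZ.
  apply/eqP; rewrite eq_le; apply/andP; split.
    by apply: op_norm_le; apply: bZ => //; exact: op_norm_bound.
  have [->|a0] := eqVneq a 0.
    rewrite (_ : modulus 0 = 0) ?mul0r; last by rewrite /modulus normr0.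
    have s0 : compactly_supported (fun g => 0 * f g) by exact: compactly_supportedZ.
    by have [] := op_norm_bound s0.
  have ma : 0 < modulus a.
    by rewrite lt_neqAle modulus_ge0 andbT eq_sym -(inj_eq (@complexI R)) -normCplxE normr_eq0.
  rewrite -ler_pdivlMl//.
  have -> : f = (fun g => a^-1 * (a * f g)) by apply/funext => g; rewrite mulKf.
  have -> : (fun g => a * (a^-1 * (a * f g))) = fun g => a * f g.
    by apply/funext => g; rewrite mulKf.
  have -> : (modulus a)^-1 = modulus a^-1.
    apply: (mulfI (lt0r_neq0 ma)); rewrite divff ?lt0r_neq0// -modulusM divff//.
    by rewrite /modulus normr1.
  by apply: op_norm_le; apply: bZ => //; exact: op_norm_bound.
- move=> f h /Cc_compactly_supported sf /Cc_compactly_supported sh.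
  by apply: op_norm_le; apply: op_bound_conv => //; exact: op_norm_bound.
- move=> f /Cc_compactly_supported sf; have sa := compactly_supported_adj sf.
  have [f0 fb] := op_norm_bound sf; have [a0 ab] := op_norm_bound sa.
  have bc : op_bound (Defs.conv (adj f) f) (op_norm (adj f) * op_norm f).
    by apply: op_bound_conv => //; exact: op_norm_bound.
  have [c0 cb] := op_normP bc.
  apply/eqP; rewrite eq_le; apply/andP; split.
    by rewrite (le_trans (op_norm_le bc))// expr2 ler_wpM2r// op_norm_adj.
  rewrite -[leRHS]sqr_sqrtr// ler_pXn2r ?nnegrE ?sqrtr_ge0//.
  apply: op_norm_le; split; first exact: sqrtr_ge0.
  move=> xi cxi; have cx := koopman_continuous hG hX sf cxi.
  have cax := koopman_continuous hG hX sa cx.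
  rewrite -(ler_pXn2r (n := 2)) ?nnegrE ?mulr_ge0 ?l2_norm_ge0 ?sqrtr_ge0//.
  rewrite exprMn (l2_norm_sqr cx) sqr_sqrtr// (koopman_adj sf cxi cx) l2_dotC.
  apply: (le_trans (l2_dot_le_norm cax cxi)).
  rewrite -koopman_convolution// -conv_convolution expr2 mulrA.
  by apply: ler_wpM2r; [exact: l2_norm_ge0|exact: cb].
Qed.

End koopman_representation.

(** * Weak containment from an invariant measure *)

Section integral_mean.
Variables (R : realType) (G : topGroupoid).
Hypotheses (hG : ample G) (hX : compact [set: units G]).
Local Notation X := (units G).
Variable mu : probability (Borel X) R.
Hypothesis mu_inv : groupoid_invariant mu.

Lemma borel_open (Y : ptopologicalType) (U : set Y) : open U ->
  measurable (U : set (Borel Y)).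
Proof. by move=> oU; exact: sub_sigma_algebra. Qed.

Lemma borel_continuous (h : X -> R) : continuous h ->
  measurable_fun [set: Borel X] (h : Borel X -> R).
Proof.
move=> ch; apply: (measurability _ (RGenOpens.measurableE R)).
move=> _ [_ [a [b ->] <-]]; rewrite setTI; apply: borel_open.
by move/continuousP : ch; apply; exact: interval_open.
Qed.

Lemma borel_integrable (h : X -> R) : continuous h ->
  mu.-integrable [set: Borel X] (EFin \o h).
Proof.
move=> ch; apply: measurable_bounded_integrable => //.
- exact: (eq_ind_r (fun z => (z < +oo)%E) (ltry 1) (probability_setT mu)).
- exact: borel_continuous.
- have ca : continuous (fun x => `|h x|).
    by move=> x; apply: continuous_comp; [exact: ch|exact: norm_continuous].
  have [M M0 HM] := continuous_bounded hX ca.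
  exists M; split; first exact: num_real.
  by move=> y My x _ /=; rewrite (le_trans (HM x))// ltW.
Qed.

Definition integral_mean (h : X -> R) : R := \int[mu]_x h x.

Lemma integral_mean_invariant : invariant_mean integral_mean.
Proof.
split.
- by move=> h k ch ck; rewrite /integral_mean RintegralD//; exact: borel_integrable.
- by move=> a h ch; rewrite /integral_mean RintegralZl//; exact: borel_integrable.
- by move=> h ch h0; apply: Rintegral_ge0.
- rewrite /integral_mean Rintegral_cst// mul1r.
  exact: (congr1 fine (probability_setT mu)).
- move=> S [cS oS bS].
  have [_ hGG lr ls _] := hG.
  have E (p : G -> X) : set_inj S p -> local_homeo p ->
      integral_mean (fibre_sum p (indicator R S)) = fine (mu (p @` S)).
    move=> pI lp; rewrite /integral_mean /Rintegral.
    have -> : fibre_sum p (indicator R S) = \1_(p @` S).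
      apply/funext => x; rewrite indicE.
      have [/set_mem[g Sg <-]|] := boolP (x \in p @` S).
        rewrite (fibre_sum_inj (S := S))//.
          by rewrite /indicator /patch ifT// inE.
        by move=> t St; rewrite /indicator /patch memNset.
      rewrite notin_setE => xS; rewrite (fibre_sum_out (S := S))//.
      by move=> t St; rewrite /indicator /patch memNset.
    rewrite integral_indic// ?setIT//; apply: borel_open.
    exact: local_homeo_open.
  by rewrite !E ?(mu_inv oS bS)//; case: bS.
Qed.

End integral_mean.

Section weak_containment.
Variables (R : realType) (G : topGroupoid).
Hypotheses (hG : ample G) (hX : compact [set: units G]).
Local Notation X := (units G).
Local Notation Cx := (Cplx R).
Variable A : full_cstar R G.

Lemma normCplx_rnorm (V : normedModType (Cplx R)) (x : V) : `|x| = (rnorm x)%:C%C.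
Proof. by rewrite /rnorm RRe_real// ger0_real. Qed.

Lemma compactly_supported_Cc (f : G -> Cx) : compactly_supported f -> Cc f.
Proof.
move=> [cf [C cC fC]]; split=> //.
have hGG : hausdorff_space G by case: hG.
apply: (subclosed_compact _ cC); first exact: closed_closure.
rewrite [X in _ `<=` X](closure_id C).1; last exact: compact_closed.
apply: closureS => g /= /eqP fg; apply: contrapT => Cg.
exact/fg/fC.
Qed.

Lemma compactly_supported_indic (S : set G) : compact S -> open S ->
  compactly_supported (\1_S : G -> Cx).
Proof.
move=> cS oS; rewrite (_ : \1_S = patch (fun=> 0) S (fun=> 1)); last first.
  by apply/funext => g; rewrite indicE /patch; case: (g \in S).
split; last by exists S => // t St; rewrite /patch memNset.
apply: continuous_patch; first exact: compact_open_clopen.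
by move=> x; exact: cvg_cst.
Qed.

Lemma Cc_indic (S : set G) : compact S -> open S -> Cc (\1_S : G -> Cx).
Proof.
by move=> cS oS; apply: compactly_supported_Cc; exact: compactly_supported_indic.
Qed.

(** The combination of the indicators of the bisections U_i with coefficients
    a_i multiplies the constant function 1 by the sum of the a_i, since each
    U_i has exactly one arrow over each unit. *)
Lemma full_group_sum_embed (s : seq (Cx * full_group hG hX)) :
  exists F : G -> Cx, [/\ compactly_supported F,
    embed A F = \sum_(p <- s) p.1 *: pi_rep A p.2
    & forall x, koopman F (fun=> 1) x = \sum_(p <- s) p.1].
Proof.
elim: s => [|[a U] s [F [sF eF aF]]].
  have s0 : compactly_supported (fun _ : G => 0 : Cx).
    by split; [move=> x; exact: cvg_cst|exists set0 => //; exact: compact0].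
  exists (fun g => 0 * 0); split.
  - exact: compactly_supportedZ.
  - rewrite big_nil (embedZ A 0 (f := fun=> 0)) ?scale0r//.
    exact: compactly_supported_Cc.
  - by move=> x; rewrite big_nil /koopman; apply: fsbig1 => g _; rewrite !mul0r.
have [cU oU bU rU _] := set_mem (valP U).
have s1 := compactly_supported_indic cU oU.
have sa := compactly_supportedZ a s1.
exists ((fun g => a * \1_(val U) g) \+ F); split.
- exact: compactly_supportedD.
- rewrite big_cons embedD; try exact: compactly_supported_Cc.
  by rewrite embedZ ?eF//; exact: compactly_supported_Cc.
- move=> x; rewrite big_cons koopmanD//; last by move=> y; exact: cvg_cst.
  rewrite addfunE aF koopmanZ; congr (_ + _).
  have [g Ug <-] : (rng @` val U) x by rewrite rU.
  rewrite /koopman (fibre_sum_inj (S := val U))//; last 2 first.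
  + by case: bU.
  + by move=> t Ut; rewrite indicE memNset// mul0r.
  by rewrite indicE mem_set// !mulr1.
Qed.

(** The operator norm on L^2(mu) is one of the seminorms of which the universal
    norm is the supremum, and testing it on the constant function 1, which has
    norm 1, gives the trivial representation. *)
Lemma invariant_weakly_contains (mu : probability (Borel X) R) :
  groupoid_invariant mu ->
  weakly_contains (@pi_rep R G A hG hX) (@trivial_rep R (full_group hG hX)).
Proof.
move=> /(integral_mean_invariant hG hX) hI s.
have [F [sF <- aF]] := full_group_sum_embed s.
have -> : \sum_(p <- s) p.1 *: trivial_rep R p.2 = \sum_(p <- s) p.1 :> Cx.
  by apply: eq_bigr => p _; exact: mulr1.
rewrite !normCplx_rnorm lecR; set c := \sum_(p <- s) p.1.
have H1 : modulus c <= op_norm (integral_mean mu) F.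
  have [_ /(_ (fun=> 1))] := op_norm_bound hG hX hI sF.
  have c1 : continuous (fun _ : X => 1 : Cx) by move=> x; exact: cvg_cst.
  have -> : koopman F (fun=> 1) = fun x => c * 1.
    by apply/funext => x; rewrite aF mulr1.
  rewrite (l2_normZ hI c c1).
  have -> : l2_norm (integral_mean mu) (fun=> 1 : Cx) = 1.
    rewrite /l2_norm sqnE -[RHS]sqrtr1; congr Num.sqrt.
    rewrite -[RHS](mean1 hI); congr integral_mean; apply/funext => x.
    by rewrite /modulus normr1 expr1n.
  by rewrite !mulr1; apply.
apply: (le_trans H1); rewrite -lee_fin embed_norm; last exact: compactly_supported_Cc.
apply: ereal_sup_ubound; exists (op_norm (integral_mean mu)); last reflexivity.
exact: (op_norm_cstar hG hX hI).
Qed.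

End weak_containment.

(** * Radon measures from contents on clopen sets *)

Section clopen_content.
Variables (R : realType) (X : ptopologicalType) (m : set X -> R).
Hypotheses (hX : compact [set: X]).
Hypothesis clopen_basis : forall (x : X) U, nbhs x U ->
  exists D, [/\ clopen D, D x & D `<=` U].
Hypotheses (m_ge0 : forall K, clopen K -> 0 <= m K)
  (mU : forall K L, clopen K -> clopen L -> K `&` L = set0 ->
    m (K `|` L) = m K + m L)
  (mT : m setT = 1).

Lemma content_le K L : clopen K -> clopen L -> K `<=` L -> m K <= m L.
Proof.
move=> cK cL KL; have cD : clopen (L `\` K).
  by rewrite setDE; apply: clopenI => //; exact: clopenC.
rewrite -(setDUK KL) mU//; first by rewrite lerDl m_ge0.
by rewrite setDE setICA setICr setI0.
Qed.

Lemma content0 : m set0 = 0.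
Proof.
have := mU (@clopen0 X) (@clopen0 X); rewrite setU0 setI0 => /(_ erefl); lra.
Qed.

(** A finitely additive m on the clopen sets is extended first to open sets
    from inside, then to all sets from outside.  The space need not be second
    countable, so its Borel sets are in general not generated by the clopen
    sets, and the usual extension of premeasures would not reach them. *)
Definition open_content (U : set X) : \bar R :=
  ereal_sup [set (m K)%:E | K in [set K | clopen K /\ K `<=` U]].

Definition outer_content (E : set X) : \bar R :=
  ereal_inf [set open_content U | U in [set U | open U /\ E `<=` U]].

Local Open Scope ereal_scope.

Lemma open_content_le U V : U `<=` V -> open_content U <= open_content V.
Proof.
move=> UV; apply: ereal_sup_le => _ [K [cK KU] <-].
by exists K => //; split => //; exact: subset_trans UV.
Qed.

Lemma open_content_ge K U : clopen K -> K `<=` U -> (m K)%:E <= open_content U.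
Proof. by move=> cK KU; apply: ereal_sup_ubound; exists K. Qed.

Lemma open_content_clopen K : clopen K -> open_content K = (m K)%:E.
Proof.
move=> cK; apply/eqP; rewrite eq_le open_content_ge// andbT.
by apply: ge_ereal_sup => _ [L [cL LK] <-]; rewrite lee_fin content_le.
Qed.

Lemma open_content_ge0 U : 0 <= open_content U.
Proof.
by rewrite -[0]/(0%:E) -content0; apply: open_content_ge => //; exact: clopen0.
Qed.

(** Countable subadditivity comes from compactness: a clopen K inside the union
    is covered by finitely many clopen F_n inside the U_n. *)
Lemma open_content_bigcup (U : (set X)^nat) : (forall n, open (U n)) ->
  open_content (\bigcup_n U n) <= \sum_(n <oo) open_content (U n).
Proof.
move=> oU; apply: ge_ereal_sup => _ [K [cK KU] <-].
have [A KA [N [F [FU AF]]]] : exists2 A : set X, K `<=` A &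
    exists N (F : (set X)^nat), (forall n, clopen (F n) /\ F n `<=` U n) /\
      A `<=` \bigcup_(n < N) F n.
  apply: compact_ind.
  - by apply: (subclosed_compact _ hX) => //; case: cK.
  - exists 0%N, (fun=> set0); split=> // n; split => //; exact: clopen0.
  - move=> A B [N [F [FU AF]]] [N' [F' [FU' BF]]].
    exists (maxn N N'), (fun n => F n `|` F' n); split.
      move=> n; have [? ?] := FU n; have [? ?] := FU' n.
      by split; [exact: clopenU|rewrite subUset].
    move=> x [/AF|/BF] [n /= nN Fn]; exists n => /=.
    + by rewrite leq_max nN.
    + by left.
    + by rewrite leq_max nN orbT.
    + by right.
  - move=> x /KU [n _ Unx].
    have [D [cD Dx DU]] := clopen_basis (open_nbhs_nbhs (conj (oU n) Unx)).
    exists D; first by apply: open_nbhs_nbhs; split => //; case: cD.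
    exists n.+1, (fun k => if k == n then D else set0); split.
      by move=> k; case: eqP => [->|_]; split => //; exact: clopen0.
    by move=> y Dy; exists n => //=; rewrite eqxx.
have H : forall M (L : set X), clopen L -> L `<=` \bigcup_(n < M) F n ->
    (m L)%:E <= \sum_(0 <= n < M) open_content (U n).
  elim=> [L cL LF|M IH L cL LF].
    have -> : L = set0 by rewrite -subset0 => x /LF[].
    by rewrite big_nil content0.
  have [cF FUM] := FU M.
  have c1 : clopen (L `\` F M).
    by rewrite setDE; apply: clopenI => //; exact: clopenC.
  have c2 : clopen (L `&` F M) by exact: clopenI.
  rewrite -(setUIDK L (F M)) setUC mU//; last first.
    by rewrite -subset0 => x [[_ ?] [_ ?]].
  rewrite EFinD big_nat_recr//=; apply: leeD.
    apply: IH => // x [/LF[n /= nM Fn] FM]; exists n => //=.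
    move: nM; rewrite ltnS leq_eqVlt => /predU1P[nM|//].
    by rewrite nM in Fn.
  by apply: open_content_ge => //; exact: subset_trans FUM.
apply: (le_trans (H N K cK _)); first exact: subset_trans AF.
by apply: nneseries_lim_ge => n _ _; exact: open_content_ge0.
Qed.

Lemma outer_content_open U : open U -> outer_content U = open_content U.
Proof.
move=> oU; apply/eqP; rewrite eq_le; apply/andP; split.
  by apply: ereal_inf_lbound => /=; exists U => //; split.
apply: le_ereal_inf_tmp => _ [V [oV UV] <-]; exact: open_content_le.
Qed.

Lemma outer_content_le A B : A `<=` B -> outer_content A <= outer_content B.
Proof.
move=> AB; apply: ereal_inf_le_tmp => _ [V [oV BV] <-].
by exists V => //; split => //; exact: subset_trans BV.
Qed.

Lemma outer_content_ge0 A : 0 <= outer_content A.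
Proof. by apply: le_ereal_inf_tmp => _ [V _ <-]; exact: open_content_ge0. Qed.

Lemma outer_content0 : outer_content set0 = 0.
Proof.
by rewrite outer_content_open ?open_content_clopen ?content0//;
  [exact: clopen0|exact: open0].
Qed.

Lemma outer_contentT : outer_content setT = 1.
Proof.
by rewrite outer_content_open ?open_content_clopen ?mT//;
  [exact: clopenT|exact: openT].
Qed.

Lemma outer_content_fin A : outer_content A \is a fin_num.
Proof.
apply/fin_numPlt/andP; split.
  by rewrite (lt_le_trans _ (outer_content_ge0 A)).
by rewrite (le_lt_trans (outer_content_le (@subsetT _ A)))// outer_contentT ltry.
Qed.

Lemma outer_content_sigma_subadditive : sigma_subadditive outer_content.
Proof.
move=> A; apply/lee_addgt0Pr => e e0.
rewrite (le_trans _ (epsilon_trick _ _ (ltW e0)))//; last first.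
  by move=> n; exact: outer_content_ge0.
have [U HU] : {U : (set X)^nat & forall n, [/\ open (U n), A n `<=` U n &
    open_content (U n) <= outer_content (A n) + (e / (2 ^ n.+1)%:R)%:E]}.
  apply: (@choice _ _ (fun n V => [/\ open V, A n `<=` V &
    open_content V <= outer_content (A n) + (e / (2 ^ n.+1)%:R)%:E])) => n.
  have en : (0 < e / (2 ^ n.+1)%:R)%R by rewrite divr_gt0// ltr0n expn_gt0.
  have [_ [V [oV AV] <-] Vlt] := lb_ereal_inf_adherent en (outer_content_fin (A n)).
  by exists V; split => //; exact: ltW.
have oU n : open (U n) by case: (HU n).
apply: (@le_trans _ _ (open_content (\bigcup_n U n))).
  rewrite -outer_content_open; last exact: bigcup_open.
  by apply: outer_content_le; apply: subset_bigcup => n _; case: (HU n).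
apply: (le_trans (open_content_bigcup oU)).
by apply: lee_nneseries => [n _ _|n _]; [exact: open_content_ge0|case: (HU n)].
Qed.

(** For K clopen inside V and O, a clopen L inside V minus K is disjoint from
    K, so m(K) + m(L) is at most the content of V; the supremum over L, then
    over K, gives the inequality. *)
Lemma open_contentD O V : open O -> open V ->
  open_content (V `&` O) + outer_content (V `\` O) <= open_content V.
Proof.
move=> oO oV; rewrite -leeBrDr ?outer_content_fin//.
apply: ge_ereal_sup => _ [K [cK KVO] <-].
rewrite leeBrDr ?outer_content_fin// -leeBrDl//.
apply: (@le_trans _ _ (open_content (V `\` K))).
  rewrite -outer_content_open; last first.
    by rewrite setDE; apply: openI => //; apply: closed_openC; case: cK.
  by apply: outer_content_le => x [Vx nOx]; split => // /KVO[].
apply: ge_ereal_sup => _ [L [cL LVK] <-].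
rewrite leeBrDl// -EFinD -mU//; last by rewrite -subset0 => x [Kx /LVK[]].
apply: open_content_ge; first exact: clopenU.
by rewrite subUset; split=> x; [move=> /KVO[]|move=> /LVK[]].
Qed.

Definition stone_outer : {outer_measure set X -> \bar R} :=
  HB.pack_for (outer_measure R X) outer_content
    (isOuterMeasure.Build R X outer_content outer_content0 outer_content_ge0
      outer_content_le outer_content_sigma_subadditive).

Lemma open_caratheodory (O : set X) : open O -> stone_outer.-caratheodory O.
Proof.
move=> oO; apply: le_caratheodory_measurable => E.
apply: le_ereal_inf_tmp => _ [V [oV EV] <-].
apply: (le_trans _ (open_contentD oO oV)); apply: leeD.
  rewrite -outer_content_open; last exact: openI.
  by apply: outer_content_le; exact: setSI.
by apply: outer_content_le; exact: setSI.
Qed.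

Lemma borel_caratheodory (E : set (Borel X)) : measurable E ->
  stone_outer.-caratheodory E.
Proof.
apply: (@smallest_sub _ (sigma_algebra setT) (@open X)
  (stone_outer.-caratheodory)); last exact: open_caratheodory.
split.
- exact: caratheodory_measurable_set0.
- by move=> A cA; rewrite setTD; exact: caratheodory_measurable_setC.
- exact: caratheodory_measurable_bigcup.
Qed.

Lemma outer_content_sigma_additive :
  semi_sigma_additive (outer_content : set (Borel X) -> \bar R).
Proof.
move=> F mF tF mUF.
apply: (@caratheodory_measure_sigma_additive R X stone_outer F) => //.
- by move=> i; exact: borel_caratheodory.
- exact: borel_caratheodory.
Qed.

Definition stone_measure : {measure set (Borel X) -> \bar R} :=
  HB.pack_for {measure set (Borel X) -> \bar R}
    (outer_content : set (Borel X) -> \bar R)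
    (isMeasure.Build _ (Borel X) R (outer_content : set (Borel X) -> \bar R)
      outer_content0 outer_content_ge0 outer_content_sigma_additive).

Definition stone_probability : probability (Borel X) R :=
  HB.pack_for (probability (Borel X) R)
    (outer_content : set (Borel X) -> \bar R)
    (isMeasure.Build _ (Borel X) R (outer_content : set (Borel X) -> \bar R)
      outer_content0 outer_content_ge0 outer_content_sigma_additive)
    (Measure_isProbability.Build _ (Borel X) R stone_measure outer_contentT).

Lemma stone_probabilityE (E : set (Borel X)) : stone_probability E = outer_content E.
Proof. by []. Qed.

(** Outer regularity is built in; inner regularity follows by complements, as
    closed sets are compact. *)
Lemma stone_probability_regular : regular_borel stone_probability.
Proof.
move=> E mE; split.
  rewrite stone_probabilityE {1}/outer_content; congr ereal_inf.
  by apply/seteqP; split=> _ [U [oU EU] <-]; exists U => //;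
    rewrite stone_probabilityE outer_content_open.
apply/eqP; rewrite eq_le; apply/andP; split; last first.
  by apply: ge_ereal_sup => _ [K [_ KE] <-]; exact: outer_content_le.
apply/lee_addgt0Pr => e e0.
have [_ [U [oU EU] <-] Ult] := lb_ereal_inf_adherent e0 (outer_content_fin (~` E)).
have mUo : measurable (U : set (Borel X)) by exact: borel_open.
have cU : compact (~` U).
  by apply: (subclosed_compact _ hX) => //; exact: open_closedC.
have UE : ~` U `<=` E by move=> x Ux; apply: contrapT => Ex; apply: Ux; exact: EU.
apply: (@le_trans _ _ (stone_probability (~` U) + e%:E)); last first.
  by apply: leeD => //; apply: ereal_sup_ubound; exists (~` U).
rewrite (probability_setC stone_probability mUo).
have EC : stone_probability E = 1 - stone_probability (~` E).
  by rewrite -(probability_setC stone_probability (measurableC mE)) setCK.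
rewrite [X in X <= _]EC.
have {Ult} : open_content U < outer_content (~` E) + e%:E by [].
rewrite -(outer_content_open oU) !stone_probabilityE.
rewrite -(fineK (outer_content_fin U)) -(fineK (outer_content_fin (~` E))).
by rewrite -!EFinB -!EFinD lte_fin lee_fin; lra.
Qed.

Lemma stone_probability_homeo (t t' : X -> X) : continuous t -> continuous t' ->
  cancel t t' -> cancel t' t ->
  (forall K, clopen K -> m (t @` K) = m K) ->
  forall E : set (Borel X), stone_probability (t @` E) = stone_probability E.
Proof.
have le (t1 t2 : X -> X) (E : set X) : continuous t1 -> continuous t2 ->
    cancel t1 t2 -> cancel t2 t1 -> (forall K, clopen K -> m (t1 @` K) = m K) ->
    outer_content (t1 @` E) <= outer_content E.
  move=> c1 c2 K1 K2 tm; apply: le_ereal_inf_tmp => _ [V [oV EV] <-].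
  have im (A : set X) : t1 @` A = t2 @^-1` A.
    apply/seteqP; split=> [_ [x Ax <-]|x Ax] /=; first by rewrite K1.
    by exists (t2 x).
  have pre (A : set X) : t2 @` A = t1 @^-1` A.
    apply/seteqP; split=> [_ [x Ax <-]|x Ax] /=; first by rewrite K2.
    by exists (t1 x).
  have oW : open (t1 @` V) by rewrite im; move/continuousP: c2; exact.
  apply: (@le_trans _ _ (open_content (t1 @` V))).
    rewrite -outer_content_open//; apply: outer_content_le.
    exact: image_subset.
  apply: ge_ereal_sup => _ [K [cK KV] <-].
  have cL : clopen (t2 @` K) by rewrite pre; exact: preimage_clopen.
  have -> : m K = m (t2 @` K).
    by rewrite -(tm _ cL) image_comp (eq_imagel (f' := id)) ?image_id// => x _ /=; rewrite K2.
  apply: open_content_ge => // _ [x Kx <-].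
  by have [v Vv <-] := KV _ Kx; rewrite K1.
move=> c1 c2 K1 K2 tm E; apply/eqP; rewrite !stone_probabilityE eq_le (le t t')//=.
have tm' K : clopen K -> m (t' @` K) = m K.
  move=> cK; have cL : clopen (t' @` K).
    have -> : t' @` K = t @^-1` K.
      apply/seteqP; split=> [_ [x Ax <-]|x Ax] /=; first by rewrite K2.
      by exists (t x).
    exact: preimage_clopen.
  rewrite -(tm _ cL) image_comp (eq_imagel (f' := id)) ?image_id// => x _ /=.
  by rewrite K2.
have := le t' t (t @` E) c2 c1 K2 K1 tm'.
by rewrite image_comp (eq_imagel (f' := id)) ?image_id// => x _ /=; rewrite K1.
Qed.

End clopen_content.

(** * From invariance under the full group to invariance under the groupoid *)

Section full_group_to_groupoid.
Variables (R : realType) (G : topGroupoid).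
Hypotheses (hG : ample G) (hX : compact [set: units G]).
Local Notation X := (units G).

Lemma theta_src (U : set G) g : full_bisection U -> U g -> theta U (src g) = rng g.
Proof.
move=> [_ _ [_ sI] _ sU] Ug; have [Us ss] := src_sectionP sU (src g).
by rewrite /theta /=; congr rng; apply: sI; rewrite ?inE.
Qed.

Lemma open_unt (D : set X) : open D -> open (unt @` D : set G).
Proof.
move=> oD; have [_ oR _ _ _] := full_bisection1 hG hX.
rewrite (_ : _ @` _ = range unt `&` src @^-1` D).
  by apply: openI => //; move/continuousP: (@src_continuous G); exact.
apply/seteqP; split=> [_ [x Dx <-]|_ [[x _ <-] /=]].
  by split; [exists x|rewrite /= src_unt].
by rewrite src_unt => Dx; exists x.
Qed.

Lemma open_ginv (U : set G) : open U -> open (ginv @` U).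
Proof.
move=> oU; rewrite (_ : _ @` _ = ginv @^-1` U).
  by move/continuousP: (@ginv_continuous G); exact.
apply/seteqP; split=> [_ [g Ug <-]|g Ug] /=; first by rewrite ginvK.
by exists (ginv g) => //; rewrite ginvK.
Qed.

Lemma rng_ginv (U : set G) : rng @` (ginv @` U) = src @` U.
Proof.
by rewrite image_comp; apply: eq_imagel => g _ /=; rewrite rng_inv.
Qed.

Lemma src_ginv (U : set G) : src @` (ginv @` U) = rng @` U.
Proof.
by rewrite image_comp; apply: eq_imagel => g _ /=; rewrite src_inv.
Qed.

Lemma bisection_ginv (U : set G) : bisection U -> bisection (ginv @` U).
Proof.
move=> [rI sI]; split=> _ _ /set_mem[g Ug <-] /set_mem[h Uh <-].
- by rewrite !rng_inv => /sI; rewrite !inE => ->.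
- by rewrite !src_inv => /rI; rewrite !inE => ->.
Qed.

(** The involution of the unit space that exchanges s(T) and r(T) along T and
    fixes the rest, when s(T) and r(T) are disjoint. *)
Definition bisection_swap (T : set G) : set G :=
  T `|` ginv @` T `|` unt @` (~` (rng @` T `|` src @` T)).

Lemma bisection_swapP (T : set G) : compact_open_bisection T ->
  rng @` T `&` src @` T = set0 -> full_bisection (bisection_swap T).
Proof.
move=> [cT oT [rI sI]] rs0.
have hXX : hausdorff_space X := units_hausdorff hG.
have rs g h : T g -> T h -> rng g <> src h.
  move=> Tg Th gh; have : (rng @` T `&` src @` T) (rng g).
    by split; [exists g|exists h].
  by rewrite rs0.
have cI (p : G -> X) : continuous p -> closed (p @` T).
  move=> cp; apply: compact_closed => //; apply: continuous_compact => //.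
  exact: continuous_subspaceT.
have oZ : open (~` (rng @` T `|` src @` T)).
  apply: closed_openC; apply: closedU; apply: cI.
    exact: rng_continuous.
  exact: src_continuous.
have full (p : G -> X) : p = rng \/ p = src -> p @` bisection_swap T = setT.
  move=> pE; apply/seteqP; split=> // x _.
  have [[g Tg gx]|xr] := pselect ((rng @` T) x).
    case: pE => ->; first by exists g => //; left; left.
    by exists (ginv g); rewrite ?src_inv//; left; right; exists g.
  have [[g Tg gx]|xs] := pselect ((src @` T) x).
    case: pE => ->; last by exists g => //; left; left.
    by exists (ginv g); rewrite ?rng_inv//; left; right; exists g.
  have Z : bisection_swap T (unt x) by right; exists x => // -[].
  by case: pE => ->; exists (unt x); rewrite ?rng_unt ?src_unt.
apply: full_bisection_intro => //; first last.
- exact: (full _ (or_intror erefl)).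
- exact: (full _ (or_introl erefl)).
- split=> g h /set_mem Ug /set_mem Uh.
  + case: Ug => [[Tg|[g' Tg <-]]|[x nx <-]]; case: Uh => [[Th|[h' Th <-]]|[y ny <-]];
      rewrite ?rng_inv ?rng_unt.
    * by apply: rI; rewrite inE.
    * by move=> /rs; case.
    * by move=> gy; exfalso; apply: ny; left; exists g.
    * by move=> /esym/rs; case.
    * by move=> /sI; rewrite !inE => ->.
    * by move=> gy; exfalso; apply: ny; right; exists g'.
    * by move=> xh; exfalso; apply: nx; left; exists h.
    * by move=> xh; exfalso; apply: nx; right; exists h'.
    * by move=> ->.
  + case: Ug => [[Tg|[g' Tg <-]]|[x nx <-]]; case: Uh => [[Th|[h' Th <-]]|[y ny <-]];
      rewrite ?src_inv ?src_unt.
    * by apply: sI; rewrite inE.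
    * by move=> /esym/rs; case.
    * by move=> gy; exfalso; apply: ny; right; exists g.
    * by move=> /rs; case.
    * by move=> /rI; rewrite !inE => ->.
    * by move=> gy; exfalso; apply: ny; left; exists g'.
    * by move=> xh; exfalso; apply: nx; right; exists h.
    * by move=> xh; exfalso; apply: nx; left; exists h'.
    * by move=> ->.
- by apply: openU; [apply: openU => //; exact: open_ginv|exact: open_unt].
Qed.

Variable mu : probability (Borel X) R.
Hypotheses (mu_reg : regular_borel mu) (mu_inv : full_group_invariant hG hX mu).

Lemma measurable_rng (U : set G) : open U -> measurable (rng @` U : set (Borel X)).
Proof.
by move=> oU; apply: borel_open; apply: local_homeo_open => //; case: hG.
Qed.

Lemma measurable_src (U : set G) : open U -> measurable (src @` U : set (Borel X)).
Proof.
by move=> oU; apply: borel_open; apply: local_homeo_open => //; case: hG.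
Qed.

Lemma probabilityU (A B : set (Borel X)) : measurable A -> measurable B ->
  A `&` B = set0 -> mu (A `|` B) = (mu A + mu B)%E.
Proof. exact: measureU. Qed.

Lemma probability_le (A B : set (Borel X)) : measurable A -> measurable B ->
  A `<=` B -> (mu A <= mu B)%E.
Proof. by move=> mA mB AB; apply: le_measure; rewrite ?inE. Qed.

Lemma invariant_disjoint (T : set G) : compact_open_bisection T ->
  rng @` T `&` src @` T = set0 -> mu (rng @` T) = mu (src @` T).
Proof.
move=> cT rs0; have fU := bisection_swapP cT rs0.
pose U : full_group hG hX := SigSub (mem_set fU).
have [_ oT _] := cT.
have <- := mu_inv U (measurable_src oT).
congr (mu _); rewrite image_comp; apply: eq_imagel => g Tg /=.
by rewrite theta_src//; left; left.
Qed.

(** By inner regularity it is enough to compare on compact sets K in s(E).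
    Since r and s differ on E, each point of s(E) is the source of an arrow in a
    compact open bisection with disjoint source and range, on which
    bisection_swap applies; K is covered by finitely many such sources. *)
Lemma invariant_le (E : set G) : open E -> bisection E ->
  (forall g, E g -> rng g <> src g) -> (mu (src @` E) <= mu (rng @` E))%E.
Proof.
move=> oE [rI sI] ne.
have hXX : hausdorff_space X := units_hausdorff hG.
have [_ hGG lr ls _] := hG.
have opre (A : set X) : open A -> open (E `&` src @^-1` A).
  move=> oA; apply: openI => //.
  by move/continuousP: (@src_continuous G); exact.
(* again asked of every clopen part, to make overlapping pieces disjoint *)
pose P (A : set X) := [/\ clopen A, A `<=` src @` E & forall A', clopen A' ->
  A' `<=` A -> mu A' = mu (rng @` (E `&` src @^-1` A'))].
have [_ ->] := mu_reg (measurable_src oE).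
apply: ge_ereal_sup => _ [K [cK KE] <-].
have [U KU [cU UE PU]] : exists2 U, K `<=` U & P U.
  apply: compact_ind => //.
  - split; [exact: clopen0|by []|move=> A' _].
    by rewrite subset0 => ->; rewrite preimage_set0 setI0 !image_set0.
  - move=> A B [cA AE PA] [cB BE PB]; split.
    + exact: clopenU.
    + by rewrite subUset.
    move=> A' cA' A'AB.
    have c1 : clopen (A' `&` A) by exact: clopenI.
    have c2 : clopen (A' `&` ~` A) by apply: clopenI => //; exact: clopenC.
    have mo (Y : set X) : clopen Y -> measurable (Y : set (Borel X)).
      by case=> oY _; exact: borel_open.
    have -> : A' = (A' `&` A) `|` (A' `&` ~` A) by rewrite -setIUr setUCr setIT.
    rewrite preimage_setU setIUr image_setU !probabilityU//.
    + by rewrite (PA _ c1) ?(PB _ c2)// => x [/A'AB[]].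
    + by apply: measurable_rng; apply: opre; case: c1.
    + by apply: measurable_rng; apply: opre; case: c2.
    + rewrite -subset0 => _ [[g [Eg [_ Ag]] <-] [h [Eh [_ Ah]] hg]].
      apply: Ah; suff -> : h = g by [].
      by apply: rI; rewrite ?inE.
    + exact: mo.
    + exact: mo.
    + by rewrite -subset0 => x [[_ ?] [_]].
  - move=> _ /KE [g Eg <-].
    have gE : rng g != src g by apply/eqP; exact: ne.
    have := hXX; rewrite open_hausdorff => /(_ _ _ gE)[[V W] /= [/set_mem Vg /set_mem Wg]].
    move=> [oV oW /eqP VW].
    have [T [bT Tg TO]] := @compact_open_bisection_basis G hG hX g
      (E `&` rng @^-1` V `&` src @^-1` W) (open_nbhs_nbhs (conj
        (openI (openI oE (open_preimage (@rng_continuous G) oV))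
          (open_preimage (@src_continuous G) oW)) (conj (conj Eg Vg) Wg))).
    have [cT oT _] := bT.
    have oA : open (src @` T) by exact: local_homeo_open.
    have cA : clopen (src @` T).
      split => //; apply: compact_closed => //; apply: continuous_compact => //.
      by apply: continuous_subspaceT; exact: src_continuous.
    exists (src @` T); first by apply: open_nbhs_nbhs; split => //; exists g.
    split => //; first by move=> _ [t /TO[[Et _] _] <-]; exists t.
    move=> A' [oA' cA'] A'T.
    have ET : E `&` src @^-1` A' = T `&` src @^-1` A'.
      apply/seteqP; split=> [e [Ee /= Ae]|e [Te Ae]]; last first.
        by split => //; have [[]] := TO _ Te.
      have [t Tt te] := A'T _ Ae; have [[Et _] _] := TO _ Tt.
      suff <- : t = e by split => //=; rewrite te.
      by apply: sI; rewrite ?inE.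
    have bT' : compact_open_bisection (T `&` src @^-1` A').
      split.
      - apply: compact_closedI => //; move/continuous_closedP: (@src_continuous G).
        exact.
      - by rewrite -ET; exact: opre.
      - split=> x y /set_mem[/TO[[Ex _] _] _] /set_mem[/TO[[Ey _] _] _].
          by apply: rI; rewrite inE.
        by apply: sI; rewrite inE.
    rewrite ET invariant_disjoint//.
      congr (mu _); apply/seteqP; split=> [x Ax|_ [t [_ At] <-//]].
      have [t Tt tx] := A'T _ Ax; exists t => //; split => //=.
      by rewrite tx.
    rewrite -subset0 => _ [[t [/TO[[_ Vt] _] _] <-] [u [/TO[_ Wu] _] ut]].
    by rewrite -VW; split => //; rewrite -ut.
have mU : measurable (U : set (Borel X)) by apply: borel_open; case: cU.
apply: (@le_trans _ _ (mu U)).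
  apply: probability_le => //; rewrite -[K]setCK; apply: measurableC.
  apply: borel_open; apply: closed_openC; exact: compact_closed.
rewrite (PU U cU)//; apply: probability_le.
- by apply: measurable_rng; apply: opre; case: cU.
- exact: measurable_rng.
- by apply: image_subset => g [].
Qed.

(** Where r and s agree there is nothing to prove; the rest E of S is handled by
    the inequality above, applied to E and to its inverse. *)
Lemma full_group_invariant_groupoid : groupoid_invariant mu.
Proof.
move=> S oS bS; have hXX : hausdorff_space X := units_hausdorff hG.
pose E := S `&` [set g | rng g <> src g].
have oE : open E.
  rewrite openE => g [Sg /= /eqP ne].
  have := hXX; rewrite open_hausdorff => /(_ _ _ ne)[[V W] /= [/set_mem Vg /set_mem Wg]].
  move=> [oV oW /eqP VW].
  have oO := openI (openI oS (open_preimage (@rng_continuous G) oV))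
          (open_preimage (@src_continuous G) oW).
  have : nbhs g (S `&` rng @^-1` V `&` src @^-1` W).
    by apply: open_nbhs_nbhs; split.
  apply: filterS => h [[Sh Vh] Wh]; split => //= hh.
  have : (V `&` W) (rng h) by split => //; rewrite hh.
  by rewrite VW.
have bE : bisection E.
  by case: bS => rI sI; split=> x y /set_mem[Sx _] /set_mem[Sy _];
    [apply: rI|apply: sI]; rewrite inE.
have EE : mu (rng @` E) = mu (src @` E).
  apply/eqP; rewrite eq_le (invariant_le oE bE) ?andbT; last by move=> g [].
  rewrite -(src_ginv E) -(rng_ginv E); apply: invariant_le.
  - exact: open_ginv.
  - exact: bisection_ginv.
  - by move=> _ [g [_ /= gE] <-]; rewrite rng_inv src_inv => /esym.
have D (p : G -> X) : set_inj S p -> p @` S `\` p @` E = p @` (S `\` E).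
  move=> pI; apply/seteqP; split=> [_ [[g Sg <-] nE]|_ [g [Sg nE] <-]].
    by exists g => //; split => // Eg; apply: nE; exists g.
  split; first by exists g.
  move=> [h [Sh Eh] hg]; apply: nE; suff <- : h = g by split.
  by apply: pI; rewrite ?inE.
have split (p : G -> X) : set_inj S p -> open (p @` S) -> open (p @` E) ->
    mu (p @` S) = (mu (p @` E) + mu (p @` (S `\` E)))%E.
  move=> pI o1 o2; rewrite -D// -probabilityU.
  - by rewrite setDUK//; apply: image_subset => g [].
  - exact: borel_open.
  - by apply: measurableD; exact: borel_open.
  - by rewrite setDE setICA setICr setI0.
have [_ _ lr ls _] := hG; have [rI sI] := bS.
rewrite !split//; try exact: local_homeo_open.
rewrite EE; congr (_ + mu _)%E; apply: eq_imagel => g [Sg nE].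
by apply: contrapT => gE; apply: nE; split.
Qed.

End full_group_to_groupoid.

(** * C*-algebra arithmetic and the representation of the full group *)

Section real_norm.
Variables (R : realType) (V : normedModType (Cplx R)).
Implicit Types x y : V.

Lemma rnorm_ge0 x : 0 <= rnorm x.
Proof. by rewrite -lecR -normCplx_rnorm normr_ge0. Qed.

Lemma rnormD x y : rnorm (x + y) <= rnorm x + rnorm y.
Proof.
have : `|x + y| <= `|x| + `|y| by exact: ler_normD.
by rewrite !normCplx_rnorm -rmorphD lecR.
Qed.

Lemma rnormZ (a : Cplx R) x : rnorm (a *: x) = modulus a * rnorm x.
Proof.
have : `|a *: x| = `|a| * `|x| by exact: normrZ.
by rewrite !normCplx_rnorm -rmorphM => /complexI.
Qed.

Lemma rnormN x : rnorm (- x) = rnorm x.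
Proof. by rewrite /rnorm normrN. Qed.

Lemma rnormB x y : rnorm (x - y) = rnorm (y - x).
Proof. by rewrite /rnorm distrC. Qed.

Lemma rnorm0 : rnorm (0 : V) = 0.
Proof. by rewrite /rnorm normr0. Qed.

Lemma rnorm_eq0 x : rnorm x = 0 -> x = 0.
Proof. by move=> x0; apply/eqP; rewrite -normr_eq0 normCplx_rnorm x0. Qed.

Lemma closure_rnorm (B : set V) x (e : R) : closure B x -> 0 < e ->
  exists2 y, B y & rnorm (x - y) < e.
Proof.
move=> clx e0; have [|y [By]] := clx (ball x e%:C%C).
  by apply: nbhsx_ballx; rewrite ltcR.
by rewrite -ball_normE /= normCplx_rnorm ltcR; exists y.
Qed.

End real_norm.

Section cstar_basics.
Variables (R : realType) (A : cstarAlgType R).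
Implicit Types x y : A.

Lemma cmul0l x : cmul 0 x = 0.
Proof. by rewrite -(scale0r (0 : A)) cmulZl !scale0r. Qed.

Lemma cmul0r x : cmul x 0 = 0.
Proof. by rewrite -(scale0r (0 : A)) cmulZr !scale0r. Qed.

Lemma cmulNl x y : cmul (- x) y = - cmul x y.
Proof. by rewrite -scaleN1r cmulZl scaleN1r. Qed.

Lemma cmulNr x y : cmul x (- y) = - cmul x y.
Proof. by rewrite -scaleN1r cmulZr scaleN1r. Qed.

Lemma cmulBl x y z : cmul (x - y) z = cmul x z - cmul y z.
Proof. by rewrite cmulDl cmulNl. Qed.

Lemma cmulBr x y z : cmul z (x - y) = cmul z x - cmul z y.
Proof. by rewrite cmulDr cmulNr. Qed.

Lemma star0 : star (0 : A) = 0.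
Proof. by rewrite -(scale0r (0 : A)) starZ rmorph0 !scale0r. Qed.

Lemma starN x : star (- x) = - star x.
Proof. by rewrite -scaleN1r starZ rmorphN rmorph1 scaleN1r. Qed.

Lemma starB x y : star (x - y) = star x - star y.
Proof. by rewrite starD starN. Qed.

Lemma star1 : star (cone : A) = cone.
Proof. by rewrite -[LHS]cmul1r -[X in cmul _ X]starK -starM cmul1r starK. Qed.

Lemma rnormM x y : rnorm (cmul x y) <= rnorm x * rnorm y.
Proof.
have : `|cmul x y| <= `|x| * `|y| by exact: cnormM.
by rewrite !normCplx_rnorm -rmorphM lecR.
Qed.

Lemma rnorm_cstar x : rnorm (cmul (star x) x) = rnorm x ^+ 2.
Proof.
have : `|cmul (star x) x| = `|x| ^+ 2 by exact: cnorm_star.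
by rewrite !normCplx_rnorm -rmorphXn => /complexI.
Qed.

(** The C*-identity gives |x|^2 <= |x^*| |x|, and the same for x^*. *)
Lemma rnorm_star x : rnorm (star x) = rnorm x.
Proof.
have le y : rnorm y <= rnorm (star y).
  have [->|y0] := eqVneq (rnorm y) 0; first exact: rnorm_ge0.
  have yp : 0 < rnorm y by rewrite lt_neqAle eq_sym y0 rnorm_ge0.
  by rewrite -(ler_pM2r yp) -expr2 -rnorm_cstar rnormM.
by apply/eqP; rewrite eq_le -{2}[x]starK !le.
Qed.

Lemma star_sum (I : Type) (s : seq I) (F : I -> A) :
  star (\sum_(i <- s) F i) = \sum_(i <- s) star (F i).
Proof. exact: (big_morph star (@starD _ A) star0). Qed.

Lemma cmul_suml (I : Type) (s : seq I) (F : I -> A) y :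
  cmul (\sum_(i <- s) F i) y = \sum_(i <- s) cmul (F i) y.
Proof.
by apply: (big_morph (fun x => cmul x y)); [move=> u v; exact: cmulDl|exact: cmul0l].
Qed.

Lemma cmul_sumr (I : Type) (s : seq I) (F : I -> A) y :
  cmul y (\sum_(i <- s) F i) = \sum_(i <- s) cmul y (F i).
Proof.
by apply: (big_morph (cmul y)); [move=> u v; exact: cmulDr|exact: cmul0r].
Qed.

End cstar_basics.

Section full_group_representation.
Variables (R : realType) (G : topGroupoid).
Hypotheses (hG : ample G) (hX : compact [set: units G]).
Local Notation X := (units G).
Local Notation Cx := (Cplx R).
Variable A : full_cstar R G.
Local Notation Gam := (full_group hG hX).
Local Notation rep := (@pi_rep R G A hG hX).

(** A factorization g = a b with a in U is determined by r(a) = r(g), so the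
    convolution sum has at most one nonzero term. *)
Lemma conv_indic (U V : set G) : set_inj U rng ->
  Defs.conv (\1_U : G -> Cx) \1_V = \1_(bmul U V).
Proof.
move=> rI; rewrite conv_convolution; apply/funext => g.
pose F a : Cx := \1_U a * \1_V (gmul (ginv a) g).
have F0 a : ~ U a -> F a = 0 by move=> Ua; rewrite /F indicE memNset// mul0r.
have -> : convolution \1_U \1_V g = fibre_sum rng F (rng g) by [].
have [[u Uu ug]|nU] := pselect ((rng @` U) (rng g)); last first.
  rewrite (fibre_sum_out F0 nU) indicE memNset// => -[u [v [Uu Vv uv gE]]].
  by apply: nU; exists u => //; rewrite gE rng_mul.
rewrite -ug (fibre_sum_inj rI F0 Uu) /F !indicE mem_set// mul1r.
suff -> : (gmul (ginv u) g \in V) = (g \in bmul U V) by [].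
apply/idP/idP => [/set_mem Vg|/set_mem[u' [v [Uu' Vv uv gE]]]].
  rewrite inE; exists u, (gmul (ginv u) g).
  by rewrite rng_mul ?src_inv ?rng_inv// gmulA ?rng_inv ?src_inv// gmulV ug gmul1l.
rewrite inE; have -> : u = u' by apply: rI; rewrite ?inE// ug gE rng_mul.
by rewrite gE gmulA ?src_inv// gmulVl uv gmul1l.
Qed.

Lemma adj_indic (U : set G) : adj (\1_U : G -> Cx) = \1_(ginv @` U).
Proof.
apply/funext => g; rewrite /adj !indicE rmorph_nat.
suff -> : (ginv g \in U) = (g \in ginv @` U) by [].
apply/idP/idP => [/set_mem Ug|/set_mem[h Uh <-]]; rewrite inE ?ginvK//.
by exists (ginv g) => //; rewrite ginvK.
Qed.

Lemma bisection_Cc (U : Gam) : Cc (\1_(val U) : G -> Cx).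
Proof. by have [? ? _ _ _] := set_mem (valP U); exact: Cc_indic. Qed.

Lemma repM (U V : Gam) : rep (U * V)%g = cmul (rep U) (rep V).
Proof.
have [_ _ [rI _] _ _] := set_mem (valP U).
rewrite /pi_rep -embedM; try exact: bisection_Cc.
by rewrite conv_indic.
Qed.

Lemma repV (U : Gam) : rep U^-1%g = star (rep U).
Proof. by rewrite /pi_rep -embed_star ?adj_indic//; exact: bisection_Cc. Qed.

(** The indicator of the units is a left unit for the convolution algebra, hence
    by density for the completion, and a left unit equals the unit. *)
Lemma rep1 : rep 1%g = cone.
Proof.
have unit f : Cc f -> cmul (rep 1%g) (embed A f) = embed A f.
  move=> Cf; rewrite /pi_rep -embedM//; last exact: bisection_Cc.
  congr embed; rewrite conv_convolution; apply/funext => g.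
  pose F a : Cx := \1_(range (@unt G)) a * f (gmul (ginv a) g).
  have F0 a : ~ range (@unt G) a -> F a = 0.
    by move=> Ua; rewrite /F indicE memNset// mul0r.
  have -> : convolution \1_(val (1%g : Gam)) f g = fibre_sum rng F (rng g) by [].
  have rI : set_inj (range (@unt G)) rng.
    by move=> _ _ /set_mem[x _ <-] /set_mem[y _ <-]; rewrite !rng_unt => ->.
  have Ug : range (@unt G) (unt (rng g)) by exists (rng g).
  rewrite -(rng_unt (rng g)) (fibre_sum_inj rI F0 Ug) /F indicE mem_set// mul1r.
  congr f; have -> : ginv (unt (rng g)) = unt (rng g).
    by rewrite -[LHS]gmul1r src_inv rng_unt gmulVl src_unt.
  by rewrite gmul1l.
apply/eqP; rewrite -subr_eq0; apply/eqP/rnorm_eq0/eqP.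
rewrite eq_le rnorm_ge0 andbT; apply/ler_addgt0Pr => e e0; rewrite add0r.
pose M := rnorm (rep 1%g) + 1; have M0 : 0 < M by rewrite ltr_wpDl ?rnorm_ge0.
have [|_ [f Cf <-] fe] := @closure_rnorm R A (embed A @` @Cc R G) cone (e / M) _ (divr_gt0 e0 M0).
  by rewrite embed_dense.
set y := embed A f in fe.
have -> : rep 1%g - cone = cmul (rep 1%g) (cone - y) - (cone - y).
  by rewrite cmulBr unit// cmul1r opprB addrA subrK.
apply: (le_trans (rnormD _ _)); rewrite rnormN.
apply: (@le_trans _ _ (M * rnorm (cone - y))).
  by rewrite mulrDl mul1r lerD2r rnormM.
by rewrite mulrC -ler_pdivlMr// ltW.
Qed.

End full_group_representation.

(** * A character from weak containment *)

Section character_of_weak_containment.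
Variables (R : realType) (Gam : groupType) (A : cstarAlgType R).
Local Notation Cx := (Cplx R).
Variable rep : Gam -> A.
Hypotheses (repM : forall g h, rep (g * h)%g = cmul (rep g) (rep h))
  (repV : forall g, rep g^-1%g = star (rep g)) (rep1 : rep 1%g = cone).
Hypothesis triv : weakly_contains rep (@trivial_rep R Gam).
Implicit Types (s t : seq (Cx * Gam)) (x y : A) (c d : Cx).

(** A formal sum stands for an element of the group algebra: its value under the
    representation and its value under the trivial representation. *)
Definition formal_value s : A := \sum_(p <- s) p.1 *: rep p.2.
Definition augmentation s : Cx := \sum_(p <- s) p.1.

Lemma augmentation_le s : modulus (augmentation s) <= rnorm (formal_value s).
Proof.
have := triv s.
have -> : \sum_(p <- s) p.1 *: trivial_rep R p.2 = augmentation s :> Cx.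
  by apply: eq_bigr => p _; exact: mulr1.
by rewrite !normCplx_rnorm lecR.
Qed.

Definition formal_mul s t : seq (Cx * Gam) :=
  [seq (p.1 * q.1, (p.2 * q.2)%g) | p <- s, q <- t].

Lemma formal_valueM s t :
  formal_value (formal_mul s t) = cmul (formal_value s) (formal_value t).
Proof.
rewrite /formal_value /formal_mul big_allpairs_dep cmul_suml.
apply: eq_bigr => p _; rewrite cmul_sumr; apply: eq_bigr => q _.
by rewrite cmulZl cmulZr scalerA repM.
Qed.

Lemma augmentationM s t :
  augmentation (formal_mul s t) = augmentation s * augmentation t.
Proof.
rewrite /augmentation /formal_mul big_allpairs_dep mulr_suml.
by apply: eq_bigr => p _; rewrite mulr_sumr.
Qed.

Definition formal_star s : seq (Cx * Gam) := [seq (p.1^*, (p.2^-1)%g) | p <- s].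

Lemma formal_value_star s : formal_value (formal_star s) = star (formal_value s).
Proof.
rewrite /formal_value /formal_star big_map star_sum; apply: eq_bigr => p _.
by rewrite starZ repV.
Qed.

Lemma augmentation_star s : augmentation (formal_star s) = (augmentation s)^*.
Proof.
by rewrite /augmentation /formal_star big_map rmorph_sum.
Qed.

Definition formal_scale a s : seq (Cx * Gam) := [seq (a * p.1, p.2) | p <- s].

Lemma formal_valueZ a s : formal_value (formal_scale a s) = a *: formal_value s.
Proof.
rewrite /formal_value /formal_scale big_map scaler_sumr.
by apply: eq_bigr => p _; rewrite scalerA.
Qed.

Lemma augmentationZ a s : augmentation (formal_scale a s) = a * augmentation s.
Proof. by rewrite /augmentation /formal_scale big_map mulr_sumr. Qed.

Lemma formal_valueD s t : formal_value (s ++ t) = formal_value s + formal_value t.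
Proof. by rewrite /formal_value big_cat. Qed.

Lemma augmentationD s t : augmentation (s ++ t) = augmentation s + augmentation t.
Proof. by rewrite /augmentation big_cat. Qed.

(** The closure of the graph of the augmentation.  By weak containment it is the
    graph of a contractive function, whose domain is the generated
    C*-subalgebra.  Working with the graph avoids choosing limits before the
    algebraic identities are known. *)
Definition char_graph x c : Prop := forall e : R, 0 < e ->
  exists s, rnorm (x - formal_value s) < e /\ modulus (c - augmentation s) < e.

Lemma char_graph_formal s : char_graph (formal_value s) (augmentation s).
Proof.
move=> e e0; exists s; rewrite !subrr rnorm0; split=> //.
by rewrite [modulus _](@rnorm0 R Cx).
Qed.

Lemma char_graph_rep g : char_graph (rep g) 1.
Proof.
have := char_graph_formal [:: (1, g)].
by rewrite /formal_value /augmentation !big_seq1 scale1r.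
Qed.

(** Contractivity on formal sums survives in the closure of the graph; as the
    graph is linear, this also makes it single-valued. *)
Lemma char_graph_le x c : char_graph x c -> modulus c <= rnorm x.
Proof.
move=> xc; apply/ler_addgt0Pr => e e0.
have [s [xs cs]] := xc (e / 2) (divr_gt0 e0 (ltr0Sn _ _)).
have h1 := modulusD (c - augmentation s) (augmentation s).
have h2 := rnormD (formal_value s - x) x.
rewrite subrK in h1; rewrite subrK rnormB in h2.
have := augmentation_le s; lra.
Qed.

Lemma char_graphD x y c d : char_graph x c -> char_graph y d ->
  char_graph (x + y) (c + d).
Proof.
move=> xc yd e e0; have e2 : 0 < e / 2 by rewrite divr_gt0.
have [s [xs cs]] := xc _ e2; have [t [yt dt]] := yd _ e2.
exists (s ++ t); split; rewrite [e]splitr.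
- rewrite formal_valueD opprD addrACA.
  by apply: (le_lt_trans (rnormD _ _)); exact: ltrD.
- rewrite augmentationD opprD addrACA.
  by apply: (le_lt_trans (modulusD _ _)); exact: ltrD.
Qed.

Lemma char_graphZ a x c : char_graph x c -> char_graph (a *: x) (a * c).
Proof.
move=> xc e e0.
have a1 : 0 < modulus a + 1 by rewrite ltr_wpDl// modulus_ge0.
have [s [xs cs]] := xc _ (divr_gt0 e0 a1).
exists (formal_scale a s).
rewrite formal_valueZ augmentationZ -scalerBr -mulrBr rnormZ modulusM.
have lt (r : R) : 0 <= r -> r < e / (modulus a + 1) -> modulus a * r < e.
  move=> r0; rewrite ltr_pdivlMr// mulrDr mulr1 mulrC => h.
  by apply: le_lt_trans h; rewrite lerDl.
by split; apply: lt => //; [exact: rnorm_ge0|exact: modulus_ge0].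
Qed.

Lemma char_graph_star x c : char_graph x c -> char_graph (star x) c^*.
Proof.
move=> xc e e0; have [s [xs cs]] := xc _ e0; exists (formal_star s).
rewrite formal_value_star augmentation_star -starB -rmorphB rnorm_star.
by rewrite modulus_conj.
Qed.

Lemma char_graphM x y c d : char_graph x c -> char_graph y d ->
  char_graph (cmul x y) (c * d).
Proof.
move=> xc yd e e0.
(* with errors at most r <= 1, the error of the product is at most r * N *)
pose N := rnorm x + rnorm y + modulus c + modulus d + 1.
have hx := rnorm_ge0 x; have hy := rnorm_ge0 y.
have hc := modulus_ge0 c; have hd := modulus_ge0 d.
have N0 : 0 < N by rewrite /N; lra.
pose r := Num.min 1 (e / (N * 2)).
have r0 : 0 < r by rewrite lt_min ltr01 divr_gt0// mulr_gt0.
have r1 : r <= 1 by rewrite ge_min lexx.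
have rN : r * N < e.
  apply: (@le_lt_trans _ _ (e / 2)); last by lra.
  have : r <= e / (N * 2) by rewrite ge_min lexx orbT.
  rewrite ler_pdivlMr ?mulr_gt0// ler_pdivlMr//; lra.
have [s [xs cs]] := xc _ r0; have [t [yt dt]] := yd _ r0.
have bnd (a b a' b' : R) : 0 <= a -> 0 <= b -> 0 <= a' -> 0 <= b' -> a + b + 1 <= N ->
    a' < r -> b' < r -> a' * (b + b') + a * b' < e.
  move=> a0 b0 a'0 b'0 abN a'r b'r.
  apply: le_lt_trans rN; apply: (@le_trans _ _ (r * (a + b + 1))); last first.
    by rewrite ler_pM2l.
  have -> : r * (a + b + 1) = r * (b + 1) + a * r by ring.
  apply: lerD; last by rewrite ler_wpM2l// ltW.
  by apply: ler_pM => //; [lra|exact: ltW|lra].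
exists (formal_mul s t); rewrite formal_valueM augmentationM; split.
- have -> : cmul x y - cmul (formal_value s) (formal_value t) =
     cmul (x - formal_value s) (y + (formal_value t - y)) + cmul x (y - formal_value t).
    have -> : y + (formal_value t - y) = formal_value t by rewrite addrC subrK.
    by rewrite cmulBl cmulBr [RHS]addrC addrA subrK.
  apply: (le_lt_trans (rnormD _ _)).
  apply: (@le_lt_trans _ _ (rnorm (x - formal_value s) *
    (rnorm y + rnorm (y - formal_value t)) + rnorm x * rnorm (y - formal_value t))).
    apply: lerD; last exact: rnormM.
    apply: (le_trans (rnormM _ _)); apply: ler_wpM2l; first exact: rnorm_ge0.
    by rewrite [leRHS]addrC rnormB addrC; apply: rnormD.
  by apply: bnd => //; try exact: rnorm_ge0; rewrite /N; lra.
- have -> : c * d - augmentation s * augmentation t =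
     (c - augmentation s) * (d + (augmentation t - d)) + c * (d - augmentation t).
    by ring.
  apply: (le_lt_trans (modulusD _ _)); rewrite !modulusM.
  apply: (@le_lt_trans _ _ (modulus (c - augmentation s) *
    (modulus d + modulus (d - augmentation t)) + modulus c * modulus (d - augmentation t))).
    apply: lerD => //; apply: ler_wpM2l; first exact: modulus_ge0.
    by apply: (le_trans (modulusD _ _)); rewrite lerD2l [X in _ <= X](@rnormB R Cx).
  by apply: bnd => //; try exact: modulus_ge0; rewrite /N; lra.
Qed.

Lemma char_graph_fun x c d : char_graph x c -> char_graph x d -> c = d.
Proof.
move=> xc xd; have := char_graphD xc (char_graphZ (- 1) xd).
rewrite scaleN1r subrr mulN1r => /char_graph_le; rewrite rnorm0 => h.
apply/eqP; rewrite -subr_eq0; apply/eqP; apply: (@rnorm_eq0 R Cx).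
by apply/eqP; rewrite eq_le rnorm_ge0 andbT.
Qed.

(** Near a point x of the closure the values of the character form a Cauchy
    filter, by contractivity; its limit is the value at x. *)
Lemma char_domain_closed : closed [set x | exists c, char_graph x c].
Proof.
move=> x clx.
pose F : set_system Cx := [set B | exists2 e : R, 0 < e &
  forall y c, char_graph y c -> rnorm (x - y) < e -> B c].
have FF : ProperFilter F.
  split.
    move=> [e e0 /=].
    by have [y [c yc] xy] := closure_rnorm clx e0; move=> /(_ y c yc xy).
  split.
  - by exists 1.
  - move=> B B' [e e0 HB] [e' e'0 HB']; exists (Num.min e e'); first by rewrite lt_min e0.
    by move=> y c yc; rewrite lt_min => /andP[h h']; split; [exact: HB yc h|exact: HB' yc h'].
  - by move=> B B' BB' [e e0 HB]; exists e => // y c yc h; apply: BB'; exact: HB yc h.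
have Fc : cauchy F.
  apply: cauchy_exP => e e0.
  have eE : e = (complex.Re e)%:C%C by rewrite RRe_real// gtr0_real.
  have r0 : 0 < complex.Re e by rewrite -ltcR -eE.
  have r2 : 0 < complex.Re e / 2 by rewrite divr_gt0.
  have [y [c yc] xy] := closure_rnorm clx r2.
  exists c, (complex.Re e / 2) => // y' c' yc' xy'.
  rewrite -ball_normE /= eE normCplx_rnorm ltcR.
  apply: (@le_lt_trans _ _ (rnorm (y - y'))).
    have := char_graphD yc (char_graphZ (- 1) yc').
    by rewrite scaleN1r mulN1r; exact: char_graph_le.
  rewrite -[y](subrK x) -addrA (le_lt_trans (rnormD _ _))// rnormB.
  by rewrite [complex.Re e]splitr ltrD.
have := @Cplx_complete R F FF Fc; move=> /cvg_ex[c Fc'].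
exists c => e e0; have e2 : 0 < e / 2 by rewrite divr_gt0.
have : F (ball c (e / 2)%:C%C).
  by apply: Fc'; apply: nbhsx_ballx; rewrite ltcR.
move=> [r r0 Hr].
have [y [c' yc'] ] := closure_rnorm clx (e := Num.min r (e / 2)) ltac:(by rewrite lt_min r0).
rewrite lt_min => /andP[xyr xye].
have := Hr _ _ yc' xyr; rewrite -ball_normE /= normCplx_rnorm ltcR => cc'.
have [s [ys cs]] := yc' _ e2.
exists s; split; rewrite [e]splitr.
- rewrite -[x](subrK y) -addrA; apply: (le_lt_trans (rnormD _ _)); exact: ltrD.
- rewrite -[c](subrK c') -addrA; apply: (le_lt_trans (modulusD _ _)); exact: ltrD.
Qed.

Lemma weak_containment_character :
  admits_character (smallest (@cstar_subalgebra R A) (range rep)).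
Proof.
pose D := [set x | exists c, char_graph x c].
have sub : smallest (@cstar_subalgebra R A) (range rep) `<=` D.
  apply: smallest_sub.
    split.
    - exact: char_domain_closed.
    - exists 0; have := char_graph_formal [::].
      by rewrite /formal_value /augmentation !big_nil.
    - move=> x y [c xc] [d yd]; split.
        by exists (c + d); exact: char_graphD.
      by exists (c * d); exact: char_graphM.
    - by move=> a x [c xc]; exists (a * c); exact: char_graphZ.
    - by move=> x [c xc]; exists c^*; exact: char_graph_star.
  by move=> _ [g _ <-]; exists 1; exact: char_graph_rep.
pose chi x : Cx := xget 0 [set c | char_graph x c].
have chiP x c : char_graph x c -> chi x = c.
  move=> xc; rewrite /chi; case: xgetP => [d _ xd|/(_ c)//].
  exact: char_graph_fun xd xc.
have chiG x : D x -> char_graph x (chi x) by move=> [c xc]; rewrite (chiP _ _ xc).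
exists chi; split.
- by apply: chiP; rewrite -rep1; exact: char_graph_rep.
- move=> x y /set_mem/sub/chiG xc /set_mem/sub/chiG yd; apply: chiP.
  exact: char_graphD.
- move=> x y /set_mem/sub/chiG xc /set_mem/sub/chiG yd; apply: chiP.
  exact: char_graphM.
- by move=> a x /set_mem/sub/chiG xc; apply: chiP; exact: char_graphZ.
- by move=> x /set_mem/sub/chiG xc; apply: chiP; exact: char_graph_star.
Qed.

End character_of_weak_containment.

(** * The Hahn-Banach theorem *)

Section hahn_banach.
Variables (R : realType) (V : lmodType (Cplx R)) (p : V -> R).
Local Notation "r ** x" := ((r%:C%C : Cplx R) *: x) (at level 40).
Hypotheses (pD : forall x y, p (x + y) <= p x + p y)
  (pZ : forall (r : R) x, 0 <= r -> p (r ** x) = r * p x).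

(** Partial real-linear functionals dominated by p, as graphs.  Being a function
    follows from domination, and unions of chains are then easy. *)
Definition dominated_graph (Gr : set (V * R)) : Prop :=
  [/\ Gr (0, 0),
      forall x y a b (r : R), Gr (x, a) -> Gr (y, b) -> Gr (x + r ** y, a + r * b)
    & forall x a, Gr (x, a) -> a <= p x].

Lemma dominated_graphZ Gr x a (r : R) : dominated_graph Gr -> Gr (x, a) ->
  Gr (r ** x, r * a).
Proof. by move=> [G0 GL _] Gx; have := GL _ _ _ _ r G0 Gx; rewrite !add0r. Qed.

(** The one-dimensional step: the value al at v must satisfy
    b - p(y - v) <= al <= p(y + v) - b for all (y, b) in the graph, and
    subadditivity of p leaves room for it. *)
Lemma dominated_graph_extend Gr v : dominated_graph Gr ->
  exists Gr', [/\ dominated_graph Gr', Gr `<=` Gr' & exists a, Gr' (v, a)].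
Proof.
move=> dG; have [G0 GL Gp] := dG.
pose T : set R := [set z.2 - p (z.1 - v) | z in Gr].
have Tub y' b' : Gr (y', b') -> ubound T (p (y' + v) - b').
  move=> Gy' _ [[y b] Gy <-] /=.
  have /Gp := GL _ _ _ _ 1 Gy Gy'; rewrite scale1r mul1r => h.
  have := pD (y - v) (y' + v); rewrite addrACA addNr addr0; lra.
have T0 : T !=set0 by exists (0 - p (0 - v)), (0, 0).
have supT : has_sup T by split => //; exists (p (0 + v) - 0); exact: Tub.
pose al := sup T.
have ge y b : Gr (y, b) -> b - p (y - v) <= al.
  by move=> Gy; apply: ub_le_sup; [case: supT|exists (y, b)].
have le y b : Gr (y, b) -> al <= p (y + v) - b.
  by move=> Gy; apply: ge_sup => //; exact: Tub.
exists [set z | exists y b (r : R), Gr (y, b) /\ z = (y + r ** v, b + r * al)].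
split.
- split.
  + by exists 0, 0, 0; rewrite scale0r mul0r !addr0.
  + move=> _ _ _ _ r [y [b [s [Gy [-> ->]]]]] [y' [b' [s' [Gy' [-> ->]]]]].
    exists (y + r ** y'), (b + r * b'), (s + r * s'); split; first exact: GL.
    congr pair; last by ring.
    by rewrite scalerDr scalerA rmorphD rmorphM scalerDl addrACA.
  + move=> _ _ [y [b [r [Gy [-> ->]]]]].
    have [r0|r0|->] := ltgtP r 0; last by rewrite scale0r mul0r !addr0; exact: Gp.
    * have s0 : 0 < - r by rewrite oppr_gt0.
      have := ge _ _ (dominated_graphZ (- r)^-1 dG Gy).
      have -> : y + r ** v = (- r) ** ((- r)^-1 ** y - v).
        rewrite scalerBr scalerA -rmorphM divff ?gt_eqF// scale1r rmorphN scaleNr opprK.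
        by [].
      rewrite (pZ _ (ltW s0)) => h.
      have := ler_wpM2l (ltW s0) h; rewrite mulrBr mulrA divff ?gt_eqF// mul1r; lra.
    * have := le _ _ (dominated_graphZ r^-1 dG Gy).
      have -> : y + r ** v = r ** (r^-1 ** y + v).
        by rewrite scalerDr scalerA -rmorphM divff ?gt_eqF// scale1r.
      rewrite (pZ _ (ltW r0)) => h.
      have := ler_wpM2l (ltW r0) h; rewrite mulrBr mulrA divff ?gt_eqF// mul1r; lra.
- by move=> [y b] Gy; exists y, b, 0; rewrite scale0r mul0r !addr0.
- by exists al, 0, 0, 1; rewrite scale1r mul1r !add0r.
Qed.

Lemma dominated_graph_fun Gr x a b : dominated_graph Gr -> Gr (x, a) -> Gr (x, b) ->
  a = b.
Proof.
move=> dG; have [G0 GL Gp] := dG.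
have p0 : p 0 = 0 by rewrite -(scale0r (0 : V)) (pZ 0 (lexx _)) mul0r.
have le c d : Gr (x, c) -> Gr (x, d) -> c <= d.
  move=> Gc Gd; have /Gp := GL _ _ _ _ (- 1) Gc Gd.
  by rewrite rmorphN rmorph1 scaleN1r subrr p0 mulN1r subr_le0.
by move=> Ga Gb; apply/eqP; rewrite eq_le !le.
Qed.

Lemma hahn_banach G0 : dominated_graph G0 ->
  exists f : V -> R, [/\ forall x y (r : R), f (x + r ** y) = f x + r * f y,
    forall x, f x <= p x & forall x a, G0 (x, a) -> f x = a].
Proof.
move=> d0.
(* G0 is adjoined so that the union of the empty chain satisfies P too *)
pose P (Gr : set (V * R)) := dominated_graph (G0 `|` Gr).
have [F Ftot|Gr [PGr Gmax]] := @Zorn_bigcup _ P.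
  move=> tot; rewrite /P.
  have [[Y FY]|nF] := pselect (exists Y, F Y); last first.
    rewrite (_ : \bigcup_(X in F) X = set0) ?setU0//.
    by rewrite -subset0 => z [Y FY _]; apply: nF; exists Y.
  have sup z z' : (G0 `|` \bigcup_(X in F) X) z -> (G0 `|` \bigcup_(X in F) X) z' ->
      exists Y, [/\ F Y, (G0 `|` Y) z & (G0 `|` Y) z'].
    move=> [z0|[Y1 FY1 z1]] [z'0|[Y2 FY2 z2]].
    - by exists Y; split=> //; left.
    - by exists Y2; split=> //; [left|right].
    - by exists Y1; split=> //; [right|left].
    - have [Y12|Y21] := tot _ _ FY1 FY2.
        by exists Y2; split=> //; right => //; exact: Y12.
      by exists Y1; split=> //; right => //; exact: Y21.
  have sub Z : F Z -> G0 `|` Z `<=` G0 `|` \bigcup_(X in F) X.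
    by move=> FZ z [?|Zz]; [left|right; exists Z].
  split.
  - by left; case: d0.
  - move=> x y a b r Gx Gy; have [Z [FZ Zx Zy]] := sup _ _ Gx Gy.
    by apply: (sub Z) => //; have [_ GL _] := Ftot _ FZ; exact: GL.
  - move=> x a Gx; have [Z [FZ Zx _]] := sup _ _ Gx Gx.
    by have [_ _ Gp] := Ftot _ FZ; exact: Gp.
have tot v : exists a, (G0 `|` Gr) (v, a).
  have [Gr' [d' sub [a Ga]]] := dominated_graph_extend v PGr.
  exists a; apply: contrapT => na.
  apply: (Gmax Gr').
    split; first by move=> z Gz; apply: sub; right.
    by move=> GG; apply: na; right; apply: GG.
  rewrite /P (_ : G0 `|` Gr' = Gr')//; apply/setUidPr => z Gz.
  by apply: sub; left.
have [f fP] := choice tot.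
have [_ GL Gp] := PGr.
exists f; split.
- move=> x y r; apply: (dominated_graph_fun PGr (fP _)).
  exact: GL.
- by move=> x; exact: Gp.
- by move=> x a G0x; apply: (dominated_graph_fun PGr (fP _)); left.
Qed.

End hahn_banach.

(** * Characters: contractivity and multiplicative domain *)

Section characters.
Variables (R : realType) (A : cstarAlgType R) (B : set A).
Local Notation Cx := (Cplx R).
Hypotheses (subB : cstar_subalgebra B) (B1 : B cone).
Implicit Types x y z : A.

Lemma cstar_subD x y : B x -> B y -> B (x + y).
Proof. by move=> Bx By; case: subB => _ _ /(_ _ _ Bx By)[]. Qed.

Lemma cstar_subM x y : B x -> B y -> B (cmul x y).
Proof. by move=> Bx By; case: subB => _ _ /(_ _ _ Bx By)[]. Qed.

Lemma cstar_subZ (a : Cx) x : B x -> B (a *: x).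
Proof. by case: subB => _ _ _ /(_ a x). Qed.

Lemma cstar_subS x : B x -> B (star x).
Proof. by case: subB => _ _ _ _ /(_ x). Qed.

Lemma cstar_sub0 : B 0.
Proof. by case: subB. Qed.

Lemma cstar_sub_closed x : (forall e : R, 0 < e -> exists2 y, B y & rnorm (x - y) < e) -> B x.
Proof.
have [cB _ _ _ _] := subB; move=> h; apply: cB => O /nbhs_ballP[e /= e0 eO].
have eE : e = (complex.Re e)%:C%C by rewrite RRe_real// gtr0_real.
have r0 : 0 < complex.Re e by rewrite -ltcR -eE.
have [y By xy] := h _ r0; exists y; split => //; apply: eO.
by rewrite -ball_normE /= eE normCplx_rnorm ltcR.
Qed.

Definition cpow x n : A := iter n (cmul x) cone.

Lemma cpowSr x n : cpow x n.+1 = cmul (cpow x n) x.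
Proof.
elim: n => [|n IH]; first by rewrite /cpow /= cmul1l cmul1r.
have -> : cpow x n.+2 = cmul x (cpow x n.+1) by [].
by rewrite {1}IH cmulA.
Qed.

Lemma rnorm_cone_le1 : rnorm (cone : A) <= 1.
Proof.
have := rnorm_cstar (cone : A); rewrite star1 cmul1l => h.
have h0 := rnorm_ge0 (cone : A).
rewrite leNgt; apply/negP => h1; have : rnorm (cone : A) * 1 < rnorm (cone : A) ^+ 2.
  by rewrite expr2 ltr_pM2l// (lt_trans _ h1).
by rewrite -h mulr1 ltxx.
Qed.

Lemma rnorm_cpow x n : rnorm (cpow x n) <= rnorm x ^+ n.
Proof.
elim: n => [|n IH]; first by rewrite expr0; exact: rnorm_cone_le1.
rewrite exprS (le_trans (rnormM _ _))// ler_wpM2l// rnorm_ge0//.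
Qed.

Definition csum x n : A := \sum_(i < n) cpow x i.

Lemma csumS x n : csum x n.+1 = csum x n + cpow x n.
Proof. by rewrite /csum big_ord_recr. Qed.

Lemma cstar_sub_cpow x n : B x -> B (cpow x n).
Proof. by move=> Bx; elim: n => [|n IH]; [exact: B1|exact: cstar_subM]. Qed.

Lemma cstar_sub_csum x n : B x -> B (csum x n).
Proof.
move=> Bx; elim: n => [|n IH]; first by rewrite /csum big_ord0; exact: cstar_sub0.
by rewrite csumS; apply: cstar_subD => //; exact: cstar_sub_cpow.
Qed.

Lemma csum_telescope x n : cmul (csum x n) (x - cone) = cpow x n - cone.
Proof.
elim: n => [|n IH]; first by rewrite /csum big_ord0 cmul0l /cpow /= subrr.
rewrite csumS cmulDl IH cmulBr cmul1r -cpowSr.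
by rewrite addrC addrA subrK.
Qed.

(** The partial sums of the geometric series form a Cauchy sequence in the
    closed subalgebra B, so a left inverse of 1 - x is found in B itself. *)
Lemma neumann x : B x -> rnorm x < 1 -> exists2 y, B y & cmul y (cone - x) = cone.
Proof.
move=> Bx; set r := rnorm x => r1; have r0 : 0 <= r by exact: rnorm_ge0.
have tail N k : (1 - r) * rnorm (csum x (N + k) - csum x N) <= r ^+ N - r ^+ (N + k).
  elim: k => [|k IH]; first by rewrite addn0 !subrr rnorm0 mulr0.
  rewrite addnS csumS addrAC.
  have := rnormD (csum x (N + k) - csum x N) (cpow x (N + k)).
  have := rnorm_cpow x (N + k); rewrite -/r => h1 h2.
  have h3 := le_trans h2 (lerD (lexx _) h1).
  have r1' : 0 <= 1 - r by rewrite subr_ge0 ltW.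
  have := ler_wpM2l r1' h3; rewrite mulrDr exprS; lra.
have small (e : R) : 0 < e -> exists N, r ^+ N < e.
  move=> e0; have : (fun n => r ^+ n) @ \oo --> (0 : R).
    by apply: cvg_expr; rewrite ger0_norm.
  move=> /cvgrPdist_lt/(_ _ e0)[N _ /(_ N (leqnn N))]; rewrite sub0r normrN.
  by rewrite ger0_norm ?exprn_ge0//; exists N.
pose F : set_system A := [set D | exists N, forall n, (N <= n)%N -> D (csum x n)].
have FF : ProperFilter F.
  split; first by move=> [N /(_ N (leqnn N))].
  split.
  - by exists 0%N.
  - move=> D D' [N HN] [N' HN']; exists (maxn N N') => n; rewrite geq_max => /andP[h h'].
    by split; [exact: HN|exact: HN'].
  - by move=> D D' DD' [N HN]; exists N => n /HN/DD'.
have near_tail (e : R) : 0 < e -> exists N, forall n, (N <= n)%N ->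
    rnorm (csum x n - csum x N) < e.
  move=> e0; have r1' : 0 < 1 - r by rewrite subr_gt0.
  have [N HN] := small _ (mulr_gt0 r1' e0).
  exists N => n Nn; rewrite -(subnKC Nn).
  have := tail N (n - N)%N; have := exprn_ge0 (N + (n - N)) r0.
  rewrite -(ltr_pM2l r1'); lra.
have Fc : cauchy F.
  apply: cauchy_exP => e e0.
  have eE : e = (complex.Re e)%:C%C by rewrite RRe_real// gtr0_real.
  have re0 : 0 < complex.Re e by rewrite -ltcR -eE.
  have [N HN] := near_tail _ re0.
  exists (csum x N), N => n /HN; rewrite rnormB => h.
  by rewrite -ball_normE /= eE normCplx_rnorm ltcR.
have [y Fy] : exists y : A, F --> y by exists (lim F); exact: cauchy_cvg.
have lim (e : R) : 0 < e -> exists N, forall n, (N <= n)%N -> rnorm (y - csum x n) < e.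
  move=> e0; have : F (ball y e%:C%C).
    by apply: Fy; apply: nbhsx_ballx; rewrite ltcR.
  move=> [N HN]; exists N => n /HN; rewrite -ball_normE /= normCplx_rnorm.
  by rewrite ltcR.
exists y.
  apply: cstar_sub_closed => e /lim[N /(_ N (leqnn N)) h].
  by exists (csum x N) => //; exact: cstar_sub_csum.
apply/eqP; rewrite -subr_eq0; apply/eqP/rnorm_eq0/eqP.
rewrite eq_le rnorm_ge0 andbT; apply/ler_addgt0Pr => e e0; rewrite add0r.
pose M := rnorm (cone - x) + 1; have M0 : 0 < M by rewrite ltr_wpDl ?rnorm_ge0.
have [N HN] := lim (e / 2 / M) (divr_gt0 (divr_gt0 e0 (ltr0Sn _ _)) M0).
have [N' HN'] := small _ (divr_gt0 e0 (ltr0Sn _ 1)).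
pose n := maxn N N'.
have hn : rnorm (y - csum x n) < e / 2 / M by apply: HN; rewrite leq_maxl.
have hn' : rnorm (cpow x n) < e / 2.
  apply: le_lt_trans (rnorm_cpow x n) _; apply: le_lt_trans HN'.
  by apply: ler_wiXn2l; rewrite ?leq_maxr// ltW.
have E : cmul (csum x n) (cone - x) = cone - cpow x n.
  by rewrite -[cone - x]opprB cmulNr csum_telescope opprB.
have -> : cmul y (cone - x) - cone = cmul (y - csum x n) (cone - x) - cpow x n.
  by rewrite cmulBl E opprB addrA [RHS]addrAC addrK.
apply: (le_trans (rnormD _ _)); rewrite rnormN [e]splitr; apply: lerD; last exact: ltW.
apply: (le_trans (rnormM _ _)).
apply: (@le_trans _ _ (rnorm (y - csum x n) * M)).
  by rewrite ler_wpM2l ?rnorm_ge0// lerDl.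
by rewrite -ler_pdivlMr// ltW.
Qed.

Variable chi : A -> Cx.
Hypotheses (chi1 : chi cone = 1)
  (chiD : {in B &, forall x y, chi (x + y) = chi x + chi y})
  (chiM : {in B &, forall x y, chi (cmul x y) = chi x * chi y})
  (chiZ : forall a, {in B, forall x, chi (a *: x) = a * chi x})
  (chiS : {in B, forall x, chi (star x) = (chi x)^*}).

(** If |chi(x)| > |x|, then z = x / chi(x) has norm less than 1 and 1 - z has
    a left inverse in B although chi(1 - z) = 0. *)
Lemma character_le x : B x -> modulus (chi x) <= rnorm x.
Proof.
move=> Bx; rewrite leNgt; apply/negP => lt.
have m0 : 0 < modulus (chi x) by exact: le_lt_trans (rnorm_ge0 x) lt.
have c0 : chi x != 0.
  by apply/eqP => c0; move: m0; rewrite c0 [modulus _](@rnorm0 R Cx) ltxx.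
pose z := (chi x)^-1 *: x.
have Bz : B z by exact: cstar_subZ.
have chz : chi z = 1 by rewrite chiZ ?inE// mulVf.
have z1 : rnorm z < 1.
  rewrite rnormZ; have E : modulus (chi x)^-1 * modulus (chi x) = 1.
    by rewrite -modulusM mulVf// /modulus normr1.
  rewrite -[ltRHS]E ltr_pM2l// lt_neqAle modulus_ge0 andbT eq_sym.
  by apply/eqP => h; move: E; rewrite h mul0r => /esym/eqP; rewrite oner_eq0.
have [y By yz] := neumann Bz z1.
have Bn : B (- 1 *: z) by exact: cstar_subZ.
have Bc : B (cone + - 1 *: z) by exact: cstar_subD.
have : chi (cmul y (cone + - 1 *: z)) = 1 by rewrite scaleN1r yz.
rewrite chiM ?inE// chiD ?inE// chiZ ?inE// chi1 chz mulr1 subrr mulr0.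
by move=> /esym/eqP; rewrite oner_eq0.
Qed.

Definition real_linear (f : A -> R) :=
  forall x y (r : R), f (x + (r%:C%C : Cx) *: y) = f x + r * f y.

Lemma character_extension : exists f : A -> R,
  [/\ real_linear f, forall x, f x <= rnorm x & forall x, B x -> f x = complex.Re (chi x)].
Proof.
pose G0 : set (A * R) := [set z | B z.1 /\ z.2 = complex.Re (chi z.1)].
have ReZ' (r : R) (c : Cx) : complex.Re ((r%:C%C : Cx) * c) = r * complex.Re c.
  exact: ReZ.
have d0 : dominated_graph (@rnorm R A) G0.
  split.
  - split => /=; first exact: cstar_sub0.
    by rewrite -(scale0r (cone : A)) chiZ ?inE// mul0r.
  - move=> x y a b r [/= Bx ->] [/= By ->].
    have Bry : B ((r%:C%C : Cx) *: y) by exact: cstar_subZ.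
    split; first exact: cstar_subD.
    by rewrite /= chiD ?inE// chiZ ?inE// ReD ReZ'.
  - move=> x a [/= Bx ->]; rewrite (le_trans (ler_norm _))// (le_trans (Re_modulus _))//.
    exact: character_le.
have pZ (r : R) x : 0 <= r -> rnorm ((r%:C%C : Cx) *: x) = r * rnorm x.
  by move=> r0; rewrite rnormZ modulus_real ger0_norm.
have [f [fL fle fE]] := hahn_banach (@rnormD R A) pZ d0.
by exists f; split => // x Bx; apply: fE.
Qed.

Lemma real_linear0 f : real_linear f -> f 0 = 0.
Proof. by move=> fL; have := fL 0 0 1; rewrite scaler0 addr0; lra. Qed.

Lemma real_linearD f x y : real_linear f -> f (x + y) = f x + f y.
Proof. by move=> fL; have := fL x y 1; rewrite scale1r mul1r. Qed.

Lemma real_linearZ f x (r : R) : real_linear f -> f ((r%:C%C : Cx) *: x) = r * f x.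
Proof. by move=> fL; have := fL 0 x r; rewrite !add0r real_linear0// add0r. Qed.

Lemma real_linearN f x : real_linear f -> f (- x) = - f x.
Proof.
move=> fL; have := real_linearZ x (- 1) fL.
by rewrite rmorphN rmorph1 scaleN1r mulN1r.
Qed.

Lemma star_mulD x y (c : Cx) : c^* = c ->
  cmul (star (x + c *: y)) (x + c *: y) =
  (cmul (star x) x + c *: cmul (star x) y) +
  (c *: cmul (star y) x + (c * c) *: cmul (star y) y).
Proof.
by move=> cc; rewrite starD starZ cc cmulDl !cmulDr !cmulZl !cmulZr scalerA.
Qed.

(** An isometry v of B with chi(v) = 1 can be cancelled on the left under every
    norm-decreasing extension f of the real part of chi.  Instead of positivity
    and Cauchy-Schwarz, the proof averages and uses the C*-identity only.  Put
    x = (v - 1) b' and let q be the mean of the first n powers of v^*.  Then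
    chi(q) = 1, |q| <= 1 and q^* x is the telescoping sum (v^n - 1) b' / n,
    which is small, so
      (t + f(x))^2 = f(t q + x)^2 <= |t q + x|^2 <= t^2 + 2 t |q^* x| + |x|^2
    for every t > 0.  For f(x) > 0 this fails when n and then t are large. *)
Lemma extension_mull f v b : real_linear f -> (forall x, f x <= rnorm x) ->
  (forall x, B x -> f x = complex.Re (chi x)) ->
  B v -> chi v = 1 -> cmul (star v) v = cone ->
  f (cmul v b) = f b.
Proof.
move=> fL fle fE Bv chv vv.
have rv : rnorm v <= 1.
  rewrite -(ler_pXn2r (n := 2)) ?nnegrE ?rnorm_ge0// expr1n -rnorm_cstar vv.
  exact: rnorm_cone_le1.
have rpow n : rnorm (cpow v n) <= 1.
  by rewrite (le_trans (rnorm_cpow v n))// exprn_ile1// rnorm_ge0.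
have pos b' : f (cmul (v - cone) b') <= 0.
  set x := cmul (v - cone) b'; rewrite leNgt; apply/negP => fx.
  pose b1 := rnorm b' + 1; have b10 : 0 < b1 by rewrite ltr_wpDl ?rnorm_ge0.
  (* t and n are chosen so that t * f x > |x|^2 and 2 |q^* x| <= f x *)
  pose t := (rnorm x ^+ 2 + 1) / f x.
  have t0 : 0 < t by rewrite divr_gt0// ltr_wpDl ?sqr_ge0.
  have tf : t * f x = rnorm x ^+ 2 + 1 by rewrite /t divfK ?gt_eqF.
  have [n nb] : exists n : nat, 4 * rnorm b' <= n.+1%:R * f x.
    have h0 : 0 <= 4 * rnorm b' / f x.
      by rewrite divr_ge0 ?mulr_ge0 ?rnorm_ge0// ltW.
    exists (Num.bound (4 * rnorm b' / f x)); rewrite -ler_pdivrMr//.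
    by rewrite ltW// (lt_trans (archi_boundP h0))// ltr_nat.
  pose N : R := n.+1%:R; have N0 : 0 < N by rewrite ltr0n.
  pose q := (N^-1%:C%C : Cx) *: csum (star v) n.+1.
  have Bsv := cstar_subS Bv.
  have Bq : B q by apply: cstar_subZ; exact: cstar_sub_csum.
  have fq : f q = 1.
    have E k : chi (csum (star v) k) = k%:R.
      elim: k => [|k IH].
        by rewrite /csum big_ord0 -(scale0r (cone : A)) chiZ ?inE// mul0r.
      have Bk := cstar_sub_csum k Bsv; have Bpk := cstar_sub_cpow k Bsv.
      rewrite csumS chiD ?inE// IH -[RHS]natr1; congr (_ + _).
      elim: (k) => [//|j IHj]; have Bj := cstar_sub_cpow j Bsv.
      by rewrite [cpow _ _]/(cmul _ (cpow _ j)) chiM ?inE// IHj chiS ?inE// chv rmorph1 mulr1.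
    have Bc := cstar_sub_csum n.+1 Bsv.
    rewrite fE// /q chiZ ?inE// E ReZ.
    have -> : n.+1%:R = (N%:C%C : Cx) by rewrite rmorph_nat.
    by rewrite mulVf// gt_eqF.
  have sq : star q = (N^-1%:C%C : Cx) *: csum v n.+1.
    rewrite /q starZ; congr (_ *: _); first exact: conjc_real.
    rewrite /csum star_sum; apply: eq_bigr => i _.
    elim: (nat_of_ord i) => [|k IH]; first exact: star1.
    by rewrite [cpow (star v) _]/(cmul _ (cpow _ k)) starM IH starK -cpowSr.
  have modN : modulus (N^-1%:C%C : Cx) = N^-1.
    by rewrite modulus_real ger0_norm// invr_ge0 ltW.
  have rq : rnorm q <= 1.
    rewrite rnormZ modN mulrC ler_pdivrMr// mul1r /N.
    elim: (n.+1) => [|k IH]; first by rewrite /csum big_ord0 rnorm0.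
    rewrite csumS (le_trans (rnormD _ _))// -[leRHS]natr1 lerD//.
    rewrite (le_trans (rnorm_cpow _ _))// exprn_ile1 ?rnorm_ge0//.
    by rewrite rnorm_star.
  pose w := cmul (star q) x.
  have rw' : 2 * rnorm w <= f x.
    have -> : w = (N^-1%:C%C : Cx) *: cmul (cpow v n.+1 - cone) b'.
      by rewrite /w sq cmulZl /x cmulA csum_telescope.
    rewrite rnormZ modN.
    have h1 : rnorm (cmul (cpow v n.+1 - cone) b') <= 2 * rnorm b'.
      rewrite (le_trans (rnormM _ _))// ler_wpM2r ?rnorm_ge0//.
      rewrite (le_trans (rnormD _ _))// rnormN.
      by have := rpow n.+1; have := rnorm_cone_le1; lra.
    rewrite mulrCA ler_pdivrMl//; move: nb; rewrite -/N; lra.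
  pose tt := (t%:C%C : Cx).
  have st : tt^* = tt by exact: conjc_real.
  have mt : modulus tt = t by rewrite modulus_real ger0_norm// ltW.
  have H : t + f x <= rnorm (x + tt *: q).
    by apply: le_trans (fle _); rewrite fL fq mulr1 addrC.
  have H2 : rnorm (x + tt *: q) ^+ 2 <= t ^+ 2 + 2 * t * rnorm w + rnorm x ^+ 2.
    rewrite -rnorm_cstar.
    have -> : cmul (star (x + tt *: q)) (x + tt *: q) =
        (cmul (star x) x + tt *: star w) + (tt *: w + (tt * tt) *: cmul (star q) q).
      by rewrite star_mulD// /w starM starK.
    rewrite (le_trans (rnormD _ _))//.
    have h1 := rnormD (cmul (star x) x) (tt *: star w).
    have h2 := rnormD (tt *: w) ((tt * tt) *: cmul (star q) q).
    rewrite rnorm_cstar rnormZ rnorm_star mt in h1.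
    rewrite !rnormZ modulusM mt rnorm_cstar in h2.
    have h3 : t * t * rnorm q ^+ 2 <= t * t * 1.
      apply: ler_wpM2l; first by rewrite mulr_ge0// ltW.
      by rewrite exprn_ile1// rnorm_ge0.
    rewrite expr2; lra.
  have tfx : 0 <= t + f x by apply: addr_ge0; exact: ltW.
  have H3 : (t + f x) ^+ 2 <= rnorm (x + tt *: q) ^+ 2.
    by rewrite ler_pXn2r ?nnegrE// rnorm_ge0.
  have H4 : t * (2 * rnorm w) <= t * f x by apply: ler_wpM2l => //; exact: ltW.
  have := le_trans H3 H2; rewrite sqrrD; have := sqr_ge0 (f x); nra.
have e b' : f (cmul (v - cone) b') = 0.
  apply/eqP; rewrite eq_le pos /=.
  by have := pos (- b'); rewrite cmulNr real_linearN// oppr_le0.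
by have := e b; rewrite cmulBl cmul1l real_linearD// real_linearN//; lra.
Qed.

(** Rescaling u by the conjugate of the unimodular number chi(u) gives a unitary
    v with chi(v) = 1 and the same conjugation.  Multiplication by v^* on the
    right is handled by the functional whose value at x is f at x^*. *)
Lemma extension_conj f u b : real_linear f -> (forall x, f x <= rnorm x) ->
  (forall x, B x -> f x = complex.Re (chi x)) ->
  B u -> cmul (star u) u = cone -> cmul u (star u) = cone ->
  f (cmul (cmul u b) (star u)) = f b.
Proof.
move=> fL fle fE Bu uu uu'.
pose c := chi u; pose v := c^* *: u.
have Bv : B v by exact: cstar_subZ.
have cc : c^* * c = 1.
  rewrite /c -[X in _ = X]chi1 -uu chiM ?inE//; last exact: cstar_subS.
  by rewrite chiS ?inE.
have chv : chi v = 1 by rewrite chiZ ?inE.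
have vv : cmul (star v) v = cone.
  by rewrite /v starZ cmulZl cmulZr scalerA conjCK mulrC cc scale1r.
have -> : cmul (cmul u b) (star u) = cmul v (cmul b (star v)).
  by rewrite /v starZ conjCK cmulZr cmulZl cmulZr scalerA cc scale1r cmulA.
rewrite (extension_mull _ fL fle fE Bv chv vv).
pose g x := f (star x).
have gL : real_linear g.
  move=> x y r; rewrite /g starD starZ (_ : ((r%:C%C : Cx))^* = r%:C%C) ?fL//.
  exact: conjc_real.
have gle x : g x <= rnorm x by rewrite /g (le_trans (fle _))// rnorm_star.
have gE x : B x -> g x = complex.Re (chi x).
  move=> Bx; rewrite /g fE; last exact: cstar_subS.
  by rewrite chiS ?inE//; case: (chi x).
have := extension_mull (star b) gL gle gE Bv chv vv.
by rewrite /g starM !starK.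
Qed.

End characters.

(** * An invariant measure from a character *)

Lemma cstar_subalgebra_smallest (R : realType) (A : cstarAlgType R) (S : set A) :
  cstar_subalgebra (smallest (@cstar_subalgebra R A) S).
Proof.
split.
- by apply: closed_bigI => B [[]].
- by move=> B [[]].
- by move=> x y Bx By; split=> B [sB SB];
    have [_ _ /(_ x y (Bx _ (conj sB SB)) (By _ (conj sB SB)))[]] := sB.
- by move=> a x Bx B [sB SB]; have [_ _ _ /(_ a x (Bx _ (conj sB SB)))] := sB.
- by move=> x Bx B [sB SB]; have [_ _ _ _ /(_ x (Bx _ (conj sB SB)))] := sB.
Qed.

Section measure_of_character.
Variables (R : realType) (G : topGroupoid).
Hypotheses (hG : ample G) (hX : compact [set: units G]).
Local Notation X := (units G).
Local Notation Cx := (Cplx R).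
Variable A : full_cstar R G.
Local Notation Gam := (full_group hG hX).
Local Notation rep := (@pi_rep R G A hG hX).

Definition clopen_proj (K : set X) : A := embed A (\1_(unt @` K : set G)).

Lemma compact_unt (K : set X) : clopen K -> compact (unt @` K : set G).
Proof.
move=> [_ cK]; apply: continuous_compact; last exact: clopen_compact.
by apply: continuous_subspaceT; exact: unt_continuous.
Qed.

Lemma Cc_unt (K : set X) : clopen K -> Cc (\1_(unt @` K : set G) : G -> Cx).
Proof.
move=> cK; apply: Cc_indic => //; first exact: compact_unt.
by apply: open_unt => //; case: cK.
Qed.

Lemma ginv_unt (x : X) : ginv (unt x) = unt x :> G.
Proof. by rewrite -[LHS]gmul1r src_inv rng_unt gmulVl src_unt. Qed.

Lemma gmul_unt (x : X) : gmul (unt x) (unt x) = unt x :> G.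
Proof. by have := gmul1r (unt x : G); rewrite src_unt. Qed.

Lemma unt_inj_rng (K : set X) : set_inj (unt @` K : set G) rng.
Proof. by move=> _ _ /set_mem[x _ <-] /set_mem[y _ <-]; rewrite !rng_unt => ->. Qed.

Lemma clopen_projM (K : set X) : clopen K ->
  cmul (clopen_proj K) (clopen_proj K) = clopen_proj K.
Proof.
move=> cK; rewrite /clopen_proj -embedM; try exact: Cc_unt.
rewrite conv_indic; last exact: unt_inj_rng.
suff -> : bmul (unt @` K) (unt @` K) = unt @` K :> set G by [].
apply/seteqP; split=> [_ [_ [_ [[x Kx <-] [y Ky <-] + ->]]]|_ [x Kx <-]].
  rewrite src_unt rng_unt => <-; exists x => //.
  by rewrite gmul_unt.
exists (unt x), (unt x); split; try by exists x.
- by rewrite src_unt rng_unt.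
- by rewrite gmul_unt.
Qed.

Lemma clopen_proj_star (K : set X) : clopen K ->
  star (clopen_proj K) = clopen_proj K.
Proof.
move=> cK; rewrite /clopen_proj -embed_star; last exact: Cc_unt.
rewrite adj_indic image_comp (eq_imagel (f' := unt))// => x _ /=.
exact: ginv_unt.
Qed.

Lemma clopen_projU (K L : set X) : clopen K -> clopen L -> K `&` L = set0 ->
  clopen_proj (K `|` L) = clopen_proj K + clopen_proj L.
Proof.
move=> cK cL KL; rewrite /clopen_proj -embedD; try exact: Cc_unt.
congr embed; apply/funext => g; rewrite addfunE !indicE image_setU in_setU.
have [Kg|] := boolP (g \in unt @` K); have [Lg|] := boolP (g \in unt @` L);
  rewrite ?addr0 ?add0r//.
move: Kg Lg => /set_mem[x Kx <-] /set_mem[y Ly /(can_inj (@rng_unt G)) yx].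
have : (K `&` L) x by split => //; rewrite -yx.
by rewrite KL.
Qed.

Lemma clopen_projT : clopen_proj setT = cone.
Proof. by rewrite -(rep1 hG hX A). Qed.

(** Conjugation by the indicator of U moves the indicator of K to the indicator
    of theta_U(K): u x u^-1 is the unit at r(u) for u in U with s(u) = x. *)
Lemma clopen_proj_theta (U : Gam) (K : set X) : clopen K ->
  clopen_proj (theta (val U) @` K) =
  cmul (cmul (rep U) (clopen_proj K)) (star (rep U)).
Proof.
move=> cK; have fU := set_mem (valP U); have [cU oU [rI sI] rU sU] := fU.
have clU := compact_open_clopen hG cU oU.
rewrite -repV /pi_rep /clopen_proj -embedM; [|exact: bisection_Cc|exact: Cc_unt].
rewrite conv_indic//.
have bE : bmul (val U) (unt @` K) = val U `&` src @^-1` K.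
  apply/seteqP; split=> [_ [u [_ [Uu [x Kx <-] ux ->]]]|u [Uu Ku]].
    by rewrite rng_unt in ux; rewrite -ux gmul1r; split => //=; rewrite ux.
  exists u, (unt (src u)).
  by split; [|exists (src u)|rewrite rng_unt|rewrite gmul1r].
have cUK : compact (val U `&` src @^-1` K).
  apply: compact_closedI => //; move/continuous_closedP: (@src_continuous G).
  by apply; case: cK.
have oUK : open (val U `&` src @^-1` K).
  by apply: openI => //; apply: open_preimage; [exact: src_continuous|case: cK].
rewrite bE -embedM; [|exact: Cc_indic|exact: bisection_Cc].
rewrite conv_indic; last by move=> x y /set_mem[Ux _] /set_mem[Uy _]; apply: rI; rewrite inE.
suff -> : bmul (val U `&` src @^-1` K) (val (U^-1)%g) = unt @` (theta (val U) @` K).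
  by [].
apply/seteqP; split=> [_ [u [_ [[Uu Ku] [v Uv <-] uv ->]]]|_ [_ [x Kx <-] <-]].
  have -> : v = u by apply: sI; rewrite ?inE// uv rng_inv.
  by rewrite gmulV; exists (rng u) => //; exists (src u) => //; rewrite theta_src.
have [u Uu ux] : (src @` val U) x by rewrite sU.
exists u, (ginv u); split.
- by split => //=; rewrite ux.
- by exists u.
- by rewrite rng_inv.
- by rewrite gmulV -ux theta_src.
Qed.

Lemma theta_continuous (U : set G) : full_bisection U -> continuous (theta U).
Proof.
move=> [_ oU bU _ sU] x; apply: continuous_comp; last exact: rng_continuous.
exact: (src_section_continuous hG oU bU sU).
Qed.

Lemma thetaK (U : set G) : full_bisection U -> cancel (theta U) (theta (ginv @` U)).
Proof.
move=> fU x; have [_ _ _ _ sU] := fU.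
have [u Uu <-] : (src @` U) x by rewrite sU.
have Vu : (ginv @` U) (ginv u) by exists u.
rewrite (theta_src fU Uu) -src_inv (theta_src (full_bisectionV hG hX fU) Vu).
exact: rng_inv.
Qed.

(** The extension f of the real part of chi restricts to an additive function m
    of clopen sets.  Positivity of m holds because 1 - 2 e has norm at most 1
    for a projection e, and invariance under the full group because f is
    invariant under conjugation by the unitaries of the representation. *)
Lemma character_invariant_measure : admits_character (@cstar_pi R G A hG hX) ->
  exists mu : probability (Borel X) R,
    regular_borel mu /\ full_group_invariant hG hX mu.
Proof.
move=> [chi [chi1 chiD chiM chiZ chiS]].
pose B := @cstar_pi R G A hG hX.
have subB : cstar_subalgebra B by exact: cstar_subalgebra_smallest.
have Brep U : B (rep U) by move=> D [_]; apply; exists U.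
have B1 : B cone by rewrite -(rep1 hG hX A); exact: Brep.
have [f [fL fle fE]] := character_extension subB B1 chi1 chiD chiM chiZ.
pose m K := f (clopen_proj K).
have mT : m setT = 1 by rewrite /m clopen_projT fE// chi1.
have mU K L : clopen K -> clopen L -> K `&` L = set0 -> m (K `|` L) = m K + m L.
  by move=> cK cL KL; rewrite /m clopen_projU// real_linearD.
have m_ge0 K : clopen K -> 0 <= m K.
  move=> cK; pose y : A := cone + (((- 2)%:C%C : Cx) *: clopen_proj K).
  have y1 : rnorm y <= 1.
    rewrite -(ler_pXn2r (n := 2)) ?nnegrE ?rnorm_ge0// expr1n -rnorm_cstar.
    rewrite star_mulD; last exact: conjc_real.
    rewrite clopen_proj_star// star1 !cmul1l cmul1r clopen_projM//.
    rewrite -addrA -!scalerDl.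
    have -> : ((- 2)%:C%C : Cx) + ((- 2)%:C%C + (- 2)%:C%C * (- 2)%:C%C) = 0.
      rewrite -rmorphM -!rmorphD; have -> : - 2 + (- 2 + - 2 * - 2) = 0 :> R by ring.
      by [].
    by rewrite scale0r addr0; exact: rnorm_cone_le1.
  have := le_trans (fle y) y1; rewrite /y fL fE// chi1 /= -/(m K); lra.
have mtheta (U : Gam) K : clopen K -> m (theta (val U) @` K) = m K.
  move=> cK; rewrite /m clopen_proj_theta//.
  apply: (extension_conj subB B1 chi1 chiD chiM chiZ chiS _ fL fle fE) => //.
  - by rewrite -repV -repM mulVg; exact: rep1.
  - by rewrite -repV -repM mulgV; exact: rep1.
have hXX := units_hausdorff hG.
pose mu := stone_probability hX (units_clopen_basis hG hX) m_ge0 mU mT.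
exists mu; split.
  exact: stone_probability_regular.
move=> U E mE; have fU := set_mem (valP U).
have fV := full_bisectionV hG hX fU.
have VV : ginv @` (ginv @` val U) = val U.
  by rewrite image_comp (eq_imagel (f' := id)) ?image_id// => g _ /=; rewrite ginvK.
have K2 := thetaK fV; rewrite VV in K2.
exact: (stone_probability_homeo hX (units_clopen_basis hG hX) m_ge0 mU mT
  (theta_continuous fU) (theta_continuous fV) (thetaK fU) K2 (mtheta U)).
Qed.

End measure_of_character.

(** * The equivalence *)

Theorem corollary3p7 (R : realType) (G : topGroupoid) (hG : ample G)
    (hX : compact [set: units G]) (CstarG : full_cstar R G) :
  [<-> (exists mu : probability (Borel (units G)) R,
          regular_borel mu /\ groupoid_invariant mu);
       weakly_contains (@pi_rep R G CstarG hG hX)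
         (@trivial_rep R (full_group hG hX));
       admits_character (@cstar_pi R G CstarG hG hX);
       (exists mu : probability (Borel (units G)) R,
          regular_borel mu /\ full_group_invariant hG hX mu)].
Proof.
tfae.
- by move=> [mu [_ mu_inv]]; exact: invariant_weakly_contains mu_inv.
- by apply: weak_containment_character; [exact: repM|exact: repV|exact: rep1].
- exact: character_invariant_measure.
- move=> [mu [mu_reg mu_inv]]; exists mu; split => //.
  exact: full_group_invariant_groupoid mu_reg mu_inv.
Qed.
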